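(* Let $m\ge2$ and $n\ge2$ be integers with $m$ odd and $2m=n$, and let $0<\lambda<1$. Let $g:B_2(0)\setminus\{0\}\to[0,\infty)$ be continuous with $g(x)=o\left(|x|^{-\frac{n-2}{1-\lambda}}\right)$ as $x\to0$. Let $u$ be a $C^{2m}$ nonnegative solution of $$0\le-\Delta^m u\le e^{u^\lambda+g^\lambda}\quad\text{in }B_2(0)\setminus\{0\}\subset\mathbb{R}^n.$$ Then $u(x)=o\left(|x|^{-\frac{n-2}{1-\lambda}}\right)$ as $x\to0$.
   Context: $\Delta^m$ is the $m$-fold iterated Laplacian; $B_r(0)$ is the open ball of radius $r$ about the origin. *)

(* Defs.v *)
From mathcomp Require Import ssreflect ssrfun ssrbool eqtype ssrnat seq fintype bigop.
From Stdlib Require Import Reals.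
Set Implicit Arguments. Unset Strict Implicit.
Open Scope R_scope.

Definition pt (n : nat) := 'I_n -> R.

Definition norm (n : nat) (x : pt n) : R :=
  sqrt (\big[Rplus/0]_(i < n) (x i * x i)).

Definition vsub (n : nat) (x y : pt n) : pt n := fun i => x i - y i.

Definition upd (n : nat) (x : pt n) (i : 'I_n) (t : R) : pt n :=
  fun j => if j == i then t else x j.

Definition punct_ball2 (n : nat) (x : pt n) : Prop := 0 < norm x < 2.

Definition continuous_on (n : nat) (U : pt n -> Prop) (f : pt n -> R) : Prop :=
  forall x, U x -> forall eps, 0 < eps -> exists delta, 0 < delta /\
    forall y, U y -> norm (vsub y x) < delta -> Rabs (f y - f x) < eps.

(* Real power with the convention 0^a = 0 for a > 0 (Stdlib's Rpower 0 a = 1). *)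
Definition rpow (x a : R) : R := if Rle_dec x 0 then 0 else Rpower x a.

(* f is C^k on the open set U, and D is its family of partial derivatives:
   D [:: i1; ...; ij] = d_{i1} ( ... (d_{ij} f)) on U. *)
Definition Ck_with (n k : nat) (U : pt n -> Prop) (f : pt n -> R)
    (D : seq 'I_n -> pt n -> R) : Prop :=
  (forall x, U x -> D [::] x = f x) /\
  (forall l, leq (size l) k -> continuous_on U (D l)) /\
  (forall l i x, leq (S (size l)) k -> U x ->
     derivable_pt_lim (fun t => D l (upd x i t)) (x i) (D (i :: l) x)).

(* iter_lap D m [::] = Delta^m f, computed from the derivative family:
   Delta^m f = sum_{i1..im} d_{im}^2 ... d_{i1}^2 f. *)
Fixpoint iter_lap (n : nat) (D : seq 'I_n -> pt n -> R) (m : nat)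
    (l : seq 'I_n) (x : pt n) : R :=
  match m with
  | O => D l x
  | S m' => \big[Rplus/0]_(i < n) iter_lap D m' (i :: i :: l) x
  end.

Definition little_o_at0 (n : nat) (f : pt n -> R) (a : R) : Prop :=
  forall eps, 0 < eps -> exists delta, 0 < delta /\
    forall x, 0 < norm x < delta -> norm x < 2 ->
      Rabs (f x) <= eps * Rpower (norm x) (- a).

(* Main.v *)
(** Write [f = - Delta^m u >= 0], [n = 2m], [r = |x|]. Integrating against a radial
    function [Phi] that vanishes near the origin, satisfies [Delta^m Phi >= 0] there
    and grows like [|y|^(2m-2)] bounds both [int |y|^(2m-2) f] and the mean of [u] over
    [|y| ~ r] by [C r^(2-n)]. Since [m] is odd, the regularised logarithm
    [ln (1 / (|y-z|^2 + delta^2))] has [Delta^m] negative and concentrated at [z];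
    testing with a cut-off of it gives
    [c u(z) <= M ln (rho^2 / sigma^2) + C e^A sigma^n + C rho^(-n) int_B(z,rho) u],
    where [M = int_B(z,rho) f = o(r^(2-n))] and [f <= e^A] on [B(z,sigma)]. With
    [A = (4 u(z))^lam + O(r^(-a lam))], [a = (n-2)/(1-lam)], [z] a point where [u] is comparable to its
    supremum on a small ball, and [sigma = d e^(-A/n)], the right-hand side is
    absorbed by [u(z)] as soon as [u(x) >= eps r^(-a)].

    Integrals over [R^n] are replaced by Riemann sums over grids of [[-2,2]^n]:
    for compactly supported [C^1] functions the sums of a partial derivative tend
    to [0], and this is the only form of integration by parts the argument needs. *)

(* The exponent [a] is fixed by [a (1 - lam) = n - 2]. The logarithm costs the mass [M] a factor of
   order [A], hence of order [u(z)^lam], and [M u(z)^lam] is a small part of [u(z)] once [r^(2-n)]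
   is at most a multiple of [u(z)^(1-lam)], which is what [u(x) >= eps r^(-a)] provides. The choice
   of [sigma] turns [e^A sigma^n] into [d^n] and costs only [2 A / n] in the logarithm: the
   exponential growth is matched by the logarithmic fundamental solution of [Delta^m] in dimension
   [2m].

   Two obstacles shape the details. The bound [f <= e^A] near [z] needs [u] controlled by [u(z)] on
   a whole ball, so [x] has to be traded for another point. And no limit of the sums themselves is
   taken: each estimate holds for all large meshes, and the threshold on the mesh may depend on
   [eps] or [delta] while the constants may not. Uniformity in these parameters is therefore tracked
   from the start.

   Radial functions are written in [t = |y - z|^2], in which the Laplacian has polynomial
   coefficients. *)
From Coquelicot Require Import Coquelicot.
From HB Require Import structures.
Require Import Defs.
From mathcomp Require Import ssreflect ssrfun ssrbool eqtype ssrnat seq fintype bigop.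
From mathcomp Require Import finfun div binomial zify.
From Stdlib Require Import Factorial Reals Lra Lia FunctionalExtensionality Classical.
From Stdlib Require Import IndefiniteDescription.
Open Scope R_scope.

(** * Smooth families of functions of one variable *)

(* One predicate covers plain differentiability ([b = false]) and derivatives
   bounded uniformly in the parameter [p] ([b = true]). *)
Fixpoint smooth_family (b : bool) (P U : R -> Prop) (k : nat)
    (f : R -> R -> R) : Prop :=
  (b = true -> exists C, forall p t, P p -> U t -> Rabs (f p t) <= C) /\
  match k with
  | O => True
  | S k' => (forall p t, P p -> U t -> ex_derive (f p) t) /\
            smooth_family b P U k' (fun p => Derive (f p))
  end.

Lemma is_derive_eq (f : R -> R) (x l l' : R) :
  is_derive f x l -> l = l' -> is_derive f x l'.
Proof. by move=> + <-. Qed.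

Lemma is_derive_Rmult (f g : R -> R) (x f' g' : R) :
  is_derive f x f' -> is_derive g x g' ->
  is_derive (fun t => f t * g t) x (f' * g x + f x * g').
Proof. by move=> df dg; have := is_derive_mult _ _ _ _ _ df dg Rmult_comm; apply. Qed.

(** This is the Laplacian of [y |-> f (|y|^2)] in dimension [n], as a function of [t = |y|^2]. *)
Definition radial_lap (n : nat) (f : R -> R) (t : R) : R :=
  4 * t * Derive (Derive f) t + 2 * INR n * Derive f t.

Lemma smooth_family_subdomain (b : bool) (P U V : R -> Prop) k f :
  (forall t, V t -> U t) -> smooth_family b P U k f -> smooth_family b P V k f.
Proof.
move=> VU; elim: k f => [|k IH] f /= [bf Hf]; split.
- by move=> /bf [C HC]; exists C => p t Pp /VU; apply: HC.
- by [].
- by move=> /bf [C HC]; exists C => p t Pp /VU; apply: HC.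
- case: Hf => df Hf; split; last exact: IH.
  by move=> p t Pp /VU; apply: df.
Qed.

Section SmoothFamily.
Variables (b : bool) (P U : R -> Prop).
Hypothesis openU : open U.

Lemma Derive_ext_open (f g : R -> R) (t : R) :
  (forall s, U s -> f s = g s) -> U t -> Derive f t = Derive g t.
Proof.
move=> fg Ut; apply: Derive_ext_loc.
by apply: filter_imp (openU t Ut) => s; apply: fg.
Qed.

Lemma smooth_family_ext k f g :
  (forall p t, P p -> U t -> f p t = g p t) ->
  smooth_family b P U k f -> smooth_family b P U k g.
Proof.
elim: k f g => [|k IH] f g fg /= [bf Hf]; split.
- move=> /bf [C HC]; exists C => p t Pp Ut; rewrite -fg //; exact: HC.
- by [].
- move=> /bf [C HC]; exists C => p t Pp Ut; rewrite -fg //; exact: HC.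
- case: Hf => df Hf; split.
  + move=> p t Pp Ut; apply: ex_derive_ext_loc (df p t Pp Ut).
    by apply: filter_imp (openU t Ut) => s; apply: fg.
  + apply: IH Hf => p t Pp Ut; apply: Derive_ext_open => // s Us; exact: fg.
Qed.

Lemma smooth_family_pred k f :
  smooth_family b P U (S k) f -> smooth_family b P U k f.
Proof.
elim: k f => [|k IH] f /= [bf [df Hf]]; split => //.
by split => //; apply: IH.
Qed.

Lemma smooth_family_le k l f :
  (k <= l)%coq_nat -> smooth_family b P U l f -> smooth_family b P U k f.
Proof. by move=> kl; elim: kl f => // l' _ IH f /smooth_family_pred; apply: IH. Qed.

Lemma smooth_family_derive k f :
  smooth_family b P U (S k) f -> smooth_family b P U k (fun p => Derive (f p)).
Proof. by move=> /= [_ []]. Qed.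

Lemma smooth_family_ex_derive k f :
  smooth_family b P U (S k) f -> forall p t, P p -> U t -> ex_derive (f p) t.
Proof. by move=> /= [_ []]. Qed.

(** The pattern of most closure proofs below: a closed formula for the derivative replaces [Derive],
    and openness of [U] lets the replacement be differentiated again. *)
Lemma smooth_family_intro k f f' :
  (b = true -> exists C, forall p t, P p -> U t -> Rabs (f p t) <= C) ->
  (forall p t, P p -> U t -> is_derive (f p) t (f' p t)) ->
  smooth_family b P U k f' -> smooth_family b P U (S k) f.
Proof.
move=> bf df Hf'; split=> //; split.
  by move=> p t Pp Ut; exists (f' p t); apply: df.
apply: smooth_family_ext Hf' => p t Pp Ut.
by symmetry; apply: is_derive_unique; apply: df.
Qed.

Lemma smooth_family_const k (c : R -> R) :
  (b = true -> exists C, forall p, P p -> Rabs (c p) <= C) ->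
  smooth_family b P U k (fun p _ => c p).
Proof.
elim: k c => [|k IH] c bc.
  by split=> // /bc [C HC]; exists C => p t Pp _; apply: HC.
apply: (@smooth_family_intro _ _ (fun _ _ => 0)).
- by move=> /bc [C HC]; exists C => p t Pp _; apply: HC.
- move=> p t _ _; exact: is_derive_const.
- by apply: IH => _; exists 0 => p _; rewrite Rabs_R0; lra.
Qed.

Lemma smooth_family_add k f g :
  smooth_family b P U k f -> smooth_family b P U k g ->
  smooth_family b P U k (fun p t => f p t + g p t).
Proof.
have bd (f' g' : R -> R -> R) :
   (b = true -> exists C, forall p t, P p -> U t -> Rabs (f' p t) <= C) ->
   (b = true -> exists C, forall p t, P p -> U t -> Rabs (g' p t) <= C) ->
   (b = true -> exists C, forall p t, P p -> U t -> Rabs (f' p t + g' p t) <= C).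
  move=> bf bg eb; case: (bf eb) (bg eb) => C HC [C' HC'].
  exists (C + C') => p t Pp Ut; apply: Rle_trans (Rabs_triang _ _) _.
  by apply: Rplus_le_compat; [apply: HC | apply: HC'].
elim: k f g => [|k IH] f g [bf Hf] [bg Hg].
  by split => //; apply: bd.
case: Hf Hg => df Hf [dg Hg].
apply: (@smooth_family_intro _ _ (fun p t => Derive (f p) t + Derive (g p) t)).
- exact: bd.
- move=> p t Pp Ut; apply: is_derive_plus; apply: Derive_correct; auto.
- exact: IH.
Qed.

Lemma smooth_family_mult k f g :
  smooth_family b P U k f -> smooth_family b P U k g ->
  smooth_family b P U k (fun p t => f p t * g p t).
Proof.
have bd (f' g' : R -> R -> R) :
   (b = true -> exists C, forall p t, P p -> U t -> Rabs (f' p t) <= C) ->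
   (b = true -> exists C, forall p t, P p -> U t -> Rabs (g' p t) <= C) ->
   (b = true -> exists C, forall p t, P p -> U t -> Rabs (f' p t * g' p t) <= C).
  move=> bf bg eb; case: (bf eb) (bg eb) => C HC [C' HC'].
  exists (C * C') => p t Pp Ut; rewrite Rabs_mult.
  by apply: Rmult_le_compat; (try exact: Rabs_pos); [apply: HC | apply: HC'].
elim: k f g => [|k IH] f g Hf Hg.
  by case: Hf Hg => [bf _] [bg _]; split => //; apply: bd.
move: (smooth_family_pred _ _ Hf) (smooth_family_pred _ _ Hg) => Hf0 Hg0.
case: Hf Hg => [bf [df Hf]] [bg [dg Hg]].
apply: (@smooth_family_intro _ _ (fun p t => Derive (f p) t * g p t + f p t * Derive (g p) t)).
- exact: bd.
- move=> p t Pp Ut.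
  by apply: is_derive_Rmult; apply: Derive_correct; auto.
- by apply: smooth_family_add; apply: IH.
Qed.

Lemma smooth_family_scal k (c : R) f :
  smooth_family b P U k f -> smooth_family b P U k (fun p t => c * f p t).
Proof.
move=> Hf; apply: (@smooth_family_mult k (fun _ _ => c)) => //.
by apply: smooth_family_const => _; exists (Rabs c) => _ _; lra.
Qed.

Lemma smooth_family_id k :
  (b = true -> exists C, forall t, U t -> Rabs t <= C) ->
  smooth_family b P U k (fun _ t => t).
Proof.
move=> bU; have bd : b = true -> exists C, forall p t, P p -> U t -> Rabs t <= C.
  by move=> /bU [C HC]; exists C => p t _; apply: HC.
case: k => [|k]; first by split.
apply: (@smooth_family_intro _ _ (fun _ _ => 1)) => //.
- move=> p t _ _; exact: is_derive_id.
- by apply: smooth_family_const => _; exists (Rabs 1) => _ _; lra.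
Qed.

Lemma smooth_family_pow k f j :
  smooth_family b P U k f -> smooth_family b P U k (fun p t => f p t ^ j).
Proof.
move=> Hf; elim: j => [|j IH].
  by apply: smooth_family_const => _; exists (Rabs 1) => _ _; lra.
exact: smooth_family_mult.
Qed.

Lemma smooth_family_inv k f :
  (forall p t, P p -> U t -> f p t <> 0) ->
  (b = true -> exists C, forall p t, P p -> U t -> Rabs (/ f p t) <= C) ->
  smooth_family b P U k f -> smooth_family b P U k (fun p t => / f p t).
Proof.
move=> nz bi; elim: k => [|k IH] Hf; first by split.
move: (smooth_family_pred _ _ Hf) => Hf0.
case: Hf => [bf [df Hf]].
apply: (@smooth_family_intro _ _ (fun p t => (-1) * (Derive (f p) t * (/ f p t * / f p t)))) => //.
- move=> p t Pp Ut.
  apply: is_derive_eq (is_derive_inv _ _ _ (Derive_correct _ _ (df p t Pp Ut)) (nz p t Pp Ut)) _.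
  by field; apply: nz.
- by apply: smooth_family_scal; apply: smooth_family_mult => //; apply: smooth_family_mult; apply: IH.
Qed.

Lemma smooth_family_radial_lap n k f :
  (b = true -> exists C, forall t, U t -> Rabs t <= C) ->
  smooth_family b P U (S (S k)) f ->
  smooth_family b P U k (fun p => radial_lap n (f p)).
Proof.
move=> bU Hf.
have H1 := smooth_family_derive _ _ Hf.
have H2 := smooth_family_derive _ _ H1.
have H1' := smooth_family_pred _ _ H1.
apply: smooth_family_add; last exact: smooth_family_scal.
apply: smooth_family_mult => //; apply: smooth_family_scal; exact: smooth_family_id.
Qed.

Lemma smooth_family_iter_radial_lap n j k f :
  (b = true -> exists C, forall t, U t -> Rabs t <= C) ->
  smooth_family b P U (2 * j + k) f ->
  smooth_family b P U k (fun p => iter j (radial_lap n) (f p)).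
Proof.
move=> bU; elim: j k => [|j IH] k Hf //.
apply: (smooth_family_radial_lap n k (fun p => iter j (radial_lap n) (f p)) bU).
apply: IH; apply: smooth_family_le Hf; lia.
Qed.

End SmoothFamily.

Arguments Derive_ext_open {U}.

Lemma radial_lap_ext (U : R -> Prop) (openU : open U) n (f g : R -> R) :
  (forall t, U t -> f t = g t) ->
  forall t, U t -> radial_lap n f t = radial_lap n g t.
Proof.
move=> fg t Ut.
have dfg s : U s -> Derive f s = Derive g s by apply: Derive_ext_open.
by rewrite /radial_lap dfg // (Derive_ext_open openU _ _ _ dfg).
Qed.

Lemma iter_radial_lap_ext (U : R -> Prop) (openU : open U) n j (f g : R -> R) :
  (forall t, U t -> f t = g t) ->
  forall t, U t -> iter j (radial_lap n) f t = iter j (radial_lap n) g t.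
Proof. by move=> fg; elim: j => //= j IH; apply: radial_lap_ext. Qed.

Lemma radial_lap0 n t : radial_lap n (fun _ => 0) t = 0.
Proof.
rewrite /radial_lap; have -> : Derive (fun _ => 0) = fun _ => 0.
  by apply: functional_extensionality => s; rewrite Derive_const.
by rewrite Derive_const; ring.
Qed.

Lemma iter_radial_lap_locally0 (U : R -> Prop) (openU : open U) n j (f : R -> R) :
  (forall t, U t -> f t = 0) -> forall t, U t -> iter j (radial_lap n) f t = 0.
Proof.
move=> f0 t Ut; rewrite (iter_radial_lap_ext _ openU n j f (fun _ => 0) f0) //.
elim: j t {Ut} => //= j IH t.
have -> : iter j (radial_lap n) (fun _ => 0) = fun _ => 0.
  by apply: functional_extensionality.
exact: radial_lap0.
Qed.

(** A truncated power has only finitely many derivatives, but they are elementary; it takes the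
    place of a smooth bump wherever a fixed order of differentiability is enough. *)
Definition ppow (k : nat) (t : R) : R := Rmax 0 t ^ k.

Lemma is_derive_ppow k t : is_derive (ppow (S (S k))) t (INR (S (S k)) * ppow (S k) t).
Proof.
have [t0|[t0|t0]] : t < 0 \/ t = 0 \/ 0 < t by lra.
- have -> : INR (S (S k)) * ppow (S k) t = 0.
    by rewrite /ppow Rmax_left; [rewrite pow_ne_zero //; ring | lra].
  apply: (@is_derive_ext_loc _ _ (fun _ => 0)); last exact: is_derive_const.
  have := open_lt 0 t t0; apply: filter_imp => s s0.
  by rewrite /ppow Rmax_left ?pow_ne_zero //; lra.
- subst t; rewrite /ppow Rmax_left; last lra.
  rewrite pow_ne_zero // Rmult_0_r.
  (* At the corner the difference quotient is [Rmax 0 h ^ (k + 2) / h], of absolute value at most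
     [|h|] when [|h| < 1]. *)
  apply/is_derive_Reals => eps e0.
  have d0 : 0 < Rmin eps 1 by apply: Rmin_glb_lt; lra.
  exists (mkposreal _ d0) => h hn /= hd.
  rewrite Rplus_0_l (Rmax_left 0 0); last lra.
  have h1 : Rabs h < eps := Rlt_le_trans _ _ _ hd (Rmin_l _ _).
  have h2 : Rabs h < 1 := Rlt_le_trans _ _ _ hd (Rmin_r _ _).
  have M0 : 0 <= Rmax 0 h <= Rabs h.
    by split; [exact: Rmax_l | apply: Rmax_lub; [exact: Rabs_pos | exact: Rle_abs]].
  have hp : 0 < Rabs h by apply: Rabs_pos_lt.
  rewrite /= Rmult_0_l !Rminus_0_r Rabs_mult Rabs_inv.
  apply: Rle_lt_trans h1.
  apply: (Rmult_le_reg_r (Rabs h)) => //.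
  rewrite Rmult_assoc Rinv_l ?Rmult_1_r; last lra.
  rewrite Rabs_right; last first.
    by apply: Rle_ge; apply: Rmult_le_pos; [lra | apply: Rmult_le_pos; [lra | apply: pow_le; lra]].
  apply: Rmult_le_compat; try lra.
    by apply: Rmult_le_pos; [lra | apply: pow_le; lra].
  rewrite -[X in _ <= X]Rmult_1_r; apply: Rmult_le_compat; try lra.
    by apply: pow_le; lra.
  by rewrite -(pow1 k); apply: pow_incr; lra.
- apply: (@is_derive_ext_loc _ _ (fun s => s ^ (S (S k)))).
    have := open_gt 0 t t0; apply: filter_imp => s s0.
    by rewrite /ppow Rmax_right //; lra.
  rewrite /ppow Rmax_right; last lra.
  have := is_derive_pow (fun s => s) (S (S k)) t 1 (is_derive_id t).
  by rewrite Rmult_1_r.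
Qed.

(** Each derivative lowers the exponent by one and requires an exponent of at least two, so [S k]
    allows [k] derivatives. *)
Lemma smooth_family_ppow (P U : R -> Prop) (openU : open U) k f :
  smooth_family false P U k f ->
  smooth_family false P U k (fun p t => ppow (S k) (f p t)).
Proof.
elim: k f => [|k IH] f Hf; first by split.
have Hf0 := smooth_family_pred _ _ _ _ _ Hf.
case: Hf => [bf [df Hf]].
apply: (@smooth_family_intro _ _ _ openU _ _
  (fun p t => INR (S (S k)) * (Derive (f p) t * ppow (S k) (f p t)))) => //.
- move=> p t Pp Ut.
  apply: is_derive_eq (is_derive_comp _ _ _ _ _ (is_derive_ppow k (f p t)) (Derive_correct _ _ (df p t Pp Ut))) _.
  by rewrite /scal /= /mult /=; ring.
- apply: smooth_family_scal => //; apply: smooth_family_mult => //; exact: IH.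
Qed.
Lemma ppow_ge0 k t : 0 <= ppow k t.
Proof. by apply: pow_le; apply: Rmax_l. Qed.

Lemma ppow_eq0 k t : t <= 0 -> ppow (S k) t = 0.
Proof. by move=> t0; rewrite /ppow Rmax_left // pow_ne_zero. Qed.

Lemma ppow_pos k t : 0 <= t -> ppow k t = t ^ k.
Proof. by move=> t0; rewrite /ppow Rmax_right. Qed.

(** [radial_lap] has degree [-1] under dilations of [t], so each application releases one factor
    [c]. This transports a test function from the unit ball to a ball of radius [rho]. *)
Lemma iter_radial_lap_scale (U : R -> Prop) (openU : open U) n j k (c : R) (f : R -> R) :
  smooth_family false (fun _ => True) U (2 * j + k) (fun _ => f) ->
  forall t, U (c * t) ->
    iter j (radial_lap n) (fun s => f (c * s)) t = c ^ j * iter j (radial_lap n) f (c * t).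
Proof.
move=> Hf.
have openV : open (fun t => U (c * t)).
  apply: (open_comp (fun t => c * t)) => // t _.
  exact: (continuous_scal_r (K := R_AbsRing) (V := R_NormedModule) c id t (continuous_id t)).
elim: j k Hf => [|j IH] k Hf t Ut /=; first by ring.
rewrite (radial_lap_ext _ openV _ _ (fun s => c ^ j * iter j (radial_lap n) f (c * s))) //; last first.
  move=> s Us; apply: (IH (S (S k))) => //; apply: smooth_family_le Hf.
  by lia.
have Sj : smooth_family false (fun _ => True) U 2 (fun _ => iter j (radial_lap n) f).
  have := smooth_family_iter_radial_lap false (fun _ => True) U openU n j 2 (fun _ => f).
  by apply=> //; apply: smooth_family_le Hf; lia.
move: (iter j (radial_lap n) f) Sj => g Sg.
have dg s : U s -> is_derive g s (Derive g s).
  by move=> Us; apply: Derive_correct; apply: (smooth_family_ex_derive _ _ _ _ _ Sg 0).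
have ddg s : U s -> is_derive (Derive g) s (Derive (Derive g) s).
  move=> Us; apply: Derive_correct.
  exact: (smooth_family_ex_derive _ _ _ _ _ (smooth_family_derive _ _ _ _ _ Sg) 0).
have dc (h : R -> R) (s a l : R) : is_derive h (c * s) l ->
    Derive (fun x => a * h (c * x)) s = a * (c * l).
  move=> dh; apply: is_derive_unique; apply: is_derive_scal.
  apply: is_derive_eq (is_derive_comp h (fun x => c * x) s _ c dh _) _.
    by apply: is_derive_eq (is_derive_scal id s c 1 (is_derive_id s)) _; ring.
  by rewrite /scal /= /mult.
have d1 s : U (c * s) -> Derive (fun x => c ^ j * g (c * x)) s = (c ^ j * c) * Derive g (c * s).
  by move=> Us; rewrite (dc _ _ _ _ (dg _ Us)); ring.
rewrite /radial_lap d1 // (Derive_ext_open openV _ _ _ d1) // (dc _ _ _ _ (ddg _ Ut)); ring.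
Qed.

(** * Cut-off and right inverse of the radial Laplacian *)

Lemma open_Ioo (a c : R) : open (fun t => a < t < c).
Proof. by apply: open_and; [exact: open_gt | exact: open_lt]. Qed.

Lemma bounded_on_segment (f : R -> R) (a c : R) :
  (forall t, a <= t <= c -> ex_derive f t) ->
  exists C, forall t, a <= t <= c -> Rabs (f t) <= C.
Proof.
move=> df; have [t ht|M HM] := bounded_continuity f a c.
  exact: (ex_derive_continuous (K := R_AbsRing) (V := R_NormedModule) f t (df t ht)).
by exists M => t ht; left; apply: HM.
Qed.

(** One derivative is spent: differentiability on the closed segment makes each derivative of order
    at most [k] continuous there, hence bounded. *)
Lemma smooth_family_bounded (P : R -> Prop) (V : R -> Prop) (a c : R) k (f : R -> R) :
  open V -> (forall t, a <= t <= c -> V t) ->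
  smooth_family false (fun _ => True) V (S k) (fun _ => f) ->
  smooth_family true P (fun t => a < t < c) k (fun _ => f).
Proof.
move=> oV aV; have bd j g : smooth_family false (fun _ => True) V (S j) (fun _ => g) ->
    true = true -> exists C, forall p t, P p -> a < t < c -> Rabs (g t) <= C.
  move=> Hg _; have [C HC] := bounded_on_segment g a c
    (fun t ht => smooth_family_ex_derive _ _ _ _ _ Hg 0 t I (aV t ht)).
  by exists C => _ t _ ht; apply: HC; lra.
elim: k f => [|k IH] f Hf; split=> //; [exact: bd Hf | exact: bd Hf | split].
  by move=> _ t _ ht; apply: (smooth_family_ex_derive _ _ _ _ _ Hf 0) => //; apply: aV; lra.
exact: IH (smooth_family_derive _ _ _ _ _ Hf).
Qed.

(** The quotient [p / (p + q)] of two one-sided bumps with overlapping supports, whence a positive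
    denominator. It passes from [1] to [0] between [t = 1/4] and [t = 1], that is for [|y|] between
    [1/2] and [1]. *)
Definition cutoff (k : nat) (t : R) : R :=
  ppow (S k) (1 - t) * / (ppow (S k) (1 - t) + ppow (S k) (t - 1 / 4)).

Section Cutoff.
Variable k : nat.

Lemma cutoff_denom t : 0 < ppow (S k) (1 - t) + ppow (S k) (t - 1 / 4).
Proof.
have := ppow_ge0 (S k) (1 - t); have := ppow_ge0 (S k) (t - 1 / 4).
have [h|h] : 0 < 1 - t \/ 0 < t - 1 / 4 by lra.
  have : 0 < ppow (S k) (1 - t) by rewrite ppow_pos; [apply: pow_lt | lra].
  lra.
have : 0 < ppow (S k) (t - 1 / 4) by rewrite ppow_pos; [apply: pow_lt | lra].
lra.
Qed.

Lemma cutoff1 t : t <= 1 / 4 -> cutoff k t = 1.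
Proof.
move=> ht; have := cutoff_denom t; rewrite /cutoff.
rewrite (ppow_eq0 _ (t - 1 / 4)) ?Rplus_0_r; last lra.
by move=> h; field; lra.
Qed.

Lemma cutoff0 t : 1 <= t -> cutoff k t = 0.
Proof. by move=> ht; rewrite /cutoff (ppow_eq0 _ (1 - t)); [ring | lra]. Qed.

Lemma cutoff_bounds t : 0 <= cutoff k t <= 1.
Proof.
have h := cutoff_denom t; have h1 := ppow_ge0 (S k) (1 - t).
have h2 := ppow_ge0 (S k) (t - 1 / 4); rewrite /cutoff; split.
  by apply: Rmult_le_pos => //; left; apply: Rinv_0_lt_compat.
by apply: (Rmult_le_reg_r _ _ _ h); rewrite Rmult_assoc Rinv_l; lra.
Qed.

Lemma smooth_cutoff (P U : R -> Prop) : open U -> smooth_family false P U k (fun _ => cutoff k).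
Proof.
move=> oU; have id_ (a c : R) : smooth_family false P U k (fun _ t => a + c * t).
  apply: smooth_family_add => //; first exact: smooth_family_const.
  by apply: smooth_family_scal => //; exact: smooth_family_id.
have s1 : smooth_family false P U k (fun _ t => ppow (S k) (1 - t)).
  apply: smooth_family_ppow => //.
  by apply: smooth_family_ext (id_ 1 (-1)) => // _ t _ _; ring.
have s2 : smooth_family false P U k (fun _ t => ppow (S k) (t - 1 / 4)).
  apply: smooth_family_ppow => //.
  by apply: smooth_family_ext (id_ (- (1/4)) 1) => // _ t _ _; ring.
apply: smooth_family_mult => //; apply: smooth_family_inv => //.
  by move=> _ t _ _; have := cutoff_denom t; lra.
exact: smooth_family_add.
Qed.

End Cutoff.

Section Chain.
Variable m : nat.
Hypothesis m2 : (2 <= m)%coq_nat.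

(** This is [t ^ m] times the derivative of [inv_lap]. Starting the integrals at [eps] avoids the
    singular weight at [0] and makes both of them vanish on [(0, eps]] whenever [h] does. *)
Definition moment (eps : R) (h : R -> R) (s : R) : R :=
  RInt (fun q => q ^ (m - 1) * h q / 4) eps s.

(* A right inverse of the radial Laplacian in dimension [2 * m], since that
   operator is [4 t^(1-m) d/dt (t^m d/dt)]. *)
Definition inv_lap (eps : R) (h : R -> R) (t : R) : R :=
  RInt (fun s => moment eps h s / s ^ m) eps t.

Section Basic.
Variables (eps : R) (h : R -> R).
Hypothesis eps0 : 0 < eps.
Hypothesis ch : forall t, 0 < t -> ex_derive h t.

Lemma continuous_moment_integrand t : 0 < t -> continuous (fun q => q ^ (m - 1) * h q / 4) t.
Proof.
move=> t0; apply: (ex_derive_continuous (K := R_AbsRing) (V := R_NormedModule)).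
by have e1 := ch t t0; auto_derive.
Qed.

Lemma ex_RInt_pos (f : R -> R) (a c : R) : 0 < a -> 0 < c ->
  (forall t, 0 < t -> continuous f t) -> ex_RInt f a c.
Proof.
move=> a0 c0 cf; apply: ex_RInt_continuous => z [hz _]; apply: cf.
by apply: Rlt_le_trans hz; apply: Rmin_glb_lt.
Qed.

Lemma is_derive_RInt_pos (f : R -> R) (a t : R) : 0 < a -> 0 < t ->
  (forall t, 0 < t -> continuous f t) -> is_derive (fun x => RInt f a x) t (f t).
Proof.
move=> a0 t0 cf; apply: (is_derive_RInt f (fun x => RInt f a x) a t); last exact: cf.
have := open_gt 0 t t0; apply: filter_imp => s s0.
by apply: RInt_correct; apply: ex_RInt_pos.
Qed.

Lemma is_derive_moment t : 0 < t -> is_derive (moment eps h) t (t ^ (m - 1) * h t / 4).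
Proof. by move=> t0; apply: (is_derive_RInt_pos (fun q => q ^ (m - 1) * h q / 4)) => //; exact: continuous_moment_integrand. Qed.

Lemma continuous_inv_lap_integrand t : 0 < t -> continuous (fun s => moment eps h s / s ^ m) t.
Proof.
move=> t0; apply: (ex_derive_continuous (K := R_AbsRing) (V := R_NormedModule)).
have t1 : t ^ m <> 0 by apply: pow_nonzero; lra.
have e1 : ex_derive (moment eps h) t by eexists; apply: is_derive_moment.
by auto_derive.
Qed.

Lemma is_derive_inv_lap t : 0 < t -> is_derive (inv_lap eps h) t (moment eps h t / t ^ m).
Proof. by move=> t0; apply: (is_derive_RInt_pos (fun s => moment eps h s / s ^ m)) => //; exact: continuous_inv_lap_integrand. Qed.

Lemma radial_lap_inv_lap t : 0 < t -> radial_lap (2 * m) (inv_lap eps h) t = h t.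
Proof.
move=> t0; have oU := open_gt 0.
have d1 s : 0 < s -> Derive (inv_lap eps h) s = moment eps h s / s ^ m.
  by move=> s0; apply: is_derive_unique; apply: is_derive_inv_lap.
rewrite /radial_lap d1 // (Derive_ext_open oU _ _ _ d1) //.
have t1 : t ^ m <> 0 by apply: pow_nonzero; lra.
have em : (m = S (m - 1)) by lia.
have -> : Derive (fun s => moment eps h s / s ^ m) t =
    (t ^ (m - 1) * h t / 4) / t ^ m - INR m * moment eps h t / (t * t ^ m).
  apply: is_derive_unique.
  apply: is_derive_eq (is_derive_div _ (fun s => s ^ m) _ _ _ (is_derive_moment t t0)
     (is_derive_pow (fun s : R => s) m t 1 (is_derive_id t)) t1) _.
  by have := pow_nonzero t (m - 1); rewrite em /= subn1 /= => nz; field; split; [apply: nz|]; lra.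
have -> : INR (2 * m)%nat = 2 * INR m by rewrite -multE mult_INR.
move: (moment eps h t) (h t) => M H.
have [m' ->] : exists m', m = S m' by exists m.-1; lia.
rewrite subn1 /= -/(INR (S m')); field; split; [apply: pow_nonzero|]; lra.
Qed.
End Basic.

Lemma RInt_zero_fun (f : R -> R) (a c : R) :
  (forall t, Rmin a c < t < Rmax a c -> f t = 0) -> RInt f a c = 0.
Proof.
move=> f0; rewrite (RInt_ext f (fun _ => 0)) //.
by rewrite RInt_const /scal /= /mult /= Rmult_0_r.
Qed.

Lemma RInt_ge_const (f : R -> R) (a c K : R) : a <= c -> ex_RInt f a c ->
  (forall t, a < t < c -> K <= f t) -> (c - a) * K <= RInt f a c.
Proof.
move=> ac ef fK; have -> : (c - a) * K = RInt (fun _ => K) a c by rewrite RInt_const.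
by apply: RInt_le => //; exact: ex_RInt_const.
Qed.

Lemma RInt_le_const (f : R -> R) (a c K : R) : a <= c -> ex_RInt f a c ->
  (forall t, a < t < c -> f t <= K) -> RInt f a c <= (c - a) * K.
Proof.
move=> ac ef fK; have -> : (c - a) * K = RInt (fun _ => K) a c by rewrite RInt_const.
by apply: RInt_le => //; exact: ex_RInt_const.
Qed.

Lemma RInt_ge_sub (f : R -> R) (a b c : R) : 0 < a -> a <= b -> b <= c ->
  (forall t, 0 < t -> continuous f t) -> (forall t, a < t -> 0 <= f t) ->
  RInt f b c <= RInt f a c.
Proof.
move=> a0 ab bc cf f0.
have e1 : ex_RInt f a b by apply: ex_RInt_pos => //; lra.
have e2 : ex_RInt f b c by apply: ex_RInt_pos => //; lra.
rewrite -(RInt_Chasles f a b c e1 e2) /plus /=.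
have : 0 <= RInt f a b by apply: RInt_ge_0 => // t [ht _]; apply: f0.
lra.
Qed.

Section Bounds.
Variables (eps : R) (h : R -> R).
Hypothesis eps0 : 0 < eps.
Hypothesis ch : forall t, 0 < t -> ex_derive h t.

Lemma moment_eq0 s : 0 < s <= eps -> (forall t, 0 < t <= eps -> h t = 0) -> moment eps h s = 0.
Proof.
move=> hs h0; apply: RInt_zero_fun => t; rewrite Rmin_right ?Rmax_left; try lra.
by move=> ht; rewrite h0; lra.
Qed.

Lemma inv_lap_eq0 s : 0 < s <= eps -> (forall t, 0 < t <= eps -> h t = 0) -> inv_lap eps h s = 0.
Proof.
move=> hs h0; apply: RInt_zero_fun => t; rewrite Rmin_right ?Rmax_left; try lra.
by move=> ht; rewrite moment_eq0 //; lra.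
Qed.

Hypothesis h_ge0 : forall t, 0 < t -> 0 <= h t.

Lemma moment_ge0 s : eps <= s -> 0 <= moment eps h s.
Proof.
move=> hs; apply: RInt_ge_0 => //.
  by apply: ex_RInt_pos; try lra; exact: continuous_moment_integrand.
move=> t ht; apply: Rmult_le_pos; last lra.
by apply: Rmult_le_pos; [apply: pow_le | apply: h_ge0]; lra.
Qed.

Lemma inv_lap_ge0 s : eps <= s -> 0 <= inv_lap eps h s.
Proof.
move=> hs; apply: RInt_ge_0 => //.
  by apply: ex_RInt_pos; try lra; exact: continuous_inv_lap_integrand.
move=> t ht; apply: Rmult_le_pos; first by apply: moment_ge0; lra.
by left; apply: Rinv_0_lt_compat; apply: pow_lt; lra.
Qed.

Lemma moment_le s : eps <= s <= 2 -> (forall t, 0 < t <= 2 -> h t <= 1) ->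
  moment eps h s <= s ^ m / 4.
Proof.
move=> hs h1.
apply: Rle_trans (RInt_le_const _ _ _ (s ^ (m - 1) / 4) (proj1 hs) _ _) _.
- by apply: ex_RInt_pos; try lra; exact: continuous_moment_integrand.
- move=> t ht; apply: Rmult_le_compat_r; first lra.
  rewrite -[X in _ <= X]Rmult_1_r; apply: Rmult_le_compat.
  + by apply: pow_le; lra.
  + by apply: h_ge0; lra.
  + by apply: pow_incr; lra.
  + by apply: h1; lra.
have -> : s ^ m = s * s ^ (m - 1).
  by have {1}-> : m = S (m - 1) by lia.
have : 0 <= s ^ (m - 1) by apply: pow_le; lra.
nra.
Qed.

(** The integrand is at most [1/4] on an interval of length less than [2], so the bound [1]
    reproduces itself along iterated inversions. *)
Lemma inv_lap_le1 s : eps <= s <= 2 -> (forall t, 0 < t <= 2 -> h t <= 1) ->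
  inv_lap eps h s <= 1.
Proof.
move=> hs h1.
apply: Rle_trans (RInt_le_const _ _ _ (1 / 4) (proj1 hs) _ _) _; last lra.
- by apply: ex_RInt_pos; try lra; exact: continuous_inv_lap_integrand.
- move=> t ht; have tm : 0 < t ^ m by apply: pow_lt; lra.
  apply: (Rmult_le_reg_r _ _ _ tm).
  rewrite /Rdiv (Rmult_assoc (moment eps h t)) Rinv_l; last lra.
  have := moment_le t _ h1; rewrite /Rdiv; lra.
Qed.

(** Both integrals are cut down to the upper half of their interval, so that [h] is only evaluated
    at points [q >= t/4]. This gains one power of [t] and multiplies the threshold by [4]. *)
Lemma inv_lap_ge (c A : R) k : 0 <= c -> 1 <= A ->
  (forall t, A * eps <= t -> c * t ^ k <= h t) ->
  forall t, 4 * A * eps <= t -> (c / (8 * 4 ^ (m + k))) * t ^ (S k) <= inv_lap eps h t.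
Proof.
move=> c0 A1 hc t ht.
have te : eps <= t / 4 by nra.
apply: Rle_trans (RInt_ge_sub _ eps (t / 2) t _ _ _ _ _); try lra; last first.
- move=> s hs; apply: Rmult_le_pos; first by apply: moment_ge0; lra.
  by left; apply: Rinv_0_lt_compat; apply: pow_lt; lra.
- exact: continuous_inv_lap_integrand.
have k0 : 0 <= (t / 4) ^ k by apply: pow_le; lra.
have mge s : t / 2 < s -> s ^ m * (c * (t / 4) ^ k / (4 * 2 ^ m)) <= moment eps h s.
  move=> hs.
  apply: Rle_trans (RInt_ge_sub _ eps (s / 2) s _ _ _ _ _); try lra; last first.
  - move=> q hq; apply: Rmult_le_pos; last lra.
    by apply: Rmult_le_pos; [apply: pow_le | apply: h_ge0]; lra.
  - exact: continuous_moment_integrand.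
  apply: Rle_trans (RInt_ge_const _ _ _ ((s / 2) ^ (m - 1) * (c * (t / 4) ^ k) / 4) _ _ _).
  + have -> : s ^ m = s * (2 * (s / 2)) ^ (m - 1).
      have {1}-> : m = S (m - 1) by lia.
      by rewrite /=; congr (_ * _ ^ _); field.
    have -> : 2 ^ m = 2 * 2 ^ (m - 1) by have {1}-> : m = S (m - 1) by lia.
    rewrite Rpow_mult_distr; have : 2 ^ (m - 1) <> 0 by apply: pow_nonzero; lra.
    by move=> nz; right; field.
  + lra.
  + by apply: ex_RInt_pos; try lra; exact: continuous_moment_integrand.
  + move=> q hq; apply: Rmult_le_compat_r; first lra.
    apply: Rmult_le_compat; try (apply: pow_le; lra).
    * exact: Rmult_le_pos.
    * by apply: pow_incr; lra.
    * apply: Rle_trans (hc q _); last nra.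
      by apply: Rmult_le_compat_l => //; apply: pow_incr; lra.
apply: Rle_trans (RInt_ge_const _ _ _ (c * (t / 4) ^ k / (4 * 2 ^ m)) _ _ _); last first.
- move=> s hs; have sm : 0 < s ^ m by apply: pow_lt; lra.
  apply: (Rmult_le_reg_r _ _ _ sm); rewrite /Rdiv (Rmult_assoc (moment eps h s)) Rinv_l; last lra.
  have := mge s (proj1 hs); rewrite /Rdiv; lra.
- by apply: ex_RInt_pos; try lra; exact: continuous_inv_lap_integrand.
- lra.
have p1 : 0 < 2 ^ m by apply: pow_lt; lra.
have p2 : 1 <= 2 ^ m by apply: pow_R1_Rle; lra.
have p3 : 0 < 4 ^ k by apply: pow_lt; lra.
have e4 : 4 ^ (m + k) = 2 ^ m * 2 ^ m * 4 ^ k.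
  have <- : (2 * 2) ^ m = 2 ^ m * 2 ^ m by rewrite Rpow_mult_distr.
  by rewrite pow_add; congr (_ ^ _ * _); ring.
rewrite {}e4 /=.
have -> : t ^ k = 4 ^ k * (t / 4) ^ k by rewrite -Rpow_mult_distr; congr (_ ^ _); field.
have -> : c / (8 * (2 ^ m * 2 ^ m * 4 ^ k)) * (t * (4 ^ k * (t / 4) ^ k)) =
   (t - t / 2) * (c * (t / 4) ^ k / (4 * 2 ^ m)) * / 2 ^ m by field; lra.
rewrite -[X in _ <= X]Rmult_1_r; apply: Rmult_le_compat_l.
  apply: Rmult_le_pos; first lra.
  apply: Rmult_le_pos; first exact: Rmult_le_pos.
  by left; apply: Rinv_0_lt_compat; lra.
by rewrite -Rinv_1; apply: Rinv_le_contravar; lra.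
Qed.

End Bounds.

(** The derivative of [inv_lap] is [moment / t ^ m], and that of [moment] involves [h] alone;
    uniform bounds on the two integrals therefore control all further derivatives. *)
Lemma smooth_inv_lap (b : bool) (P U : R -> Prop) k (h : R -> R -> R) :
  open U -> (forall t, U t -> 0 < t) -> (forall p, P p -> 0 < p) ->
  (b = true -> exists C, forall t, U t -> Rabs t <= C) ->
  (b = true -> exists C, forall t, U t -> Rabs (/ t) <= C) ->
  (forall p, P p -> forall t, 0 < t -> ex_derive (h p) t) ->
  (b = true -> exists C, forall p t, P p -> U t -> Rabs (inv_lap p (h p) t) <= C) ->
  (b = true -> exists C, forall p t, P p -> U t -> Rabs (moment p (h p) t) <= C) ->
  smooth_family b P U k h -> smooth_family b P U (S k) (fun p => inv_lap p (h p)).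
Proof.
move=> oU U0 P0 bU biU dh bI bM Hh.
have sid : smooth_family b P U k (fun _ t => t) by exact: smooth_family_id.
have sM : smooth_family b P U (S k) (fun p => moment p (h p)).
  apply: (@smooth_family_intro _ _ _ oU _ _ (fun p t => t ^ (m - 1) * h p t * (1 / 4))) => //.
    move=> p t Pp Ut; apply: is_derive_eq (is_derive_moment _ _ (P0 p Pp) (dh p Pp) _ (U0 t Ut)) _.
    by field.
  apply: smooth_family_mult => //; last first.
    by apply: smooth_family_const => // _; exists (Rabs (1/4)) => _ _; lra.
  by apply: smooth_family_mult => //; exact: smooth_family_pow.
apply: (@smooth_family_intro _ _ _ oU _ _ (fun p t => moment p (h p) t * (/ t) ^ m)) => //.
  move=> p t Pp Ut; apply: is_derive_eq (is_derive_inv_lap _ _ (P0 p Pp) (dh p Pp) _ (U0 t Ut)) _.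
  by rewrite pow_inv.
apply: smooth_family_mult => //; first exact: smooth_family_pred.
apply: smooth_family_pow => //; apply: smooth_family_inv => //.
  by move=> _ t _ /U0; lra.
by move=> /biU [C HC]; exists C => _ t _ /HC.
Qed.

End Chain.

(** * Test functions centred at the origin *)

Section TestA.
Variables (m k : nat).
Hypothesis m3 : (3 <= m)%coq_nat.

(** The profile behind [Phi]. [chain 0] depends on [t / eps] only, vanishes for [0 < t <= eps],
    tends to [1] and has nonnegative radial Laplacian in dimension [2 m]. Inverting [m - 1] times
    raises the growth to [t^(m-1)], and [m] Laplacians then lead back to [radial_lap (chain 0)]. *)
Fixpoint chain (j : nat) (eps : R) : R -> R :=
  match j with
  | O => fun t => ppow (S (S (S k))) (1 - eps * / t)
  | S j' => inv_lap m eps (chain j' eps)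
  end.

Let m2 : (2 <= m)%coq_nat. Proof. lia. Qed.

Lemma ex_derive_chain j eps t : 0 < eps -> 0 < t -> ex_derive (chain j eps) t.
Proof.
move=> e0; elim: j t => [|j IH] t t0 /=.
- eexists; apply: is_derive_comp; first exact: is_derive_ppow.
  by apply: Derive_correct; auto_derive; lra.
- by eexists; apply: is_derive_inv_lap.
Qed.

Lemma chain_eq0 j eps t : 0 < eps -> 0 < t <= eps -> chain j eps t = 0.
Proof.
move=> e0; elim: j t => [|j IH] t ht /=.
  apply: ppow_eq0; have : 1 <= eps * / t; last lra.
  by apply: (Rmult_le_reg_r t); rewrite ?Rmult_assoc ?Rinv_l; lra.
exact: inv_lap_eq0.
Qed.

Lemma chain_ge0 j eps t : 0 < eps -> 0 < t -> 0 <= chain j eps t.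
Proof.
move=> e0; elim: j t => [|j IH] t t0; first exact: ppow_ge0.
have [te|te] := Rle_dec t eps; first by rewrite chain_eq0; lra.
by apply: inv_lap_ge0 => //; [move=> s; exact: ex_derive_chain | lra].
Qed.

Lemma chain_le1 j eps t : 0 < eps -> 0 < t <= 2 -> chain j eps t <= 1.
Proof.
move=> e0; elim: j t => [|j IH] t t0.
  have it : 0 < / t by apply: Rinv_0_lt_compat; lra.
  rewrite -[X in _ <= X](pow1 (S (S (S k)))); apply: pow_incr; split; first exact: Rmax_l.
  by apply: Rmax_lub; nra.
have [te|te] := Rle_dec t eps; first by rewrite chain_eq0; lra.
by apply: inv_lap_le1 => //; [move=> s; exact: ex_derive_chain | move=> s; exact: chain_ge0 | lra].
Qed.

Lemma iter_radial_lap_chain j eps t : 0 < eps -> 0 < t ->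
  iter j (radial_lap (2 * m)) (chain j eps) t = chain 0 eps t.
Proof.
move=> e0; have oU := open_gt 0; elim: j t => [|j IH] t t0 //.
rewrite iterSr (iter_radial_lap_ext _ oU _ _ _ (chain j eps)) //; first exact: IH.
by move=> s s0; apply: radial_lap_inv_lap => // q; apply: ex_derive_chain.
Qed.

(** The point is that [c] and [A] do not depend on [eps]: from [t = 2 eps] on, [1 - eps / t >= 1/2],
    and each inversion gains a power of [t] by [inv_lap_ge]. *)
Lemma chain_ge j : exists c A, 0 < c /\ 1 <= A /\
  forall eps t, 0 < eps -> A * eps <= t -> c * t ^ j <= chain j eps t.
Proof.
elim: j => [|j [c [A [c0 [A1 H]]]]].
  exists ((1 / 2) ^ S (S (S k))), 2; split; first by apply: pow_lt; lra.
  split; first lra.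
  move=> eps t e0 ht; rewrite /= Rmult_1_r.
  have h : eps * / t <= 1 / 2.
    by apply: (Rmult_le_reg_r t); rewrite ?Rmult_assoc ?Rinv_l; lra.
  rewrite -[1 / 2 * _]/((1 / 2) ^ S (S (S k))) ppow_pos; last lra.
  by apply: pow_incr; lra.
exists (c / (8 * 4 ^ (m + j))), (4 * A).
have p : 0 < 4 ^ (m + j) by apply: pow_lt; lra.
split; first by apply: Rmult_lt_0_compat => //; apply: Rinv_0_lt_compat; lra.
split; first lra.
move=> eps t e0 ht; apply: (inv_lap_ge _ m2 _ _ e0 _ _ _ A) => //; try lra.
- by move=> s; exact: ex_derive_chain.
- by move=> s; exact: chain_ge0.
- by move=> s hs; exact: H.
Qed.

(** With [m >= 3] both terms are nonnegative. The second one is of order [1 / eps] for [t] of order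
    [eps] beyond [eps], and this produces the lower bound on an annulus. *)
Lemma radial_lap_chain0 eps t : 0 < eps -> 0 < t ->
  radial_lap (2 * m) (chain 0 eps) t =
  INR (S (S (S k))) * (4 * INR (S (S k)) * (eps ^ 2 * (/ t) ^ 3) * ppow (S k) (1 - eps * / t)
   + (4 * INR m - 8) * (eps * (/ t) ^ 2) * ppow (S (S k)) (1 - eps * / t)).
Proof.
move=> e0 t0; have oU := open_gt 0.
have dx s : 0 < s -> is_derive (fun t => 1 - eps * / t) s (eps * (/ s) ^ 2).
  by move=> s0; auto_derive; [lra | field; lra].
have dpp j s : 0 < s -> is_derive (fun t => ppow (S (S j)) (1 - eps * / t)) s
   (INR (S (S j)) * ppow (S j) (1 - eps * / s) * (eps * (/ s) ^ 2)).
  move=> s0; apply: is_derive_eq (is_derive_comp _ _ _ _ _ (is_derive_ppow j _) (dx s s0)) _.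
  by rewrite /scal /= /mult /=; ring.
have d1 s : 0 < s -> Derive (chain 0 eps) s =
   INR (S (S (S k))) * ppow (S (S k)) (1 - eps * / s) * (eps * (/ s) ^ 2).
  by move=> s0; apply: is_derive_unique; apply: dpp.
rewrite /radial_lap d1 // (Derive_ext_open oU _ _ _ d1) //.
have -> : INR (2 * m)%nat = 2 * INR m by rewrite -multE mult_INR.
rewrite (is_derive_unique _ t (INR (S (S (S k))) * (INR (S (S k)) * ppow (S k) (1 - eps * / t) * (eps * (/ t) ^ 2) * (eps * (/ t) ^ 2) - ppow (S (S k)) (1 - eps * / t) * (eps * 2 * (/ t) ^ 3)))).
  set a := INR (S (S (S k))); set c := INR (S (S k)).
  by field; lra.
have d2 : is_derive (fun s => eps * (/ s) ^ 2) t (- (eps * 2 * (/ t) ^ 3)).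
  by auto_derive; [lra | field; lra].
apply: (is_derive_ext (fun s => INR (S (S (S k))) * (ppow (S (S k)) (1 - eps * / s) * (eps * (/ s) ^ 2)))).
  by move=> s; rewrite Rmult_assoc. 
apply: is_derive_scal; apply: is_derive_eq (is_derive_Rmult _ _ _ _ _ (dpp k t t0) d2) _; ring.
Qed.

Lemma smooth_chain j eps : 0 < eps ->
  smooth_family false (fun _ => True) (fun t => 0 < t) (S (S k)) (fun _ => chain j eps).
Proof.
move=> e0; have oU := open_gt 0.
have sid l : smooth_family false (fun _ => True) (fun t => 0 < t) l (fun _ t => t).
  exact: smooth_family_id.
elim: j => [|j IH].
  apply: smooth_family_ppow => //.
  apply: (smooth_family_ext _ _ _ oU _ (fun _ t => 1 + (- eps) * / t)).
    by move=> _ t _ _; ring.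
  apply: smooth_family_add => //; first exact: smooth_family_const.
  apply: smooth_family_scal => //; apply: smooth_family_inv => //.
  by move=> _ t _ t0; lra.
apply: smooth_family_pred.
have := smooth_inv_lap m false (eq eps) (fun t => 0 < t) (S (S k)) (chain j) oU.
(* A fixed [eps] is treated as a family with the one-point parameter set [eq eps], so that
   [smooth_inv_lap] applies. *)
have eqP l (f : R -> R -> R) : smooth_family false (eq eps) (fun t => 0 < t) l f <->
    smooth_family false (fun _ => True) (fun t => 0 < t) l (fun _ => f eps).
  elim: l f => [|l IHl] f; first by split=> _; split.
  split=> - [_ [df Hf]]; split=> //; split.
  - by move=> _ t _ t0; apply: df.
  - exact/(IHl (fun p => Derive (f p))).
  - by move=> p t <- t0; apply: (df 0).
  - exact/(IHl (fun p => Derive (f p))).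
move=> H; apply/(eqP _ (fun p => inv_lap m p (chain j p))); apply: H => //.
- by move=> p <-.
- by move=> p <- t; apply: ex_derive_chain.
- exact/eqP.
Qed.

(** For [eps < 1/8 < t] the truncation is inactive and [chain 0] is a polynomial in [eps / t]. All
    derivatives are thus bounded uniformly in [eps], which is what the transition zone of the
    cut-off requires. *)
Lemma smooth_chain_bounded l j :
  smooth_family true (fun eps => 0 < eps < 1 / 8) (fun t => 1 / 8 < t < 2) l (chain j).
Proof.
have oU := open_Ioo (1 / 8) 2.
have bi t : 1 / 8 < t < 2 -> Rabs (/ t) <= 8.
  move=> ht; rewrite Rabs_right; last by apply: Rle_ge; left; apply: Rinv_0_lt_compat; lra.
  by rewrite -(Rinv_inv 8); apply: Rinv_le_contravar; lra.
have bt t : 1 / 8 < t < 2 -> Rabs t <= 2 by move=> ht; rewrite Rabs_right; lra.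
elim: j => [|j IH].
  apply: (smooth_family_ext _ _ _ oU _ (fun eps t => (1 + (- eps) * / t) ^ (S (S (S k))))).
    move=> eps t he ht; rewrite /= -/(ppow (S (S (S k))) _) ppow_pos.
      by rewrite /=; congr (_ * (_ * (_ * _))); try ring; congr (_ ^ _); ring.
    have : eps * / t <= 1; last lra.
    by apply: (Rmult_le_reg_r t); rewrite ?Rmult_assoc ?Rinv_l; lra.
  apply: smooth_family_pow => //; apply: smooth_family_add => //.
    by apply: smooth_family_const => // _; exists (Rabs 1) => _ _; lra.
  apply: smooth_family_mult => //.
    apply: (smooth_family_const _ _ _ oU _ (fun p => - p)) => // _; exists 1 => p hp.
    by rewrite Rabs_Ropp Rabs_right; lra.
  apply: smooth_family_inv => //.
  - by move=> _ t _ ht; lra.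
  - by move=> _; exists 8 => _ t _; exact: bi.
  - by apply: smooth_family_id => // _; exists 2.
apply: smooth_family_pred.
apply: smooth_inv_lap => //.
- by move=> t; lra.
- by move=> p; lra.
- by move=> _; exists 2.
- by move=> _; exists 8.
- by move=> p hp t; apply: ex_derive_chain; lra.
- move=> _; exists 1 => p t hp ht; 
  have h1 : chain (S j) p t <= 1 by apply: chain_le1; lra.
  have h2 : 0 <= chain (S j) p t by apply: chain_ge0; lra.
  by rewrite -[inv_lap _ _ _]/(chain (S j) p) Rabs_right; lra.
- move=> _; exists (2 ^ m) => p t hp ht.
  have d0 : forall s, 0 < s -> ex_derive (chain j p) s by move=> s; apply: ex_derive_chain; lra.
  have g0 : forall s, 0 < s -> 0 <= chain j p s by move=> s; apply: chain_ge0; lra.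
  have l1 : forall s, 0 < s <= 2 -> chain j p s <= 1 by move=> s; apply: chain_le1; lra.
  have tm : t ^ m <= 2 ^ m by apply: pow_incr; lra.
  have tm0 : 0 <= t ^ m by apply: pow_le; lra.
  have p0 : 0 < p by lra.
  have H1 : moment m p (chain j p) t <= t ^ m / 4 by apply: moment_le => //; lra.
  have H2 : 0 <= moment m p (chain j p) t by apply: moment_ge0 => //; lra.
  by apply: Rabs_le; split; [apply: Rle_trans H2 | apply: Rle_trans H1 _]; lra.
Qed.

End TestA.

(** [Psi] is [chain (m - 1)] times the cut-off. For [t < 1/4] the cut-off is [1] and the [m]-fold
    Laplacian is [radial_lap (chain 0)], of known sign; in the transition zone only its size
    matters, and it is uniform in [eps]. *)
Lemma radial_test_origin_pos (m : nat) : (3 <= m)%coq_nat ->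
  exists c C A, 0 < c /\ 0 < C /\ 1 <= A /\
  forall eps, 0 < eps < 1 / 8 -> exists Psi : R -> R,
    smooth_family false (fun _ => True) (fun t => 0 < t) (2 * m + 1) (fun _ => Psi) /\
    (forall t, 0 < t < eps \/ 1 < t -> Psi t = 0) /\
    (forall t, 0 < t -> 0 <= Psi t) /\
    (forall t, A * eps <= t <= 1 / 4 -> c * t ^ (m - 1) <= Psi t) /\
    (forall t, 0 < t < 1 / 4 -> 0 <= iter m (radial_lap (2 * m)) Psi t) /\
    (forall t, t < 1 / 4 -> 3 / 2 * eps <= t <= 9 / 2 * eps ->
       c / eps <= iter m (radial_lap (2 * m)) Psi t) /\
    (forall t, 1 / 4 <= t <= 1 -> Rabs (iter m (radial_lap (2 * m)) Psi t) <= C).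
Proof.
move=> m3; set k := (2 * m + 1)%nat.
have [c [A [c0 [A1 cge]]]] := chain_ge m k m3 (m - 1).
have oI := open_Ioo (1 / 8) 2; have oP := open_gt 0.
have bt t : 1 / 8 < t < 2 -> Rabs t <= 2 by move=> ht; rewrite Rabs_right; lra.
have em : (m = S (m - 1))%nat by lia.
have [HC _] : smooth_family true (fun eps => 0 < eps < 1 / 8) (fun t => 1 / 8 < t < 2) 0
   (fun eps => iter m (radial_lap (2 * m)) (fun t => cutoff k t * chain m k (m - 1) eps t)).
  apply: (smooth_family_iter_radial_lap _ _ _ oI _ m 0 (fun eps t => cutoff k t * chain m k (m - 1) eps t)).
    by move=> _; exists 2.
  apply: (smooth_family_mult _ _ _ oI _ (fun _ => cutoff k)).
    apply: (smooth_family_bounded _ (fun _ => True)) => //; first exact: open_true.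
    apply: smooth_family_le (smooth_cutoff k _ _ open_true); lia.
  by apply: smooth_chain_bounded.
have [C {}HC] := HC erefl.
have K1 : 1 <= INR (S (S (S k))) by rewrite !S_INR; have := pos_INR k; lra.
have K2 : 1 <= INR (S (S k)) by rewrite !S_INR; have := pos_INR k; lra.
have M3 : 3 <= INR m by rewrite (_ : 3 = INR 3); [apply: le_INR | rewrite /=; ring].
(* [16/81] is [4 eps^2 / t^2] at [t = 9/2 eps], and [1/3] is [1 - eps / t] at [t = 3/2 eps]: the
   worst values on the annulus. *)
have c'0 : 0 < 16 / 81 * (1 / 3) ^ (S (S k)).
  by apply: Rmult_lt_0_compat; [lra | apply: pow_lt; lra].
exists (Rmin c (16 / 81 * (1 / 3) ^ (S (S k)))), (Rmax 1 C), A.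
split; first exact: Rmin_glb_lt.
split; first by apply: Rlt_le_trans (Rmax_l _ _); lra.
split=> // eps he; exists (fun t => cutoff k t * chain m k (m - 1) eps t).
have lapE t : 0 < t < 1 / 4 -> iter m (radial_lap (2 * m)) (fun t => cutoff k t * chain m k (m - 1) eps t) t =
   radial_lap (2 * m) (chain m k 0 eps) t.
  move=> ht; rewrite (iter_radial_lap_ext _ (open_Ioo 0 (1 / 4)) _ _ _ (chain m k (m - 1) eps)) //.
    rewrite {1}em iterS; apply: (radial_lap_ext _ oP); last lra.
    by move=> s s0; apply: iter_radial_lap_chain => //; lra.
  by move=> s hs; rewrite cutoff1; lra.
have lapge t : 0 < t -> let q := INR (S (S (S k))) in
   0 <= radial_lap (2 * m) (chain m k 0 eps) t /\
   4 * (eps * (/ t) ^ 2) * ppow (S (S k)) (1 - eps * / t) <= radial_lap (2 * m) (chain m k 0 eps) t.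
  move=> t0 q; rewrite radial_lap_chain0 //; last lra.
  have it : 0 < / t := Rinv_0_lt_compat _ t0.
  have a1 := ppow_ge0 (S k) (1 - eps * / t); have a2 := ppow_ge0 (S (S k)) (1 - eps * / t).
  move: (INR (S (S k))) K2 (ppow (S k) _) (ppow (S (S k)) _) a1 a2 => q2 Q2 x y x0 y0.
  have h1 : 0 <= 4 * q2 * (eps ^ 2 * (/ t) ^ 3) * x.
    apply: Rmult_le_pos => //; apply: Rmult_le_pos; first lra.
    by apply: Rmult_le_pos; apply: pow_le; lra.
  have h2 : 0 <= (eps * (/ t) ^ 2) * y.
    by apply: Rmult_le_pos => //; apply: Rmult_le_pos; [lra | apply: pow_le; lra].
  have h3 : 4 * ((eps * (/ t) ^ 2) * y) <= (4 * INR m - 8) * ((eps * (/ t) ^ 2) * y).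
    by apply: Rmult_le_compat_r; lra.
  rewrite -/q in K1 *; move: h1 h2 h3; rewrite -!(Rmult_assoc _ _ y).
  set X := 4 * q2 * _ * x; set Y := (eps * _); set Z := (4 * INR m - 8) * Y * y => h1 h2 h3.
  have h4 : 1 * (X + Z) <= q * (X + Z) by apply: Rmult_le_compat_r; lra.
  rewrite -/Y in h2 h3 *; lra.
split.
  apply: (smooth_family_mult _ _ _ oP _ (fun _ => cutoff k) (fun _ => chain m k (m - 1) eps)).
    exact: smooth_cutoff.
  have sc := smooth_chain m k (m - 1) eps (proj1 he).
  by apply: smooth_family_le sc; rewrite /k; lia.
split.
  move=> t [ht|ht]; first by rewrite chain_eq0 ?Rmult_0_r //; lra.
  by rewrite cutoff0 ?Rmult_0_l //; lra.
split.
  move=> t t0; apply: Rmult_le_pos; first by have := cutoff_bounds k t; lra.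
  by apply: chain_ge0 => //; lra.
split.
  move=> t ht; rewrite cutoff1; last lra.
  rewrite Rmult_1_l; apply: Rle_trans (cge eps t _ _); try lra.
  apply: Rmult_le_compat_r; last exact: Rmin_l.
  by apply: pow_le; nra.
split.
  by move=> t ht; rewrite lapE //; have := lapge t (proj1 ht); lra.
split.
  move=> t t4 ht; rewrite lapE; last lra.
  have t0 : 0 < t by lra.
  apply: Rle_trans (proj2 (lapge t t0)).
  apply: (Rle_trans _ (16 / 81 * (1 / 3) ^ (S (S k)) / eps)).
    by apply: Rmult_le_compat_r; [left; apply: Rinv_0_lt_compat; lra | exact: Rmin_r].
  have e1 : 1 / 3 <= 1 - eps * / t.
    have : eps * / t <= 2 / 3; last lra.
    by apply: (Rmult_le_reg_r t); rewrite ?Rmult_assoc ?Rinv_l; lra.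
  rewrite ppow_pos; last lra.
  have e2 : (1 / 3) ^ S (S k) <= (1 - eps * / t) ^ S (S k) by apply: pow_incr; lra.
  have e3 : 16 / 81 / eps <= 4 * (eps * (/ t) ^ 2).
    have -> : 16 / 81 / eps = 4 * (eps * (/ (9 / 2 * eps)) ^ 2) by field; lra.
    apply: Rmult_le_compat_l; first lra; apply: Rmult_le_compat_l; first lra.
    apply: pow_incr; split; first by left; apply: Rinv_0_lt_compat; lra.
    by apply: Rinv_le_contravar; lra.
  have -> : 16 / 81 * (1 / 3) ^ S (S k) / eps = 16 / 81 / eps * (1 / 3) ^ S (S k) by field; lra.
  apply: Rmult_le_compat => //; last by apply: pow_le; lra.
  by apply: Rmult_le_pos; [lra | left; apply: Rinv_0_lt_compat; lra].
move=> t ht; apply: Rle_trans (Rmax_r _ _).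
by apply: (HC eps); lra.
Qed.

(** The formulas for [chain] carry no information at [t <= 0], whereas a grid may contain the
    origin. Redefining [Psi] as [0] there makes support and sign unconditional without touching its
    derivatives on [t > 0]. *)
Lemma radial_test_origin (m : nat) : (3 <= m)%coq_nat ->
  exists c C A, 0 < c /\ 0 < C /\ 1 <= A /\
  forall eps, 0 < eps < 1 / 8 -> exists Psi : R -> R,
    smooth_family false (fun _ => True) (fun t => 0 < t) (2 * m + 1) (fun _ => Psi) /\
    (forall t, t < eps \/ 1 < t -> Psi t = 0) /\
    (forall t, 0 <= Psi t) /\
    (forall t, A * eps <= t <= 1 / 4 -> c * t ^ (m - 1) <= Psi t) /\
    (forall t, 0 < t < 1 / 4 -> 0 <= iter m (radial_lap (2 * m)) Psi t) /\
    (forall t, t < 1 / 4 -> 3 / 2 * eps <= t <= 9 / 2 * eps ->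
       c / eps <= iter m (radial_lap (2 * m)) Psi t) /\
    (forall t, 1 / 4 <= t <= 1 -> Rabs (iter m (radial_lap (2 * m)) Psi t) <= C).
Proof.
move=> /radial_test_origin_pos [c [C [A [c0 [C0 [A1 H]]]]]].
exists c, C, A; split=> //; split=> //; split=> // eps he.
have [Psi [P1 [P2 [P3 [P4 [P5 [P6 P7]]]]]]] := H eps he.
have oU := open_gt 0.
pose Psi' t := if Rle_dec t 0 then 0 else Psi t.
have E t : 0 < t -> Psi t = Psi' t by rewrite /Psi'; case: Rle_dec => // *; lra.
have EL t : 0 < t -> iter m (radial_lap (2 * m)) Psi' t = iter m (radial_lap (2 * m)) Psi t.
  by move=> t0; symmetry; apply: (iter_radial_lap_ext _ oU).
exists Psi'; split; first by apply: smooth_family_ext P1 => // _ t _; exact: E.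
split; first by move=> t ht; rewrite /Psi'; case: Rle_dec => // t0 /=; apply: P2; lra.
split; first by move=> t; rewrite /Psi'; case: Rle_dec => t0 /=; [lra | apply: P3; lra].
split; first by move=> t ht; rewrite -E; [exact: P4 | apply: Rlt_le_trans (proj1 ht); apply: Rmult_lt_0_compat; lra].
split; first by move=> t ht; rewrite EL; [exact: P5 | lra].
split; first by move=> t h ht; rewrite EL; [exact: P6 | lra].
by move=> t ht; rewrite EL; [exact: P7 | lra].
Qed.

(** * Iterated radial Laplacian of the logarithm *)

Section LogPolyharmonic.
Variable m : nat.

(** The product [(m - j - 1) ... (m - j - d)], taken over the reals so that a vanishing factor kills
    it. *)
Fixpoint descending_prod (j d : nat) : R :=
  match d with
  | O => 1
  | S d' => descending_prod j d' * (INR m - INR j - INR d)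
  end.

Lemma descending_prodS j d :
  descending_prod j (S d) = (INR m - INR (S j)) * descending_prod (S j) d.
Proof.
elim: d => [|d IH]; first by rewrite S_INR; simpl; ring.
rewrite -[LHS]/(descending_prod j (S d) * (INR m - INR j - INR (S (S d)))) IH.
rewrite -[descending_prod (S j) (S d)]/(descending_prod (S j) d * (INR m - INR (S j) - INR (S d))).
by rewrite !S_INR; ring.
Qed.

Lemma descending_prod_eq0 j d : (j + S d = m)%nat -> descending_prod j (S d) = 0.
Proof.
move=> e; rewrite -[descending_prod j (S d)]/(descending_prod j d * (INR m - INR j - INR (S d))).
by rewrite -e -plusE plus_INR; ring.
Qed.

(** Up to the global factor [- (-4)^k], the coefficient of [(k + j - 1)! b^j (s + b)^(-k-j)] in the
    [k]-th radial Laplacian of [ln (s + b)], for [k >= 1]. *)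
Definition log_coef (k j : nat) : R := INR 'C(k, j) * descending_prod j (k - j)%nat.

Lemma log_coef_diag k : log_coef k k = 1.
Proof. by rewrite /log_coef binn subnn /=; ring. Qed.

Lemma log_coef_rec0 k : log_coef (S k) 0 = (INR m - INR (S k)) * log_coef k 0.
Proof.
rewrite /log_coef !bin0 !subn0.
rewrite -[descending_prod 0 (S k)]/(descending_prod 0 k * (INR m - INR 0 - INR (S k))).
by rewrite [INR 0]/=; ring.
Qed.

(** Pascal's rule combined with [(j + 1) C(k, j + 1) = (k - j) C(k, j)], after one factor has been
    split off each falling product. *)
Lemma log_coef_rec k j : (j <= k)%nat ->
  log_coef (S k) (S j) = (INR m - INR (S k) - INR (S j)) * log_coef k (S j) + log_coef k j.
Proof.
move=> jk; rewrite /log_coef.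
have [->|jk'] : j = k \/ (j < k)%nat by lia.
  by rewrite !binn !subnn bin_small //= ; ring.
have -> : (k.+1 - j.+1)%nat = S (k - j.+1) by lia.
have -> : (k - j)%nat = S (k - j.+1) by lia.
rewrite (descending_prodS j) binS -plusE plus_INR.
rewrite -[descending_prod j.+1 (S (k - j.+1))]/(descending_prod j.+1 (k - j.+1) * (INR m - INR j.+1 - INR (S (k - j.+1)))).
have -> : INR (S (k - j.+1)) = INR k - INR j by rewrite -minus_INR; [congr INR; lia | lia].
have : INR (S j) * INR 'C(k, S j) = (INR k - INR j) * INR 'C(k, j).
  by rewrite -minus_INR; [rewrite -!mult_INR !multE minusE mul_bin_left | lia].
move: (descending_prod _ _) (INR 'C(k, j)) (INR 'C(k, S j)) => X c c'; rewrite !S_INR => e.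
have {}e : INR j * c' = (INR k - INR j) * c - c' by rewrite -e; ring.
apply: Rminus_diag_uniq.
by transitivity (X * (INR j * c' - ((INR k - INR j) * c - c'))); [ring | rewrite e; ring].
Qed.

Variable b : R.
Hypothesis b0 : 0 < b.

Definition log_term (k j : nat) (s : R) : R :=
  log_coef (S k) j * INR (fact (k + j)) * b ^ j * (/ (s + b)) ^ S (k + j).

Let U (s : R) := - b < s.

(** The two derivatives are carried as witnesses, so that the relation is additive without separate
    differentiability conditions. *)
Definition has_radial_lap (f g : R -> R) : Prop :=
  exists f1 f2 : R -> R, forall s, U s ->
    is_derive f s (f1 s) /\ is_derive f1 s (f2 s) /\
    g s = 4 * s * f2 s + 4 * INR m * f1 s.

Lemma has_radial_lapP f g : has_radial_lap f g ->
  forall s, U s -> radial_lap (2 * m) f s = g s.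
Proof.
move=> [f1 [f2 H]] s Us; have d1 r : U r -> Derive f r = f1 r.
  by move=> Ur; apply: is_derive_unique; case: (H r Ur).
rewrite /radial_lap d1 // (Derive_ext_open (open_gt (- b)) _ _ _ d1) //.
have [_ [h2 ->]] := H s Us.
by rewrite (is_derive_unique _ _ _ h2) -multE mult_INR /=; ring.
Qed.

Lemma has_radial_lap_plus f g f' g' : has_radial_lap f g -> has_radial_lap f' g' ->
  has_radial_lap (fun s => f s + f' s) (fun s => g s + g' s).
Proof.
move=> [f1 [f2 H]] [f1' [f2' H']].
exists (fun s => f1 s + f1' s), (fun s => f2 s + f2' s) => s Us.
have [h1 [h2 ->]] := H s Us; have [h1' [h2' ->]] := H' s Us.
split; first exact: (is_derive_plus f f').
by split; [exact: (is_derive_plus f1 f1') | ring].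
Qed.

Lemma has_radial_lap_ext f g g' : (forall s, U s -> g s = g' s) ->
  has_radial_lap f g -> has_radial_lap f g'.
Proof.
by move=> e [f1 [f2 H]]; exists f1, f2 => s Us; have [h1 [h2 h3]] := H s Us; rewrite -e.
Qed.

Lemma is_derive_pow_inv (c : R) p s : U s ->
  is_derive (fun s => c * (/ (s + b)) ^ p) s (- (INR p * c) * (/ (s + b)) ^ S p).
Proof.
move=> Us; have nz : s + b <> 0 by rewrite /U in Us; lra.
have d : is_derive (fun s => / (s + b)) s (- (/ (s + b)) ^ 2) by auto_derive => //; field.
apply: is_derive_eq (is_derive_scal _ _ c _ (is_derive_pow _ p _ _ d)) _.
by case: p => [|p]; rewrite ?[Nat.pred _]/=; simpl pow; simpl INR; ring.
Qed.

(** Writing [s = (s + b) - b] turns the result into a combination of the next two powers of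
    [1 / (s + b)]. *)
Lemma has_radial_lap_pow_inv (c : R) p :
  has_radial_lap (fun s => c * (/ (s + b)) ^ p)
   (fun s => 4 * c * INR p * (INR p + 1 - INR m) * (/ (s + b)) ^ S p
      - 4 * c * INR p * (INR p + 1) * b * (/ (s + b)) ^ S (S p)).
Proof.
exists (fun s => - (INR p * c) * (/ (s + b)) ^ S p),
       (fun s => - (INR (S p) * - (INR p * c)) * (/ (s + b)) ^ S (S p)) => s Us.
split; first exact: is_derive_pow_inv.
split; first exact: is_derive_pow_inv.
have nz : s + b <> 0 by rewrite /U in Us; lra.
have -> : (/ (s + b)) ^ S p = (s + b) * (/ (s + b)) ^ S (S p).
  by move: (S p) => q; rewrite -[_ ^ S q]/(_ * _ ^ q); field.
by rewrite S_INR; ring.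
Qed.

(** Partial sums make induction on [N] possible. The extra summand is the share of term [N + 1] of
    the next level that comes from term [N]; at [N = S k] it is the whole last term, because
    diagonal coefficients are [1]. *)
Lemma has_radial_lap_sum k N : (N <= S k)%nat ->
  has_radial_lap (fun s => sum_f_R0 (fun j => log_term k j s) N)
   (fun s => - 4 * sum_f_R0 (fun j => log_term (S k) j s) N
     - 4 * (log_coef (S k) N * INR (fact (S (S k) + N)) * b ^ S N * (/ (s + b)) ^ (S (S (S k) + N)))).
Proof.
have F q : INR (fact (S q)) = (INR q + 1) * INR (fact q).
  by rewrite -[fact (S q)]/(S q * fact q)%coq_nat mult_INR S_INR.
elim: N => [|N IH] Nk.
  have := has_radial_lap_pow_inv (log_coef (S k) 0 * INR (fact (k + 0)) * b ^ 0) (S (k + 0)).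
  apply: has_radial_lap_ext => s Us.
  rewrite ![sum_f_R0 _ 0]/= /log_term (log_coef_rec0 (S k)) !addn0 !F !S_INR [b ^ 0]/= [b ^ 1]/=; ring.
have := has_radial_lap_plus _ _ _ _ (IH (ltnW Nk))
   (has_radial_lap_pow_inv (log_coef (S k) (S N) * INR (fact (k + S N)) * b ^ (S N)) (S (k + S N))).
apply: has_radial_lap_ext => s Us.
rewrite [sum_f_R0 _ (S N)]/= -[in RHS]/(log_term (S k) (S N) s).
rewrite /log_term (log_coef_rec (S k)); last exact: ltnW.
rewrite !addnS !addSn !F !S_INR -plusE !plus_INR.
rewrite -[b ^ S (S N)]/(b * b ^ S N).
set B := b ^ S N; set S0 := sum_f_R0 _ _.
ring.
Qed.

Lemma has_radial_lap_log : has_radial_lap (fun s => ln (s + b))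
  (fun s => 4 * sum_f_R0 (fun j => log_term 0 j s) 1).
Proof.
exists (fun s => 1 * (/ (s + b)) ^ 1), (fun s => - (INR 1 * 1) * (/ (s + b)) ^ 2) => s Us.
have sb : 0 < s + b by rewrite /U in Us; lra.
split.
  by auto_derive => //; field; lra.
split; first exact: is_derive_pow_inv.
rewrite /log_term /= log_coef_rec0 (log_coef_diag 1) /log_coef bin0 /=; field; lra.
Qed.

Lemma iter_radial_lap_log k s : U s ->
  iter (S k) (radial_lap (2 * m)) (fun s => ln (s + b)) s =
  - (-4) ^ (S k) * sum_f_R0 (fun j => log_term k j s) (S k).
Proof.
elim: k s => [|k IH] s Us.
  by rewrite [iter _ _ _]/= (has_radial_lapP _ _ has_radial_lap_log) // [(-4) ^ 1]/=; ring.
rewrite iterS (radial_lap_ext _ (open_gt (- b)) _ _ _ IH) //.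
have oU := open_gt (- b).
have := has_radial_lap_sum k (S k) (leqnn _) => -[f1 [f2 H]].
have H2 : has_radial_lap (fun s => - (-4) ^ S k * sum_f_R0 (fun j => log_term k j s) (S k))
   (fun s => - (-4) ^ S k * (- 4 * sum_f_R0 (fun j => log_term (S k) j s) (S (S k)))).
  exists (fun s => - (-4) ^ S k * f1 s), (fun s => - (-4) ^ S k * f2 s) => r Ur.
  have [h1 [h2 h3]] := H r Ur.
  split; first exact: is_derive_scal.
  split; first exact: is_derive_scal.
  set A := - (-4) ^ S k.
  transitivity (A * (4 * r * f2 r + 4 * INR m * f1 r)); last by ring.
  rewrite -h3 (tech5 _ (S k)); congr (A * _).
  rewrite /log_term !log_coef_diag !addnS !addSn; ring.
rewrite (has_radial_lapP _ _ H2) // -[(-4) ^ S (S k)]/(-4 * (-4) ^ S k); ring.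
Qed.

(** At level [m] every coefficient with [j < m] contains the factor [m - j - (m - j)], so only
    [j = m] survives, and oddness gives [- (-4)^m = 4^m]. What remains is a positive kernel
    concentrated at scale [b]. *)
Lemma iter_radial_lap_log_odd s : odd m -> U s ->
  iter m (radial_lap (2 * m)) (fun s => ln (s + b)) s =
  4 ^ m * INR (fact (2 * m - 1)) * b ^ m * (/ (s + b)) ^ (2 * m).
Proof.
move=> om Us; have [k em] : exists k, m = S k by exists m.-1; move: om; case: (m).
rewrite {1}em iter_radial_lap_log // tech5.
have -> : sum_f_R0 (fun j => log_term k j s) k = 0.
  rewrite (sum_eq_R0 _ k) // => j jk; rewrite /log_term /log_coef.
  rewrite subSn; last by apply/leP.
  by rewrite descending_prod_eq0; [ring | lia].
rewrite /log_term log_coef_diag -em.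
have -> : - (-4) ^ m = 4 ^ m.
  have [q ->] : exists q, m = (2 * q)%coq_nat.+1 by exists m./2; lia.
  rewrite -!tech_pow_Rmult !pow_mult (_ : (-4) ^ 2 = 4 ^ 2); simpl; ring.
have -> : (k + m = 2 * m - 1)%nat by lia.
have -> : ((2 * m - 1).+1 = 2 * m)%nat by lia.
ring.
Qed.

End LogPolyharmonic.

(** * Logarithmic test functions *)

(** Valid without differentiability: the difference quotients agree up to sign, and [Derive] is
    total. *)
Lemma Derive_const_sub (c : R) (f : R -> R) :
  Derive (fun s => c - f s) = fun s => - Derive f s.
Proof.
apply: functional_extensionality => s; rewrite -Derive_opp /Derive; congr real.
by apply: Lim_ext => h; rewrite /Rdiv; congr (_ * _); ring.
Qed.

Lemma radial_lap_const_sub n (c : R) (f : R -> R) :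
  radial_lap n (fun s => c - f s) = fun s => 0 - radial_lap n f s.
Proof.
apply: functional_extensionality => s.
by rewrite /radial_lap Derive_const_sub Derive_opp; ring.
Qed.

Lemma iter_radial_lap_const_sub n j (c : R) (f : R -> R) :
  iter (S j) (radial_lap n) (fun s => c - f s) = fun s => 0 - iter (S j) (radial_lap n) f s.
Proof.
elim: j => [|j IH]; first exact: radial_lap_const_sub.
by rewrite iterS IH radial_lap_const_sub.
Qed.

Lemma smooth_log (b : R) k : 0 < b ->
  smooth_family false (fun _ => True) (fun s => - b < s) k (fun _ s => ln 2 - ln (s + b)).
Proof.
move=> b0; have oU := open_gt (- b); case: k => [|k]; first by split.
apply: (@smooth_family_intro _ _ _ oU _ _ (fun _ s => -1 * / (s + b))) => //.
  by move=> _ s _ hs; auto_derive; [lra | field; lra].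
apply: smooth_family_scal => //; apply: smooth_family_inv => //.
  by move=> _ s _ hs; lra.
apply: smooth_family_add => //; first exact: smooth_family_id.
exact: smooth_family_const.
Qed.

Lemma smooth_log_bounded k :
  smooth_family true (fun b => 0 < b < 1) (fun s => 1 / 8 < s < 2) k
    (fun b s => ln 2 - ln (s + b)).
Proof.
have oU := open_Ioo (1 / 8) 2.
have bd : true = true -> exists C, forall b s, 0 < b < 1 -> 1 / 8 < s < 2 -> Rabs (ln 2 - ln (s + b)) <= C.
  move=> _; exists (Rabs (ln 2) + Rabs (ln (1 / 8)) + Rabs (ln 3)) => b s hb hs.
  have h1 : ln (1 / 8) < ln (s + b) by apply: ln_increasing; lra.
  have h2 : ln (s + b) < ln 3 by apply: ln_increasing; lra.
  move: h1 h2; move: (ln (s + b)) (ln 2) (ln 3) (ln (1 / 8)) => x y z w.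
  by rewrite /Rabs; repeat case: Rcase_abs => ?; lra.
case: k => [|k]; first by split.
apply: (@smooth_family_intro _ _ _ oU _ _ (fun b s => -1 * / (s + b))) => //.
  by move=> b s hb hs; auto_derive; [lra | field; lra].
apply: smooth_family_scal => //; apply: smooth_family_inv => //.
- by move=> b s hb hs; lra.
- move=> _; exists 8 => b s hb hs.
  rewrite Rabs_right; last by apply: Rle_ge; left; apply: Rinv_0_lt_compat; lra.
  by rewrite -(Rinv_inv 8); apply: Rinv_le_contravar; lra.
apply: smooth_family_add => //.
  by apply: smooth_family_id => // _; exists 2 => s hs; rewrite Rabs_right; lra.
by apply: (smooth_family_const _ _ _ oU _ (fun b => b)) => // _; exists 1 => b hb; rewrite Rabs_right; lra.
Qed.

(** The constant [ln 2] keeps the logarithm nonnegative while [s + b <= 2]. Below [s = 1/4] the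
    exact formula for the [m]-fold Laplacian applies; beyond it the bounds are uniform in [b]. *)
Lemma radial_test_log (m : nat) : odd m ->
  exists c C, 0 < c /\ 0 < C /\
  forall b, 0 < b < 1 -> exists Psi : R -> R,
    smooth_family false (fun _ => True) (fun s => - b < s) (2 * m + 1) (fun _ => Psi) /\
    (forall s, 1 < s -> Psi s = 0) /\
    (forall s, 0 <= s <= 1 -> 0 <= Psi s <= ln (2 / (s + b))) /\
    (forall s, 0 <= s < 1 / 4 -> iter m (radial_lap (2 * m)) Psi s <= 0) /\
    (forall s, 0 <= s <= b -> s < 1 / 4 ->
       iter m (radial_lap (2 * m)) Psi s <= - (c / b ^ m)) /\
    (forall s, 1 / 4 <= s <= 1 -> Rabs (iter m (radial_lap (2 * m)) Psi s) <= C).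
Proof.
move=> om; set k := (2 * m + 1)%nat.
have oI := open_Ioo (1 / 8) 2.
have bt t : 1 / 8 < t < 2 -> Rabs t <= 2 by move=> ht; rewrite Rabs_right; lra.
have [HC _] : smooth_family true (fun b => 0 < b < 1) (fun t => 1 / 8 < t < 2) 0
   (fun b => iter m (radial_lap (2 * m)) (fun s => cutoff k s * (ln 2 - ln (s + b)))).
  apply: (smooth_family_iter_radial_lap _ _ _ oI _ m 0 (fun b s => cutoff k s * (ln 2 - ln (s + b)))).
    by move=> _; exists 2.
  apply: (smooth_family_mult _ _ _ oI _ (fun _ => cutoff k)).
    apply: (smooth_family_bounded _ (fun _ => True)) => //; first exact: open_true.
    apply: smooth_family_le (smooth_cutoff k _ _ open_true); lia.
  exact: smooth_log_bounded.
have [C {}HC] := HC erefl.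
set F := 4 ^ m * INR (fact (2 * m - 1)).
have F0 : 0 < F.
  apply: Rmult_lt_0_compat; first by apply: pow_lt; lra.
  by apply: lt_0_INR; apply: lt_O_fact.
(* For [s <= b] one has [s + b <= 2 b], so the kernel [b^m / (s + b)^(2m)] is at least
   [(1/2)^(2m) / b^m]. *)
exists (F * (1 / 2) ^ (2 * m)), (Rmax 1 C).
split; first by apply: Rmult_lt_0_compat => //; apply: pow_lt; lra.
split; first by apply: Rlt_le_trans (Rmax_l _ _); lra.
move=> b hb; have oU := open_gt (- b).
exists (fun s => cutoff k s * (ln 2 - ln (s + b))).
have lapE s : 0 <= s < 1 / 4 -> iter m (radial_lap (2 * m)) (fun s => cutoff k s * (ln 2 - ln (s + b))) s =
   - (F * b ^ m * (/ (s + b)) ^ (2 * m)).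
  move=> hs; rewrite (iter_radial_lap_ext _ (open_Ioo (- b) (1 / 4)) _ _ _ (fun s => ln 2 - ln (s + b))); last 1 first.
  - by move: hs; lra.
  - have [j em] : exists j, m = S j by exists m.-1; move: om; case: (m).
    rewrite {1}em iter_radial_lap_const_sub -em iter_radial_lap_log_odd //; last by lra.
    by rewrite /F; ring.
  - by move=> r hr; rewrite cutoff1; lra.
have pp s : 0 <= s -> 0 <= F * b ^ m * (/ (s + b)) ^ (2 * m).
  move=> s0; apply: Rmult_le_pos; first by apply: Rmult_le_pos; [lra | apply: pow_le; lra].
  by apply: pow_le; left; apply: Rinv_0_lt_compat; lra.
split.
  apply: (smooth_family_mult _ _ _ oU _ (fun _ => cutoff k) (fun _ s => ln 2 - ln (s + b))).
    exact: smooth_cutoff.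
  by apply: smooth_log; lra.
split; first by move=> s hs; rewrite cutoff0 ?Rmult_0_l //; lra.
split.
  move=> s hs; rewrite /Rdiv ln_mult ?ln_Rinv; try lra; last by apply: Rinv_0_lt_compat; lra.
  have h : ln (s + b) <= ln 2 by apply: ln_le; lra.
  have := cutoff_bounds k s; rewrite -/(Rminus (ln 2) (ln (s + b))).
  by move: (cutoff k s) => x hx; split; [apply: Rmult_le_pos; lra | nra].
split; first by move=> s hs; rewrite lapE //; have := pp s (proj1 hs); lra.
split; last by move=> s hs; apply: Rle_trans (Rmax_r _ _); apply: (HC b); lra.
move=> s hs hs4; rewrite lapE; last lra.
apply: Ropp_le_contravar.
have -> : F * (1 / 2) ^ (2 * m) / b ^ m = F * b ^ m * (/ (2 * b)) ^ (2 * m).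
  rewrite Rinv_mult Rpow_mult_distr (_ : 1 / 2 = / 2); last field.
  have -> : (2 * m = m + m)%nat by lia.
  rewrite (pow_add (/ b)) !pow_inv; field.
  by split; apply: pow_nonzero; lra.
apply: Rmult_le_compat_l.
  by apply: Rmult_le_pos; [lra | apply: pow_le; lra].
apply: pow_incr; split; first by left; apply: Rinv_0_lt_compat; lra.
by apply: Rinv_le_contravar; lra.
Qed.

Lemma smooth_family_comp_scal (U : R -> Prop) k (c : R) (f : R -> R) : open U ->
  smooth_family false (fun _ => True) U k (fun _ => f) ->
  smooth_family false (fun _ => True) (fun t => U (c * t)) k (fun _ t => f (c * t)).
Proof.
move=> oU; have oV : open (fun t => U (c * t)).
  apply: (open_comp (fun t => c * t)) => // t _.
  exact: (continuous_scal_r (K := R_AbsRing) (V := R_NormedModule) c id t (continuous_id t)).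
elim: k f => [|k IH] f Hf; first by split.
apply: (@smooth_family_intro _ _ _ oV _ _ (fun _ t => c * Derive f (c * t))) => //.
  move=> _ t _ Ut.
  have df := Derive_correct _ _ (smooth_family_ex_derive _ _ _ _ _ Hf 0 _ I Ut).
  apply: is_derive_eq (is_derive_comp f (fun x => c * x) t _ c df _) _ => //.
  by apply: is_derive_eq (is_derive_scal id t c 1 (is_derive_id t)) _; ring.
apply: smooth_family_scal => //; apply: IH; exact: smooth_family_derive Hf.
Qed.

(** The unit test function with [b = (delta / rho)^2], dilated by [1 / rho^2]. The condition
    [delta < rho / 2] puts the core [t <= delta^2] inside the zone where the cut-off is [1]. *)
Lemma radial_test_log_scaled (m : nat) : odd m ->
  exists c C, 0 < c /\ 0 < C /\
  forall rho delta, 0 < delta < rho / 2 -> exists Psi : R -> R,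
    smooth_family false (fun _ => True) (fun t => - delta ^ 2 < t) (2 * m + 1) (fun _ => Psi) /\
    (forall t, rho ^ 2 < t -> Psi t = 0) /\
    (forall t, 0 <= t <= rho ^ 2 -> 0 <= Psi t <= ln (2 * rho ^ 2 / (t + delta ^ 2))) /\
    (forall t, 0 <= t < rho ^ 2 / 4 -> iter m (radial_lap (2 * m)) Psi t <= 0) /\
    (forall t, 0 <= t <= delta ^ 2 ->
       iter m (radial_lap (2 * m)) Psi t <= - (c / delta ^ (2 * m))) /\
    (forall t, rho ^ 2 / 4 <= t <= rho ^ 2 ->
       Rabs (iter m (radial_lap (2 * m)) Psi t) <= C / rho ^ (2 * m)).
Proof.
move=> om; have [c [C [c0 [C0 H]]]] := radial_test_log m om.
exists c, C; split=> //; split=> // rho delta hd.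
have r0 : 0 < rho ^ 2 by apply: pow_lt; lra.
have d0 : 0 < delta ^ 2 by apply: pow_lt; lra.
have dr : 4 * delta ^ 2 < rho ^ 2.
  have -> : 4 * delta ^ 2 = (2 * delta) ^ 2 by ring.
  by rewrite /= !Rmult_1_r; apply: Rmult_le_0_lt_compat; lra.
set s := / rho ^ 2; have s0 : 0 < s by apply: Rinv_0_lt_compat.
have sr : s * rho ^ 2 = 1 by rewrite /s Rinv_l; lra.
have hb : 0 < s * delta ^ 2 < 1 by split; nra.
have [Psi [P1 [P2 [P3 [P4 [P5 P6]]]]]] := H _ hb.
exists (fun t => Psi (s * t)).
have oU := open_gt (- (s * delta ^ 2)).
have eU t : - delta ^ 2 < t <-> - (s * delta ^ 2) < s * t.
  by split=> h; [nra | apply: (Rmult_lt_reg_l s) => //; lra].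
have sm : s ^ m = / rho ^ (2 * m) by rewrite /s pow_inv -pow_mult.
have sm0 : 0 < s ^ m by apply: pow_lt.
have lapE t : 0 <= t -> iter m (radial_lap (2 * m)) (fun t => Psi (s * t)) t =
    s ^ m * iter m (radial_lap (2 * m)) Psi (s * t).
  move=> t0; apply: (iter_radial_lap_scale _ oU (2 * m) m 1 s Psi P1).
  by apply/eU; lra.
split.
  apply: (smooth_family_subdomain _ _ (fun t => - (s * delta ^ 2) < s * t)).
    by move=> t /eU.
  exact: (smooth_family_comp_scal _ _ s Psi oU P1).
split; first by move=> t ht; apply: P2; nra.
split.
  move=> t ht; have -> : 2 * rho ^ 2 / (t + delta ^ 2) = 2 / (s * t + s * delta ^ 2).
    by rewrite /s; field; repeat split; try lra; apply: Rgt_not_eq; nra.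
  by apply: P3; nra.
split.
  move=> t ht; rewrite lapE; last lra.
  have := P4 (s * t); have : 0 <= s * t < 1 / 4 by nra.
  by move=> h /(_ h) h'; nra.
split.
  move=> t ht; rewrite lapE; last lra.
  have -> : - (c / delta ^ (2 * m)) = s ^ m * - (c / (s * delta ^ 2) ^ m).
    rewrite Rpow_mult_distr -(pow_mult delta) multE; field.
    by split; [apply: pow_nonzero; lra | apply: Rgt_not_eq].
  by apply: Rmult_le_compat_l; [lra | apply: P5; nra].
move=> t ht; rewrite lapE; last lra.
rewrite Rabs_mult Rabs_right; last lra.
have -> : C / rho ^ (2 * m) = s ^ m * C by rewrite sm /Rdiv Rmult_comm.
by apply: Rmult_le_compat_l; [lra | apply: P6; nra].
Qed.

(** * Euclidean space and compactness of boxes *)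

Lemma RplusA : associative Rplus. Proof. by move=> x y z; rewrite Rplus_assoc. Qed.
Lemma RmultA : associative Rmult. Proof. by move=> x y z; rewrite Rmult_assoc. Qed.
HB.instance Definition _ := Monoid.isComLaw.Build R 0 Rplus RplusA Rplus_comm Rplus_0_l.
HB.instance Definition _ := Monoid.isComLaw.Build R 1 Rmult RmultA Rmult_comm Rmult_1_l.
HB.instance Definition _ := Monoid.isMulLaw.Build R 0 Rmult Rmult_0_l Rmult_0_r.
HB.instance Definition _ := Monoid.isAddLaw.Build R Rmult Rplus Rmult_plus_distr_r Rmult_plus_distr_l.

Section Sums.
Variable I : finType.
Implicit Types F G : I -> R.

Lemma sumR_ge0 F : (forall i, 0 <= F i) -> 0 <= \big[Rplus/0]_(i : I) F i.
Proof. by move=> F0; elim/big_ind: _ => //; [lra | move=> x y; lra]. Qed.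

Lemma sumR_le F G : (forall i, F i <= G i) ->
  \big[Rplus/0]_(i : I) F i <= \big[Rplus/0]_(i : I) G i.
Proof. by move=> FG; elim/big_ind2: _ => //; [lra | move=> *; lra]. Qed.

Lemma sumR_scal c F : \big[Rplus/0]_(i : I) (c * F i) = c * \big[Rplus/0]_(i : I) F i.
Proof. by rewrite big_distrr. Qed.

Lemma sumR_add F G : \big[Rplus/0]_(i : I) (F i + G i) =
  \big[Rplus/0]_(i : I) F i + \big[Rplus/0]_(i : I) G i.
Proof. by rewrite big_split. Qed.

Lemma sumR_abs F : Rabs (\big[Rplus/0]_(i : I) F i) <= \big[Rplus/0]_(i : I) Rabs (F i).
Proof.
elim/big_ind2: _ => [|x x' y y' h h'|i _]; try (rewrite ?Rabs_R0; lra).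
by apply: Rle_trans (Rabs_triang _ _) _; lra.
Qed.

Lemma sumR_const c : \big[Rplus/0]_(i : I) c = INR #|I| * c.
Proof.
rewrite big_const; elim: #|I| => [|k IH]; first by rewrite /=; ring.
by rewrite iterS IH S_INR; ring.
Qed.

Lemma sumR_term F i : (forall j, 0 <= F j) -> F i <= \big[Rplus/0]_(j : I) F j.
Proof.
move=> F0; rewrite (bigD1 i) //=.
have : 0 <= \big[Rplus/0]_(j | j != i) F j by elim/big_ind: _ => //; [lra | move=> x y; lra].
lra.
Qed.
End Sums.

(** * Euclidean norm, neighbourhoods and continuity *)

Section Euclid.
Variable n : nat.
Implicit Types x y z : pt n.

Definition sqdist z y : R := \big[Rplus/0]_(i < n) ((y i - z i) * (y i - z i)).

Lemma sqdist_ge0 z y : 0 <= sqdist z y.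
Proof. by apply: sumR_ge0 => i; apply: Rle_0_sqr. Qed.

Lemma norm_ge0 x : 0 <= norm x. Proof. exact: sqrt_pos. Qed.

Lemma norm_sqr x : norm x * norm x = \big[Rplus/0]_(i < n) (x i * x i).
Proof. by apply: sqrt_sqrt; apply: sumR_ge0 => i; apply: Rle_0_sqr. Qed.

Lemma sqdist_norm z y : sqdist z y = norm (vsub y z) ^ 2.
Proof. by rewrite /= Rmult_1_r norm_sqr. Qed.

Lemma sqdist0 y : sqdist (fun _ => 0) y = norm y ^ 2.
Proof. by rewrite /= Rmult_1_r norm_sqr; apply: eq_bigr => i _; ring. Qed.

Lemma norm_triang x y : norm (fun i => x i + y i) <= norm x + norm y.
Proof.
have zero (w v : pt n) : norm w = 0 -> norm (fun i => w i + v i) <= norm v.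
  move=> w0; have wi i : w i = 0.
    have := norm_sqr w; rewrite w0 Rmult_0_l => e.
    have := sumR_term _ (fun i => w i * w i) i (fun j => Rle_0_sqr (w j)).
    by rewrite -e => h; nra.
  by right; congr norm; apply: functional_extensionality => i; rewrite wi; ring.
have [x0|x0] := Req_dec (norm x) 0; first by have := zero x y x0; lra.
have [y0|y0] := Req_dec (norm y) 0.
  have -> : (fun i => x i + y i) = (fun i => y i + x i).
    by apply: functional_extensionality => i; ring.
  by have := zero y x y0; lra.
have A0 := norm_ge0 x; have B0 := norm_ge0 y.
apply: Rsqr_incr_0_var; last lra.
rewrite /Rsqr norm_sqr.
set A := norm x in x0 A0 *; set B := norm y in y0 B0 *.
(* Weighted AM-GM: [2 x y <= (B / A) x^2 + (A / B) y^2]. *)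
apply: (Rle_trans _ (\big[Rplus/0]_(i < n) ((1 + B / A) * (x i * x i) + (1 + A / B) * (y i * y i)))).
  apply: sumR_le => i.
  have : 0 <= (/ (A * B)) * ((B * x i - A * y i) * (B * x i - A * y i)).
    by apply: Rmult_le_pos (Rle_0_sqr _); left; apply: Rinv_0_lt_compat; nra.
  have -> : (/ (A * B)) * ((B * x i - A * y i) * (B * x i - A * y i)) =
      (B / A) * (x i * x i) + (A / B) * (y i * y i) - 2 * (x i * y i) by field.
  lra.
rewrite sumR_add !sumR_scal -!norm_sqr -/A -/B; right; by field.
Qed.

Lemma norm_vsub_sym x y : norm (vsub x y) = norm (vsub y x).
Proof. by rewrite /norm; congr sqrt; apply: eq_bigr => i _; rewrite /vsub; ring. Qed.

Lemma norm_vsub_triang x y z : norm (vsub x z) <= norm (vsub x y) + norm (vsub y z).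
Proof.
have -> : vsub x z = fun i => vsub x y i + vsub y z i.
  by apply: functional_extensionality => i; rewrite /vsub; ring.
exact: norm_triang.
Qed.

Lemma norm_le_add x y : norm x <= norm y + norm (vsub x y).
Proof.
have {1}-> : x = fun i => y i + vsub x y i.
  by apply: functional_extensionality => i; rewrite /vsub; ring.
exact: norm_triang.
Qed.

Lemma coord_le_norm x i : Rabs (x i) <= norm x.
Proof.
apply: Rsqr_incr_0_var; last exact: norm_ge0.
rewrite -Rsqr_abs {2}/Rsqr norm_sqr.
exact: (sumR_term _ (fun i => x i * x i) i (fun j => Rle_0_sqr (x j))).
Qed.

Lemma norm_le_coord x M : 0 <= M -> (forall i, Rabs (x i) <= M) -> norm x <= INR n * M.
Proof.
move=> M0 H; apply: Rsqr_incr_0_var; last first.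
  by apply: Rmult_le_pos => //; exact: pos_INR.
rewrite {1}/Rsqr norm_sqr; apply: (Rle_trans _ (\big[Rplus/0]_(i < n) (M * M))).
  apply: sumR_le => i; rewrite -/(Rsqr (x i)) Rsqr_abs; apply: Rmult_le_compat => //; exact: Rabs_pos.
rewrite sumR_const card_ord /Rsqr.
have -> : INR n * M * (INR n * M) = INR n * (INR n * (M * M)) by ring.
have MM : 0 <= M * M by nra.
case: (n) => [|n']; first by rewrite /=; lra.
rewrite -[X in X <= _]Rmult_1_l; apply: Rmult_le_compat_r.
  by apply: Rmult_le_pos => //; exact: pos_INR.
by rewrite S_INR; have := pos_INR n'; lra.
Qed.

Lemma sqdist_upd z x i t :
  sqdist z (upd x i t) = sqdist z x - (x i - z i) * (x i - z i) + (t - z i) * (t - z i).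
Proof.
rewrite /sqdist (bigD1 i) //= (bigD1 i (F := fun j => (x j - z j) * (x j - z j))) //=.
rewrite {1 2}/upd eqxx.
have -> : \big[Rplus/0]_(j < n | j != i) ((upd x i t j - z j) * (upd x i t j - z j)) =
          \big[Rplus/0]_(j < n | j != i) ((x j - z j) * (x j - z j)).
  by apply: eq_bigr => j ji; rewrite /upd (negbTE ji).
by move: (\big[Rplus/0]_(j < n | j != i) _) => X /=; ring.
Qed.

Lemma norm_vsub_upd x i t : norm (vsub (upd x i t) x) = Rabs (t - x i).
Proof.
rewrite -sqrt_Rsqr_abs /Rsqr /norm; congr sqrt.
rewrite (bigD1 i) //= big1 => [|j ji]; rewrite /vsub /upd; last by rewrite (negbTE ji); ring.
by rewrite eqxx /=; ring.
Qed.

Lemma upd_id x i : upd x i (x i) = x.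
Proof. by apply: functional_extensionality => j; rewrite /upd; case: eqP => [->|]. Qed.

Lemma upd_upd x i s t : upd (upd x i s) i t = upd x i t.
Proof. by apply: functional_extensionality => j; rewrite /upd; case: eqP. Qed.

Definition pnear x (P : pt n -> Prop) : Prop :=
  exists d, 0 < d /\ forall y, norm (vsub y x) < d -> P y.

Global Instance pnear_filter x : Filter (pnear x).
Proof.
constructor.
- by exists 1; split; [lra|].
- move=> P Q [d [d0 HP]] [e [e0 HQ]]; exists (Rmin d e); split; first exact: Rmin_glb_lt.
  move=> y hy; split; [apply: HP | apply: HQ]; apply: Rlt_le_trans hy _;
    [exact: Rmin_l | exact: Rmin_r].
- by move=> P Q PQ [d [d0 HP]]; exists d; split=> // y hy; apply: PQ; apply: HP.
Qed.

Lemma norm_vsub_self x : norm (vsub x x) = 0.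
Proof.
rewrite /norm big1 ?sqrt_0 // => i _; rewrite /vsub; ring.
Qed.

Lemma pnear_self x P : pnear x P -> P x.
Proof. by move=> [d [d0 H]]; apply: H; rewrite norm_vsub_self. Qed.

Definition cont_at (F : pt n -> R) x : Prop := filterlim F (pnear x) (locally (F x)).

Lemma cont_atP F x : cont_at F x <->
  forall eps, 0 < eps -> pnear x (fun y => Rabs (F y - F x) < eps).
Proof.
split.
  move=> cF eps e0; apply: (cF (fun v => Rabs (v - F x) < eps)).
  by exists (mkposreal _ e0) => v; apply.
move=> H P [e He]; apply: filter_imp (H e (cond_pos e)) => y hy; exact: He.
Qed.

Lemma cont_at_ext F G x : pnear x (fun y => F y = G y) -> cont_at F x -> cont_at G x.
Proof.
move=> e cF; have ex := pnear_self _ _ e; rewrite /cont_at -ex.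
exact: filterlim_ext_loc cF.
Qed.

Lemma cont_at_const c x : cont_at (fun _ => c) x.
Proof. exact: filterlim_const. Qed.

Lemma cont_at_add F G x : cont_at F x -> cont_at G x -> cont_at (fun y => F y + G y) x.
Proof.
move=> cF cG; apply: (filterlim_comp_2 F G Rplus cF cG).
exact: (filterlim_plus (K := R_AbsRing) (V := R_NormedModule)).
Qed.

Lemma cont_at_mult F G x : cont_at F x -> cont_at G x -> cont_at (fun y => F y * G y) x.
Proof.
move=> cF cG; apply: (filterlim_comp_2 F G Rmult cF cG).
exact: (filterlim_mult (K := R_AbsRing)).
Qed.

Lemma cont_at_coord i x : cont_at (fun y => y i) x.
Proof.
apply/cont_atP => eps e0; exists eps; split=> // y hy.
exact: Rle_lt_trans (coord_le_norm (vsub y x) i) hy.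
Qed.

Lemma cont_at_comp (f : R -> R) F x : continuous f (F x) -> cont_at F x ->
  cont_at (fun y => f (F y)) x.
Proof. by move=> cf cF; apply: filterlim_comp cF cf. Qed.

Lemma cont_at_sum (I : finType) (F : I -> pt n -> R) x : (forall i, cont_at (F i) x) ->
  cont_at (fun y => \big[Rplus/0]_(i : I) F i y) x.
Proof.
move=> cF; elim: (index_enum I) => [|i s IH].
  by apply: (cont_at_ext (fun _ => 0)) (cont_at_const _ _); apply: filter_forall => y; rewrite big_nil.
apply: (cont_at_ext (fun y => F i y + \big[Rplus/0]_(j <- s) F j y)).
  by apply: filter_forall => y; rewrite big_cons.
exact: cont_at_add.
Qed.

Lemma cont_at_sqdist z x : cont_at (sqdist z) x.
Proof.
apply: cont_at_sum => i.
by apply: cont_at_mult; apply: (cont_at_add (fun y => y i) (fun _ => - z i));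
  try exact: cont_at_coord; exact: cont_at_const.
Qed.

Lemma cont_at_of_continuous_on (U : pt n -> Prop) F x :
  pnear x U -> continuous_on U F -> cont_at F x.
Proof.
move=> nU cF; apply/cont_atP => eps e0.
have [d [d0 H]] := cF x (pnear_self _ _ nU) eps e0.
have nd : pnear x (fun y => norm (vsub y x) < d) by exists d.
by apply: filter_imp (filter_and _ _ nU nd) => y [Uy hy]; apply: H.
Qed.

Lemma pnear_norm_lt x c : norm x < c -> pnear x (fun y => norm y < c).
Proof.
move=> xc; exists (c - norm x); split; first lra.
by move=> y hy; have := norm_le_add y x; lra.
Qed.

Lemma pnear_norm_gt x c : c < norm x -> pnear x (fun y => c < norm y).
Proof.
move=> xc; exists (norm x - c); split; first lra.
by move=> y hy; have := norm_le_add x y; rewrite (norm_vsub_sym x y); lra.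
Qed.

Lemma pnear_punct_ball2 x : punct_ball2 x -> pnear x (@punct_ball2 n).
Proof. by move=> [h1 h2]; apply: filter_and; [exact: pnear_norm_gt | exact: pnear_norm_lt]. Qed.

End Euclid.

(** * Compactness of boxes, by passing to nested pairs *)

Section BoxCover.

Fixpoint tnth (n : nat) : Tn n R -> nat -> R :=
  match n with
  | O => fun _ _ => 0
  | S n' => fun t i => match i with O => fst t | S i' => tnth n' (snd t) i' end
  end.

Fixpoint tuple_of (n : nat) (f : nat -> R) : Tn n R :=
  match n with
  | O => tt
  | S n' => (f O, tuple_of n' (fun i => f (S i)))
  end.

Lemma bounded_tuple_of n L f : (forall i, (i < n)%nat -> Rabs (f i) <= L) ->
  bounded_n n (tuple_of n (fun _ => - L)) (tuple_of n (fun _ => L)) (tuple_of n f).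
Proof.
elim: n f => [|n IH] f H //=; split; last by apply: IH => i hi; apply: H.
by have := H O isT; move/Rabs_le_between.
Qed.

Lemma close_tuple_of n d f t : close_n n d (tuple_of n f) t ->
  forall i, (i < n)%nat -> Rabs (f i - tnth n t i) < d.
Proof.
elim: n f t => [|n IH] f t //=; case: t => t1 t2 [h1 h2] [|i] hi //=.
exact: (IH (fun i => f (S i))).
Qed.

(** [compactness_list] measures closeness coordinatewise, and the norm is at most [n] times the
    largest coordinate. Division by [n + 1] absorbs this, [n = 0] included. *)
Lemma box_cover n L (delta : pt n -> R) : (forall x, 0 < delta x) ->
  exists l : seq (pt n), forall x : pt n, (forall i, Rabs (x i) <= L) ->
    exists t, List.In t l /\ norm (vsub x t) < delta t.
Proof.
move=> d0; have n1 : 0 < INR n + 1 by have := pos_INR n; lra.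
pose from (t : Tn n R) : pt n := fun i => tnth n t i.
have dp t : 0 < delta (from t) / (INR n + 1).
  by apply: Rmult_lt_0_compat => //; apply: Rinv_0_lt_compat.
have [l Hl] := NNPP _ (compactness_list n (tuple_of n (fun _ => - L)) (tuple_of n (fun _ => L))
  (fun t => mkposreal _ (dp t))).
exists (List.map from l) => x hx.
pose f i := if insub i is Some j then x (j : 'I_n) else 0.
have fE (j : 'I_n) : f j = x j by rewrite /f valK.
have bf : bounded_n n (tuple_of n (fun _ => - L)) (tuple_of n (fun _ => L)) (tuple_of n f).
  by apply: bounded_tuple_of => i hi; rewrite -[i]/(val (Ordinal hi)) fE.
have [t [tl [_ ct]]] := Hl _ bf.
exists (from t); split; first exact: List.in_map.
apply: Rle_lt_trans (norm_le_coord _ _ (delta (from t) / (INR n + 1)) _ _) _; first by left.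
  by move=> i; left; rewrite /vsub -fE; apply: close_tuple_of ct _ _.
have h : INR n < INR n + 1 by lra.
apply: (Rlt_le_trans _ ((INR n + 1) * (delta (from t) / (INR n + 1)))).
  exact: Rmult_lt_compat_r.
by right; field; lra.
Qed.

Lemma list_min n (delta : pt n -> R) (l : seq (pt n)) : (forall x, 0 < delta x) ->
  exists d, 0 < d /\ forall t, List.In t l -> d <= delta t.
Proof.
move=> d0; elim: l => [|t l [d [dp Hd]]]; first by exists 1; split; [lra|].
exists (Rmin (delta t) d); split; first exact: Rmin_glb_lt.
move=> s [<-|sl]; first exact: Rmin_l.
exact: Rle_trans (Rmin_r _ _) (Hd s sl).
Qed.

(** The covering uses half radii, so that [y] stays within the full radius of the centre that covers
    [x]. Only [x] is confined to the box. *)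
Lemma uniform_continuity_box n L (F : pt n -> R) : (forall x, cont_at n F x) ->
  forall eps, 0 < eps -> exists d, 0 < d /\ forall x y : pt n,
    (forall i, Rabs (x i) <= L) -> norm (vsub y x) < d -> Rabs (F y - F x) < eps.
Proof.
move=> cF eps e0.
have H x : {d | 0 < d /\ forall y, norm (vsub y x) < d -> Rabs (F y - F x) < eps / 2}.
  by apply: constructive_indefinite_description; apply: (proj1 (cont_atP n F x) (cF x)); lra.
have dp x : 0 < sval (H x) / 2 by case: (H x) => d [d0 ?] /=; lra.
have [l Hl] := box_cover n L (fun x => sval (H x) / 2) dp.
have [d [d0 Hd]] := list_min n _ l dp.
exists d; split=> // x y hx hy.
have [t [tl xt]] := Hl x hx; move: (Hd t tl) xt.
case: (H t) => e [e1 He] /= de xt.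
have yt : norm (vsub y t) < e by have := norm_vsub_triang n y x t; lra.
have h1 := He y yt; have h2 : Rabs (F x - F t) < eps / 2 by apply: He; lra.
have -> : F y - F x = (F y - F t) + - (F x - F t) by ring.
by apply: Rle_lt_trans (Rabs_triang _ _) _; rewrite Rabs_Ropp; lra.
Qed.

(** The local bound is asked at every point of space; off a closed [K] it is vacuous, and this
    replaces any explicit mention of closedness. *)
Lemma locally_bounded_box n L (K : pt n -> Prop) (F : pt n -> R) :
  (forall x, K x -> forall i, Rabs (x i) <= L) ->
  (forall x, exists M, pnear n x (fun y => K y -> Rabs (F y) <= M)) ->
  exists M, forall x, K x -> Rabs (F x) <= M.
Proof.
move=> KL H.
have H' x : {p : R * R | 0 < p.2 /\ forall y, norm (vsub y x) < p.2 -> K y -> Rabs (F y) <= p.1}.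
  apply: constructive_indefinite_description.
  by have [M [d Hd]] := H x; exists (M, d).
have dp x : 0 < (sval (H' x)).2 by case: (H' x) => p [].
have [l Hl] := box_cover n L _ dp.
have [M HM] : exists M, forall t, List.In t l -> (sval (H' t)).1 <= M.
  elim: (l) => [|t l' [M HM]]; first by exists 0.
  exists (Rmax (sval (H' t)).1 M) => s [<-|sl]; first exact: Rmax_l.
  exact: Rle_trans (HM s sl) (Rmax_r _ _).
exists M => x Kx; have [t [tl xt]] := Hl x (KL x Kx).
apply: Rle_trans (HM t tl); move: xt; case: (H' t) => p [p0 Hp] /= xt; exact: Hp.
Qed.

End BoxCover.

(** * Riemann sums and integration by parts *)

Section RiemannSums.
Variable n : nat.

Definition mesh (N : nat) : R := 4 / INR N.

Definition grid N (k : {ffun 'I_n -> 'I_N}) : pt n := fun i => -2 + mesh N * INR (k i).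

(** Only inequalities for large [N], or limits of differences of such sums, are ever used; this
    suits integrands cut by indicators. *)
Definition rsum N (F : pt n -> R) : R :=
  mesh N ^ n * \big[Rplus/0]_(k : {ffun 'I_n -> 'I_N}) F (grid N k).

Lemma mesh_ge0 N : 0 <= mesh N.
Proof.
rewrite /mesh; case: N => [|N]; first by rewrite /= /Rdiv Rinv_0; lra.
apply: Rmult_le_pos; first lra.
by left; apply: Rinv_0_lt_compat; apply: lt_0_INR; lia.
Qed.

Lemma mesh_pow_ge0 N : 0 <= mesh N ^ n.
Proof. by apply: pow_le; apply: mesh_ge0. Qed.

Lemma rsum_le N F G : (forall x, F x <= G x) -> rsum N F <= rsum N G.
Proof.
by move=> FG; apply: Rmult_le_compat_l; [exact: mesh_pow_ge0 | apply: sumR_le].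
Qed.

Lemma rsum_ge0 N F : (forall x, 0 <= F x) -> 0 <= rsum N F.
Proof. by move=> F0; apply: Rmult_le_pos; [exact: mesh_pow_ge0 | apply: sumR_ge0]. Qed.

Lemma rsum_add N F G : rsum N (fun x => F x + G x) = rsum N F + rsum N G.
Proof. by rewrite /rsum sumR_add /=; ring. Qed.

Lemma rsum_scal N c F : rsum N (fun x => c * F x) = c * rsum N F.
Proof. by rewrite /rsum sumR_scal /=; ring. Qed.

Lemma rsum_ext N F G : (forall x, F x = G x) -> rsum N F = rsum N G.
Proof. by move=> e; congr rsum; apply: functional_extensionality. Qed.

Lemma rsum_sub N F G : rsum N (fun x => F x - G x) = rsum N F - rsum N G.
Proof.
rewrite (rsum_ext N _ (fun x => F x + (-1) * G x)); last by move=> x; ring.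
by rewrite rsum_add rsum_scal; ring.
Qed.

Lemma rsum_sum (I : finType) N (F : I -> pt n -> R) :
  rsum N (fun x => \big[Rplus/0]_(i : I) F i x) = \big[Rplus/0]_(i : I) rsum N (F i).
Proof. by rewrite /rsum exchange_big /= -sumR_scal. Qed.

Lemma INR_expn a b : INR (expn a b) = INR a ^ b.
Proof. by elim: b => [|b IH] //; rewrite expnS -multE mult_INR IH. Qed.

Lemma mesh_mul N : (0 < N)%nat -> mesh N * INR N = 4.
Proof. by move=> N0; rewrite /mesh; field; apply: not_0_INR; lia. Qed.

Lemma rsum_const N c : (0 < N)%nat -> rsum N (fun _ => c) = 4 ^ n * c.
Proof.
move=> N0; rewrite /rsum sumR_const card_ffun !card_ord INR_expn -Rmult_assoc.
by rewrite -Rpow_mult_distr mesh_mul.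
Qed.

Lemma grid_bound N k i : Rabs (grid N k i) <= 2.
Proof.
have kN : (k i < N)%nat by apply: ltn_ord.
have N0 : 0 < INR N by apply: lt_0_INR; lia.
have k0 := pos_INR (k i).
have k1 : INR (k i) <= INR N by apply: le_INR; lia.
have m0 := mesh_ge0 N; have mN : mesh N * INR N = 4 by apply: mesh_mul; lia.
by apply: Rabs_le; rewrite /grid; split; nra.
Qed.

(** A cyclic shift of the [i]-th index permutes the grid. Where it wraps around, the two points
    compared have [i]-th coordinates [2] and [-2], and [F] vanishes at both. *)
Lemma rsum_shift N i (F : pt n -> R) : (0 < N)%nat ->
  (forall x, 2 <= norm x -> F x = 0) ->
  \big[Rplus/0]_(k : {ffun 'I_n -> 'I_N}) F (upd (grid N k) i (grid N k i + mesh N)) =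
  \big[Rplus/0]_(k : {ffun 'I_n -> 'I_N}) F (grid N k).
Proof.
move=> N0 F0.
pose shift (k : {ffun 'I_n -> 'I_N}) : {ffun 'I_n -> 'I_N} :=
  [ffun j => if j == i then ordS (k j) else k j].
have inj : injective shift.
  move=> k k' /ffunP e; apply/ffunP => j; have := e j; rewrite !ffunE.
  by case: eqP => // _; exact: ordS_inj.
rewrite [RHS](reindex_inj inj); apply: eq_bigr => k _.
have kN : (k i < N)%nat by apply: ltn_ord.
have [lt|ge] := ltnP (k i).+1 N.
  congr F; apply: functional_extensionality => j; rewrite /upd /grid ffunE.
  case: eqP => [->|//]; rewrite /= modn_small // S_INR; ring.
have eN : (k i).+1 = N by lia.
have big x : 2 <= Rabs (x i) -> F x = 0.
  by move=> h; apply: F0; have := coord_le_norm _ x i; lra.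
rewrite !big //.
  by rewrite /grid ffunE eqxx /= eN modnn /= Rmult_0_r Rplus_0_r Rabs_left; lra.
rewrite /upd eqxx /grid.
have -> : -2 + mesh N * INR (k i) + mesh N = -2 + mesh N * INR (k i).+1 by rewrite S_INR; ring.
by rewrite eN mesh_mul // Rabs_right; lra.
Qed.

Lemma eventually_pos : eventually (fun N => (0 < N)%nat).
Proof. by exists 1%nat => N hN; apply/ltP. Qed.

Lemma eventually_mesh d : 0 < d -> eventually (fun N => mesh N < d).
Proof.
move=> d0; have [N0 HN0] := nfloor_ex (4 / d) (Rlt_le _ _ (Rdiv_lt_0_compat 4 d ltac:(lra) d0)).
exists (S N0) => N hN; rewrite /mesh.
have h1 : INR N0 + 1 <= INR N by rewrite -S_INR; apply: le_INR.
have h2 : 4 / d < INR N by lra.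
have N1 : 0 < INR N by have := pos_INR N0; lra.
have e4 : 4 = (4 / d) * d by field; lra.
apply: (Rmult_lt_reg_r (INR N)) => //.
rewrite /Rdiv Rmult_assoc Rinv_l; last lra.
rewrite Rmult_1_r {1}e4 Rmult_comm; exact: Rmult_lt_compat_l.
Qed.

(** Difference quotients with step [mesh N] sum to zero by [rsum_shift]. By the mean value theorem
    they differ from [G] by its oscillation over one step, which is uniformly small on the box. *)
Lemma rsum_partial i (F G : pt n -> R) :
  (forall x, is_derive (fun t => F (upd x i t)) (x i) (G x)) ->
  (forall x, cont_at n G x) -> (forall x, 2 <= norm x -> F x = 0) ->
  is_lim_seq (fun N => rsum N G) 0.
Proof.
move=> dF cG F0; apply/is_lim_seq_spec => eps.
have p4 : 0 < 4 ^ n by apply: pow_lt; lra.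
have e0 : 0 < eps / (2 * 4 ^ n) by apply: Rdiv_lt_0_compat; [exact: cond_pos | lra].
have [d [d0 Hd]] := uniform_continuity_box n 2 G cG _ e0.
apply: filter_imp (filter_and _ _ eventually_pos (eventually_mesh d d0)) => N [N0 hN].
have h0 : 0 < mesh N.
  by apply: Rdiv_lt_0_compat; [lra | apply: lt_0_INR; apply/ltP].
rewrite Rminus_0_r.
pose E k := G (grid N k) - / mesh N * (F (upd (grid N k) i (grid N k i + mesh N)) - F (grid N k)).
have ES : \big[Rplus/0]_(k : {ffun 'I_n -> 'I_N}) G (grid N k) = \big[Rplus/0]_k E k.
  rewrite (eq_bigr (fun k => E k + / mesh N * (F (upd (grid N k) i (grid N k i + mesh N)) + (-1) * F (grid N k)))).
    by rewrite sumR_add sumR_scal sumR_add sumR_scal rsum_shift // /=; ring.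
  by move=> k _; rewrite /E; ring.
have Ek k : Rabs (E k) <= eps / (2 * 4 ^ n).
  set x := grid N k.
  have dx s : is_derive (fun t => F (upd x i t)) s (G (upd x i s)).
    have := dF (upd x i s); rewrite [upd x i s i]/upd eqxx.
    by apply: is_derive_ext => t; rewrite upd_upd.
  have cx s : continuity_pt (fun t => F (upd x i t)) s.
    apply/continuity_pt_filterlim.
    by apply: (ex_derive_continuous (K := R_AbsRing) (V := R_NormedModule)); eexists; apply: dx.
  have [c [hc]] := MVT_gen (fun t => F (upd x i t)) (x i) (x i + mesh N) (fun t => G (upd x i t))
    (fun s _ => dx s) (fun s _ => cx s).
  rewrite Rmin_left ?Rmax_right in hc; try lra.
  rewrite upd_id => e; rewrite /E -/x e.
  have -> : G x - / mesh N * (G (upd x i c) * (x i + mesh N - x i)) = - (G (upd x i c) - G x).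
    by field; lra.
  rewrite Rabs_Ropp; left; apply: Hd; first by move=> j; exact: grid_bound.
  by rewrite norm_vsub_upd Rabs_right; lra.
apply: (Rle_lt_trans _ (rsum N (fun _ => eps / (2 * 4 ^ n)))).
  rewrite /rsum ES Rabs_mult (Rabs_right (mesh N ^ n)); last by apply: Rle_ge; exact: mesh_pow_ge0.
  apply: Rmult_le_compat_l; first exact: mesh_pow_ge0.
  by apply: Rle_trans (sumR_abs _ _) _; apply: sumR_le.
rewrite rsum_const //.
have -> : 4 ^ n * (eps / (2 * 4 ^ n)) = eps / 2 by field; lra.
by have := cond_pos eps; lra.
Qed.

Lemma is_lim_seq_sum0 (I : finType) (a : I -> nat -> R) :
  (forall i, is_lim_seq (a i) 0) -> is_lim_seq (fun N => \big[Rplus/0]_(i : I) a i N) 0.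
Proof.
move=> H; elim: (index_enum I) => [|i s IH].
  by apply: (is_lim_seq_ext (fun _ => 0)); [move=> N; rewrite big_nil | exact: is_lim_seq_const].
apply: (is_lim_seq_ext (fun N => a i N + \big[Rplus/0]_(j <- s) a j N)).
  by move=> N; rewrite big_cons.
by have := is_lim_seq_plus' _ _ _ _ (H i) IH; rewrite Rplus_0_r.
Qed.

End RiemannSums.

(** * Green's identity against radial test functions *)

Section IntegrationByParts.
Variables (n K : nat) (u : pt n -> R) (D : seq 'I_n -> pt n -> R).
Hypothesis HC : Ck_with K (@punct_ball2 n) u D.
Variables (z : pt n) (U Z : R -> Prop).
Hypotheses (openU : open U) (openZ : open Z).
Hypothesis ball_U : forall y, punct_ball2 y -> U (sqdist n z y).
Hypothesis outside_Z : forall y, ~ punct_ball2 y -> Z (sqdist n z y).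

Notation T := (sqdist n z).

Lemma pnear_sqdist (V : R -> Prop) x : open V -> V (T x) -> pnear n x (fun y => V (T y)).
Proof. by move=> oV Vx; apply: (cont_at_sqdist n z x V); exact: oV. Qed.

Section Step.
Variables (l : seq 'I_n) (Psi : R -> R).
Hypothesis sizel : (size l + 2 <= K)%nat.
Hypothesis SPsi : smooth_family false (fun _ => True) U 3 (fun _ => Psi).
Hypothesis Psi0 : forall t, Z t -> Psi t = 0.

Let ex1 t : U t -> ex_derive Psi t.
Proof. exact: (smooth_family_ex_derive _ _ _ _ _ SPsi 0). Qed.
Let ex2 t : U t -> ex_derive (Derive Psi) t.
Proof. exact: (smooth_family_ex_derive _ _ _ _ _ (smooth_family_derive _ _ _ _ _ SPsi) 0). Qed.
Let ex3 t : U t -> ex_derive (Derive (Derive Psi)) t.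
Proof.
exact: (smooth_family_ex_derive _ _ _ _ _
  (smooth_family_derive _ _ _ _ _ (smooth_family_derive _ _ _ _ _ SPsi)) 0).
Qed.

Let dPsi0 t : Z t -> Derive Psi t = 0.
Proof. by move=> Zt; rewrite (Derive_ext_open openZ _ (fun _ => 0)) ?Derive_const. Qed.
Let ddPsi0 t : Z t -> Derive (Derive Psi) t = 0.
Proof. by move=> Zt; rewrite (Derive_ext_open openZ _ (fun _ => 0)) ?Derive_const. Qed.

(** The flux of Green's identity in direction [i], for [D l] and [Psi (|y - z|^2)]. Summed over [i],
    its divergence is the Laplacian of the first times the second minus the reverse. [Psi] is smooth
    on [U], which covers the punctured ball, and zero on [Z], which covers the complement. *)
Definition flux i (y : pt n) : R :=
  D (i :: l) y * Psi (T y) - D l y * (2 * (y i - z i) * Derive Psi (T y)).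

Definition flux_div i (y : pt n) : R :=
  D (i :: i :: l) y * Psi (T y)
  - D l y * (2 * Derive Psi (T y) + 4 * ((y i - z i) * (y i - z i)) * Derive (Derive Psi) (T y)).

Lemma cont_at_D l' x : (size l' <= K)%nat -> punct_ball2 x -> cont_at n (D l') x.
Proof.
move=> hs hx; apply: cont_at_of_continuous_on (pnear_punct_ball2 _ _ hx) _.
exact: (proj1 (proj2 HC)).
Qed.

Lemma is_derive_D l' i x : (size l' < K)%nat -> punct_ball2 x ->
  is_derive (fun t => D l' (upd x i t)) (x i) (D (i :: l') x).
Proof. by move=> hs hx; apply/is_derive_Reals; apply: (proj2 (proj2 HC)). Qed.

(** Outside the punctured ball, at its centre in particular, nothing is known about [D]; but [Z] is
    open, so [Psi] and its derivatives vanish nearby and the flux is locally zero. *)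
Lemma is_derive_flux i x : is_derive (fun t => flux i (upd x i t)) (x i) (flux_div i x).
Proof.
have [hx|hx] := classic (punct_ball2 x); last first.
  have Zx := outside_Z x hx.
  rewrite /flux_div Psi0 // dPsi0 // ddPsi0 //.
  apply: is_derive_eq (_ : is_derive _ _ 0) _; last by ring.
  apply: (is_derive_ext_loc (fun _ => 0)); last exact: is_derive_const.
  have [d [d0 Hd]] := pnear_sqdist Z x openZ Zx.
  exists (mkposreal d d0) => t ht; rewrite /flux Psi0 ?dPsi0; last first.
  - by apply: Hd; rewrite norm_vsub_upd.
  - by apply: Hd; rewrite norm_vsub_upd.
  - by rewrite !Rmult_0_r Rminus_0_r.
have Ux := ball_U x hx.
have dT : is_derive (fun t => T (upd x i t)) (x i) (2 * (x i - z i)).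
  apply: (is_derive_ext (fun t => T x - (x i - z i) * (x i - z i) + (t - z i) * (t - z i))).
    by move=> t; rewrite sqdist_upd.
  by auto_derive => //; ring.
have comp (f : R -> R) : ex_derive f (T x) ->
    is_derive (fun t => f (T (upd x i t))) (x i) (2 * (x i - z i) * Derive f (T x)).
  move=> ef; apply: is_derive_eq (is_derive_comp f (fun t => T (upd x i t)) (x i) _ _ _ dT) _; last by [].
  by rewrite upd_id; exact: Derive_correct.
have d1 := comp Psi (ex1 _ Ux); have d2 := comp (Derive Psi) (ex2 _ Ux).
have D1 : is_derive (fun t => D (i :: l) (upd x i t)) (x i) (D (i :: i :: l) x).
  by apply: is_derive_D => //=; lia.
have D2 : is_derive (fun t => D l (upd x i t)) (x i) (D (i :: l) x).
  by apply: is_derive_D => //=; lia.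
have D3 : is_derive (fun t => 2 * (t - z i)) (x i) 2 by auto_derive => //; ring.
apply: (is_derive_ext (fun t => D (i :: l) (upd x i t) * Psi (T (upd x i t)) -
   D l (upd x i t) * (2 * (t - z i) * Derive Psi (T (upd x i t))))).
  by move=> t; rewrite /flux [upd x i t i]/upd eqxx.
apply: is_derive_eq (is_derive_minus _ _ _ _ _ (is_derive_Rmult _ _ _ _ _ D1 d1)
   (is_derive_Rmult _ _ _ _ _ D2 (is_derive_Rmult _ _ _ _ _ D3 d2))) _.
by rewrite /flux_div !upd_id /minus /plus /opp /=; ring.
Qed.

Lemma cont_at_flux_div i x : cont_at n (flux_div i) x.
Proof.
have [hx|hx] := classic (punct_ball2 x); last first.
  have Zx := outside_Z x hx.
  apply: (cont_at_ext _ (fun _ => 0)) (cont_at_const _ _ _).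
  apply: filter_imp (pnear_sqdist Z x openZ Zx) => y Zy.
  by rewrite /flux_div Psi0 // dPsi0 // ddPsi0 //; ring.
have Ux := ball_U x hx.
have comp (f : R -> R) : ex_derive f (T x) -> cont_at n (fun y => f (T y)) x.
  move=> ef; apply: cont_at_comp (cont_at_sqdist _ _ _).
  exact: (ex_derive_continuous (K := R_AbsRing) (V := R_NormedModule)).
have c1 := comp Psi (ex1 _ Ux); have c2 := comp (Derive Psi) (ex2 _ Ux).
have c3 := comp (Derive (Derive Psi)) (ex3 _ Ux).
have cc c := cont_at_const n c x.
have cy : cont_at n (fun y => y i + - z i) x by apply: cont_at_add => //; exact: cont_at_coord.
apply: (cont_at_ext _ (fun y => D (i :: i :: l) y * Psi (T y) + (-1) *
  (D l y * (2 * Derive Psi (T y) + 4 * ((y i + - z i) * (y i + - z i)) * Derive (Derive Psi) (T y))))).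
  by apply: filter_forall => y; rewrite /flux_div; ring.
apply: cont_at_add; first by apply: cont_at_mult => //; apply: cont_at_D => //=; lia.
apply: cont_at_mult => //; apply: cont_at_mult; first by apply: cont_at_D => //=; lia.
by apply: cont_at_add; repeat apply: cont_at_mult => //.
Qed.

Lemma rsum_laplacian_step :
  is_lim_seq (fun N => rsum n N (fun y => \big[Rplus/0]_(i < n) D (i :: i :: l) y * Psi (T y))
    - rsum n N (fun y => D l y * radial_lap n Psi (T y))) 0.
Proof.
apply: (is_lim_seq_ext (fun N => \big[Rplus/0]_(i < n) rsum n N (flux_div i))).
  move=> N; rewrite -rsum_sum -rsum_sub; apply: rsum_ext => y.
  rewrite (eq_bigr (fun i => Psi (T y) * D (i :: i :: l) y +
    ((-1) * (D l y * (2 * Derive Psi (T y))) +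
     ((-4) * D l y * Derive (Derive Psi) (T y)) * ((y i - z i) * (y i - z i))))); last first.
    by move=> i _; rewrite /flux_div; ring.
  rewrite sumR_add sumR_scal sumR_add sumR_const card_ord sumR_scal -/(T y) /radial_lap.
  by rewrite /= ; ring.
apply: is_lim_seq_sum0 => i; apply: rsum_partial (is_derive_flux i) (cont_at_flux_div i) _.
move=> x hx; have Zx : Z (T x) by apply: outside_Z => -[_]; lra.
by rewrite /flux Psi0 // dPsi0 //; ring.
Qed.

End Step.

(** The induction first moves [j] Laplacians from [D (i :: i :: l)], then the last one with
    [iter j (radial_lap n) Psi] as test function. That step consumes three derivatives, the third
    for continuity, hence [2 * j + 1]. *)
Lemma rsum_iter_laplacian j l Psi : (size l + 2 * j <= K)%nat ->
  smooth_family false (fun _ => True) U (2 * j + 1) (fun _ => Psi) ->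
  (forall t, Z t -> Psi t = 0) ->
  is_lim_seq (fun N => rsum n N (fun y => iter_lap D j l y * Psi (T y))
    - rsum n N (fun y => D l y * iter j (radial_lap n) Psi (T y))) 0.
Proof.
move=> + + Psi0; elim: j l => [|j IH] l hs SPsi.
  apply: (is_lim_seq_ext (fun _ => 0)); last exact: is_lim_seq_const.
  by move=> N; rewrite /=; ring.
have S0 : smooth_family false (fun _ => True) U (2 * j + 1) (fun _ => Psi).
  by apply: smooth_family_le SPsi; lia.
have S3 : smooth_family false (fun _ => True) U 3 (fun _ => iter j (radial_lap n) Psi).
  apply: (smooth_family_iter_radial_lap _ _ _ openU n j 3 (fun _ => Psi)) => //.
  by apply: smooth_family_le SPsi; lia.
have Z0 t : Z t -> iter j (radial_lap n) Psi t = 0 by apply: iter_radial_lap_locally0.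
have h1 := rsum_laplacian_step l _ ltac:(lia) S3 Z0.
have h2 : is_lim_seq (fun N => \big[Rplus/0]_(i < n)
    (rsum n N (fun y => iter_lap D j (i :: i :: l) y * Psi (T y)) -
     rsum n N (fun y => D (i :: i :: l) y * iter j (radial_lap n) Psi (T y)))) 0.
  by apply: is_lim_seq_sum0 => i; apply: IH => //=; lia.
have := is_lim_seq_plus' _ _ _ _ h2 h1; rewrite Rplus_0_r; apply: is_lim_seq_ext => N.
have e A : rsum n N (fun y => \big[Rplus/0]_(i < n) A i y * iter j (radial_lap n) Psi (T y)) =
   \big[Rplus/0]_(i < n) rsum n N (fun y => A i y * iter j (radial_lap n) Psi (T y)).
  by rewrite -rsum_sum; apply: rsum_ext => y; rewrite big_distrl.
have e' A : rsum n N (fun y => \big[Rplus/0]_(i < n) A i y * Psi (T y)) =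
   \big[Rplus/0]_(i < n) rsum n N (fun y => A i y * Psi (T y)).
  by rewrite -rsum_sum; apply: rsum_ext => y; rewrite big_distrl.
rewrite (e (fun i => D (i :: i :: l))).
rewrite -[iter_lap D (S j) l]/(fun y => \big[Rplus/0]_(i < n) iter_lap D j (i :: i :: l) y).
rewrite (e' (fun i => iter_lap D j (i :: i :: l))).
rewrite (eq_bigr (fun i => rsum n N (fun y => iter_lap D j (i :: i :: l) y * Psi (T y)) +
    (-1) * rsum n N (fun y => D (i :: i :: l) y * iter j (radial_lap n) Psi (T y)))); last first.
  by move=> i _; ring.
by rewrite sumR_add sumR_scal /=; ring.
Qed.

End IntegrationByParts.

(** * Volumes of balls *)

Definition indic (a b t : R) : R :=
  if Rle_dec a t then if Rle_dec t b then 1 else 0 else 0.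

Lemma indic_spec a b t : (a <= t <= b /\ indic a b t = 1) \/ (~ (a <= t <= b) /\ indic a b t = 0).
Proof.
by rewrite /indic; case: Rle_dec => h1; case: Rle_dec => h2; (try by left); right; split=> //; tauto.
Qed.

Lemma indic01 a b t : 0 <= indic a b t <= 1.
Proof. by case: (indic_spec a b t) => -[_ ->]; lra. Qed.

Lemma indic1 a b t : a <= t <= b -> indic a b t = 1.
Proof. by case: (indic_spec a b t) => -[]. Qed.

Lemma indic0 a b t : ~ (a <= t <= b) -> indic a b t = 0.
Proof. by case: (indic_spec a b t) => -[]. Qed.

(** The bound proved by induction depends on [N]: it counts only up to [Rmin N (b + 1)]. *)
Lemma count_le a b N : a <= b ->
  \big[Rplus/0]_(j < N) indic a b (INR j) <= b - a + 1.
Proof.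
move=> ab; apply: (Rle_trans _ (Rmax 0 (Rmin (INR N) (b + 1) - a))); last first.
  by apply: Rmax_lub; [lra | have := Rmin_r (INR N) (b + 1); lra].
elim: N => [|N IH]; first by rewrite big_ord0; exact: Rmax_l.
rewrite big_ord_recr /= -/(INR N.+1) S_INR; move: IH; move: (\big[_/_]_(_ < _) _) => S.
have [hN|[hN|hN]] : a <= INR N <= b \/ INR N < a \/ b < INR N by lra.
- by rewrite indic1 // /Rmin; repeat case: Rle_dec => ?; rewrite /Rmax; repeat case: Rle_dec => ?; move=> ?; lra.
- by rewrite indic0; [|lra]; rewrite /Rmin; repeat case: Rle_dec => ?; rewrite /Rmax; repeat case: Rle_dec => ?; move=> ?; lra.
- by rewrite indic0; [|lra]; rewrite /Rmin; repeat case: Rle_dec => ?; rewrite /Rmax; repeat case: Rle_dec => ?; move=> ?; lra.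
Qed.

Lemma count_ge a b N : 0 <= a -> b <= INR N ->
  b - a - 1 <= \big[Rplus/0]_(j < N) indic a b (INR j).
Proof.
move=> a0 bN; apply: (Rle_trans _ (Rmin (INR N) b - a - 1)).
  by rewrite Rmin_right; lra.
move: bN => _; elim: N => [|N IH].
  by rewrite big_ord0 /=; have := Rmin_l 0 b; lra.
have S0 : 0 <= \big[Rplus/0]_(j < N) indic a b (INR j).
  by apply: sumR_ge0 => i; have := indic01 a b (INR i); lra.
rewrite big_ord_recr /= -/(INR N.+1) S_INR; move: IH S0; move: (\big[_/_]_(_ < _) _) => S.
have [hN|[hN|hN]] : a <= INR N <= b \/ INR N < a \/ b < INR N by lra.
- by rewrite indic1 // /Rmin; repeat case: Rle_dec => ?; move=> ? ?; lra.
- by rewrite indic0; [rewrite /Rmin; repeat case: Rle_dec => ?; move=> ? ?; lra | lra].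
- by rewrite indic0; [rewrite /Rmin; repeat case: Rle_dec => ?; move=> ? ?; lra | lra].
Qed.

Lemma prodR_le (I : finType) (F : I -> R) M : (forall i, 0 <= F i <= M) ->
  0 <= \big[Rmult/1]_(i : I) F i <= M ^ #|I|.
Proof.
move=> H; have -> : M ^ #|I| = \big[Rmult/1]_(i : I) M.
  by rewrite big_const; elim: #|I| => //= k ->.
elim/big_ind2: _ => [|x y x' y' h h'|//]; first by lra.
by split; [apply: Rmult_le_pos; lra | apply: Rmult_le_compat; lra].
Qed.

Lemma prodR_ge (I : finType) (F : I -> R) M : 0 <= M -> (forall i, M <= F i) ->
  M ^ #|I| <= \big[Rmult/1]_(i : I) F i.
Proof.
move=> M0 H; have -> : M ^ #|I| = \big[Rmult/1]_(i : I) M.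
  by rewrite big_const; elim: #|I| => //= k ->.
suff : 0 <= \big[Rmult/1]_(i : I) M <= \big[Rmult/1]_(i : I) F i by lra.
elim/big_ind2: _ => [|x y x' y' h h'|i _]; [lra | | by split].
by split; [apply: Rmult_le_pos; lra | apply: Rmult_le_compat; lra].
Qed.

Section Volumes.
Variable n : nat.

(** The product form lets the Riemann sum factor into one-dimensional counts. Balls are compared
    with cubes because volumes matter only up to constants. *)
Definition box_indic (z : pt n) (s : R) (y : pt n) : R :=
  \big[Rmult/1]_(i < n) indic (- s) s (y i - z i).

Lemma rsum_box_indic N z s : (0 < N)%nat -> rsum n N (box_indic z s) =
  \big[Rmult/1]_(i < n) (mesh N * \big[Rplus/0]_(j < N)
      indic ((z i - s + 2) / mesh N) ((z i + s + 2) / mesh N) (INR j)).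
Proof.
move=> N0; rewrite big_split /= big_const card_ord.
have -> : iter n (Rmult (mesh N)) 1 = mesh N ^ n by elim: (n) => //= k ->.
rewrite /rsum bigA_distr_bigA /=; congr (_ * _).
have h0 : 0 < mesh N by apply: Rdiv_lt_0_compat; [lra | apply: lt_0_INR; apply/ltP].
apply: eq_bigr => k _; apply: eq_bigr => i _; rewrite /grid.
set j := INR (k i); set h := mesh N in h0 *; set c := z i.
have e1 : - s <= -2 + h * j - c <-> (c - s + 2) / h <= j.
  split=> H; first by apply: (Rmult_le_reg_r h) => //; rewrite /Rdiv Rmult_assoc Rinv_l; lra.
  have := Rmult_le_compat_r h _ _ (Rlt_le _ _ h0) H.
  by rewrite /Rdiv Rmult_assoc Rinv_l; lra.
have e2 : -2 + h * j - c <= s <-> j <= (c + s + 2) / h.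
  split=> H; first by apply: (Rmult_le_reg_r h) => //; rewrite /Rdiv Rmult_assoc Rinv_l; lra.
  have := Rmult_le_compat_r h _ _ (Rlt_le _ _ h0) H.
  by rewrite /Rdiv Rmult_assoc Rinv_l; lra.
by rewrite /indic; repeat case: Rle_dec => ? /=; try (exfalso; tauto).
Qed.

(** Each axis contributes at most [2 s + mesh N], and eventually [mesh N < s]. *)
Lemma eventually_rsum_box_le z s : 0 < s ->
  eventually (fun N => rsum n N (box_indic z s) <= (3 * s) ^ n).
Proof.
move=> s0; apply: filter_imp (filter_and _ _ eventually_pos (eventually_mesh s s0)) => N [N0 hN].
have h0 : 0 < mesh N by apply: Rdiv_lt_0_compat; [lra | apply: lt_0_INR; apply/ltP].
rewrite rsum_box_indic // -[X in _ ^ X](card_ord n); apply: (proj2 (prodR_le _ _ (3 * s) _)) => i; split.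
  apply: Rmult_le_pos; first lra.
  by apply: sumR_ge0 => j; have := indic01 ((z i - s + 2) / mesh N) ((z i + s + 2) / mesh N) (INR j); lra.
apply: (Rle_trans _ (mesh N * ((z i + s + 2) / mesh N - (z i - s + 2) / mesh N + 1))).
  apply: Rmult_le_compat_l; first lra.
  apply: count_le; apply: Rmult_le_compat_r; last lra.
  by left; apply: Rinv_0_lt_compat.
have -> : mesh N * ((z i + s + 2) / mesh N - (z i - s + 2) / mesh N + 1) = 2 * s + mesh N by field; lra.
lra.
Qed.

Lemma eventually_rsum_box_ge z s : 0 < s -> (forall i, Rabs (z i) + s <= 2) ->
  eventually (fun N => s ^ n <= rsum n N (box_indic z s)).
Proof.
move=> s0 hz; apply: filter_imp (filter_and _ _ eventually_pos (eventually_mesh s s0)) => N [N0 hN].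
have h0 : 0 < mesh N by apply: Rdiv_lt_0_compat; [lra | apply: lt_0_INR; apply/ltP].
rewrite rsum_box_indic // -[X in _ ^ X](card_ord n); apply: prodR_ge => [|i]; first lra.
have zi : - (2 - s) <= z i <= 2 - s by apply/Rabs_le_between; have := hz i; lra.
apply: (Rle_trans _ (mesh N * ((z i + s + 2) / mesh N - (z i - s + 2) / mesh N - 1))).
  have -> : mesh N * ((z i + s + 2) / mesh N - (z i - s + 2) / mesh N - 1) = 2 * s - mesh N by field; lra.
  lra.
apply: Rmult_le_compat_l; first lra.
apply: count_ge.
  by apply: Rmult_le_pos; [lra | left; apply: Rinv_0_lt_compat].
apply: (Rmult_le_reg_r (mesh N)) => //; rewrite /Rdiv Rmult_assoc Rinv_l; last lra.
by rewrite (Rmult_comm (INR N)) mesh_mul //; lra.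
Qed.

Lemma ball_le_box z s y : 0 <= s -> indic 0 (s ^ 2) (sqdist n z y) <= box_indic z s y.
Proof.
move=> s0; case: (indic_spec 0 (s ^ 2) (sqdist n z y)) => -[h ->]; last first.
  by apply: (proj1 (prodR_le _ _ 1 _)) => i; exact: indic01.
rewrite /box_indic big1; first lra.
move=> i _; apply: indic1; apply/Rabs_le_between.
apply: Rle_trans (coord_le_norm n (vsub y z) i) _.
apply: Rsqr_incr_0_var => //; rewrite !Rsqr_pow2 -sqdist_norm; lra.
Qed.

Lemma box_le_ball z s y : (0 < n)%nat -> 0 <= s ->
  box_indic z (s / INR n) y <= indic 0 (s ^ 2) (sqdist n z y).
Proof.
move=> n0 s0; have nn : 0 < INR n by apply: lt_0_INR; apply/ltP.
have s1 : 0 <= s / INR n by apply: Rmult_le_pos => //; left; apply: Rinv_0_lt_compat.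
have pl : 0 <= box_indic z (s / INR n) y <= 1.
  by have := prodR_le _ (fun i => indic (- (s / INR n)) (s / INR n) (y i - z i)) 1 (fun i => indic01 _ _ _); rewrite pow1.
have [H|H] := classic (forall i, Rabs (y i - z i) <= s / INR n).
  rewrite indic1; first lra.
  split; first exact: sqdist_ge0.
  rewrite sqdist_norm; apply: pow_incr; split; first exact: norm_ge0.
  have -> : s = INR n * (s / INR n) by field; lra.
  exact: norm_le_coord.
have [i hi] := not_all_ex_not _ _ H.
have -> : box_indic z (s / INR n) y = 0.
  rewrite /box_indic (bigD1 i) //= indic0 ?Rmult_0_l //.
  by move=> /Rabs_le_between.
by have := indic01 0 (s ^ 2) (sqdist n z y); lra.
Qed.

(** * Riemann sums of the logarithmic kernel *)

Definition log_plus (s delta t : R) : R := Rmax 0 (ln (s ^ 2 / (t + delta ^ 2))).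

Lemma log_plus_halve s delta t : 0 < s -> 0 < delta -> 0 <= t ->
  log_plus s delta t <= ln 4 * indic 0 (s ^ 2) t + log_plus (s / 2) delta t.
Proof.
move=> s0 d0 t0; have d2 : 0 < delta ^ 2 by apply: pow_lt.
have s2 : 0 < s ^ 2 by apply: pow_lt.
have l4 : 0 <= ln 4 by rewrite -ln_1; apply: ln_le; lra.
have m0 := Rmax_l 0 (ln ((s / 2) ^ 2 / (t + delta ^ 2))).
rewrite /log_plus; case: (indic_spec 0 (s ^ 2) t) => -[h ->].
  apply: Rmax_lub; first lra.
  have -> : s ^ 2 / (t + delta ^ 2) = 4 * ((s / 2) ^ 2 / (t + delta ^ 2)) by field; lra.
  rewrite ln_mult; [|lra|].
    by have := Rmax_r 0 (ln ((s / 2) ^ 2 / (t + delta ^ 2))); lra.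
  by apply: Rdiv_lt_0_compat; [apply: pow_lt; lra | lra].
apply: Rmax_lub; first lra.
apply: (Rle_trans _ 0); last lra.
rewrite -ln_1; apply: ln_le; first by apply: Rdiv_lt_0_compat; lra.
apply: (Rmult_le_reg_r (t + delta ^ 2)); first lra.
by rewrite /Rdiv Rmult_assoc Rinv_l; lra.
Qed.

(** A dyadic decomposition: halving [s] costs [ln 4] times the volume of a ball, and
    [(3 s / 2)^n <= (3 s)^n / 2] sums the series with the factor [2]. It stops once [s <= delta],
    where the kernel vanishes, so the bound is independent of [delta]. *)
Lemma eventually_rsum_log_plus z s delta : (0 < n)%nat -> 0 < s -> 0 < delta ->
  eventually (fun N => rsum n N (fun y => log_plus s delta (sqdist n z y)) <= 2 * ln 4 * (3 * s) ^ n).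
Proof.
move=> n0 s0 d0.
have l4 : 0 <= ln 4 by rewrite -ln_1; apply: ln_le; lra.
have [J HJ] : exists J, s <= 2 ^ J * delta.
  have [J HJ] := Pow_x_infinity 2 ltac:(rewrite Rabs_right; lra) (s / delta).
  exists J; have := HJ J (le_n J); rewrite Rabs_right; last first.
    by apply: Rle_ge; apply: pow_le; lra.
  move=> h; have -> : s = s / delta * delta by field; lra.
  by apply: Rmult_le_compat_r; lra.
elim: J s s0 HJ => [|J IH] s s0 HJ.
  exists 0%nat => N _; rewrite (rsum_ext n N _ (fun _ => 0 * 0)).
    rewrite rsum_scal Rmult_0_l; apply: Rmult_le_pos; first lra.
    by apply: pow_le; lra.
  move=> y; rewrite Rmult_0_l /log_plus Rmax_left //.
  have t0 := sqdist_ge0 n z y; have d2 : 0 < delta ^ 2 by apply: pow_lt.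
  have s2 : 0 < s ^ 2 by apply: pow_lt.
  have sd : s ^ 2 <= delta ^ 2 by apply: pow_incr; rewrite /= in HJ; lra.
  rewrite -ln_1; apply: ln_le; first by apply: Rdiv_lt_0_compat; lra.
  apply: (Rmult_le_reg_r (sqdist n z y + delta ^ 2)); first lra.
  by rewrite /Rdiv Rmult_assoc Rinv_l; lra.
have s2 : 0 < s / 2 by lra.
have IHs := IH (s / 2) s2 ltac:(rewrite /= in HJ; lra).
apply: filter_imp (filter_and _ _ IHs (eventually_rsum_box_le z s s0)) => N [h1 h2].
apply: (Rle_trans _ (rsum n N (fun y => ln 4 * box_indic z s y + log_plus (s / 2) delta (sqdist n z y)))).
  apply: rsum_le => y; apply: Rle_trans (log_plus_halve s delta _ s0 d0 (sqdist_ge0 n z y)) _.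
  apply: Rplus_le_compat_r; apply: Rmult_le_compat_l => //; apply: ball_le_box; lra.
rewrite rsum_add rsum_scal.
have -> : 2 * ln 4 * (3 * s) ^ n = ln 4 * (3 * s) ^ n + ln 4 * (3 * s) ^ n by ring.
apply: Rplus_le_compat; first exact: Rmult_le_compat_l.
apply: Rle_trans h1 _.
have -> : 3 * (s / 2) = 3 * s * / 2 by field.
rewrite Rpow_mult_distr.
have p0 : 0 <= (3 * s) ^ n by apply: pow_le; lra.
have p1 : (/ 2) ^ n <= / 2.
  have [n' ->] : exists n', n = S n' by exists n.-1; lia.
  have : 0 <= (/ 2) ^ n' <= 1.
    by split; [apply: pow_le; lra | rewrite -(pow1 n'); apply: pow_incr; lra].
  by rewrite /=; lra.
have -> : ln 4 * (3 * s) ^ n = 2 * ln 4 * ((3 * s) ^ n * / 2) by field.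
by apply: Rmult_le_compat_l; [lra | apply: Rmult_le_compat_l].
Qed.

End Volumes.

(** * Integral estimates *)

Section Energy.
Variables (m n : nat) (u : pt n -> R) (D : seq 'I_n -> pt n -> R).
Hypotheses (m3 : (3 <= m)%coq_nat) (mn : n = (2 * m)%nat).
Hypothesis HC : Ck_with n (@punct_ball2 n) u D.
Hypothesis u_ge0 : forall x, punct_ball2 x -> 0 <= u x.
Hypothesis lap_le0 : forall x : pt n, punct_ball2 x -> 0 <= - iter_lap D m [::] x.

Notation f := (fun y => - iter_lap D m [::] y).

Lemma D_nil x : punct_ball2 x -> D [::] x = u x.
Proof. exact: (proj1 HC). Qed.

(** Controls [u] in the transition zone of the cut-off, where the sign of the [m]-fold Laplacian of
    the test function is unknown. *)
Lemma bounded_unit_annulus : exists M, forall y : pt n, 1 / 4 <= norm y ^ 2 <= 1 -> u y <= M.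
Proof.
have [M HM] : exists M, forall y : pt n, 1 / 4 <= norm y ^ 2 <= 1 -> Rabs (D [::] y) <= M.
  apply: (locally_bounded_box n 1).
    move=> x hx i; apply: Rle_trans (coord_le_norm n x i) _.
    apply: Rsqr_incr_0_var; last lra; rewrite !Rsqr_pow2; lra.
  move=> x; have x0 := norm_ge0 n x.
  have [hx|[hx|hx]] : 0 < norm x < 2 \/ norm x <= 0 \/ 2 <= norm x by lra.
  - exists (Rabs (D [::] x) + 1).
    have cD : cont_at n (D [::]) x.
      apply: cont_at_of_continuous_on (pnear_punct_ball2 n x hx) _.
      exact: (proj1 (proj2 HC)).
    apply: filter_imp (proj1 (cont_atP _ _ _) cD 1 Rlt_0_1) => y hy _.
    have := Rabs_triang (D [::] y - D [::] x) (D [::] x).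
    have -> : D [::] y - D [::] x + D [::] x = D [::] y by ring.
    by lra.
  - exists 0; have := pnear_norm_lt n x (1 / 4) ltac:(lra); apply: filter_imp => y hy [h _].
    by exfalso; have := norm_ge0 n y; nra.
  - exists 0; have := pnear_norm_gt n x (3 / 2) ltac:(lra); apply: filter_imp => y hy [_ h].
    by exfalso; nra.
exists M => y hy; have py : punct_ball2 y.
  by have := norm_ge0 n y; rewrite /punct_ball2; split; nra.
by rewrite -D_nil //; apply: Rle_trans (Rle_abs _) (HM y hy).
Qed.

(** One test function yields both bounds: its size [t^(m-1)] weighs [f], and its [m]-fold Laplacian,
    at least [c / eps] on an annulus, weighs [u]. The condition [eps < 1/18] keeps that annulus
    below [t = 1/4]. *)
Lemma energy_bound : exists c C A, 0 < c /\ 0 < C /\ 1 <= A /\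
  forall eps, 0 < eps < 1 / 18 -> eventually (fun N =>
    rsum n N (fun y => f y * (norm y ^ 2) ^ (m - 1) * indic (A * eps) (1 / 4) (norm y ^ 2)) <= C /\
    rsum n N (fun y => u y * indic (3 / 2 * eps) (9 / 2 * eps) (norm y ^ 2)) <= C * eps).
Proof.
have [c [C [A [c0 [C0 [A1 H]]]]]] := radial_test_origin m m3.
have [M HM] := bounded_unit_annulus.
have p4 : 0 < 4 ^ n by apply: pow_lt; lra.
set M' := Rmax 0 M; have M0 : 0 <= M' by exact: Rmax_l.
have HM' (y : pt n) : 1 / 4 <= norm y ^ 2 <= 1 -> u y <= M'.
  by move=> hy; apply: Rle_trans (HM y hy) (Rmax_r _ _).
(* [1] bounds the discrepancy between the two Riemann sums, [C * M'] the integrand in the transition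
   zone, and [4 ^ n] is the volume of the box. *)
set B := 1 + C * (4 ^ n * M').
have B0 : 0 < B.
  have : 0 <= C * (4 ^ n * M') by apply: Rmult_le_pos; [lra | apply: Rmult_le_pos; lra].
  by rewrite /B; lra.
exists c, (B / c), A; split=> //; split; first exact: Rdiv_lt_0_compat.
split=> // eps he.
have [Psi [P1 [P2 [P3 [P4 [P5 [P6 P7]]]]]]] := H eps ltac:(lra).
pose Z t := t < eps \/ 1 < t.
have oZ : open Z by apply: open_or; [exact: open_lt | exact: open_gt].
have oU := open_gt 0.
have T0 (y : pt n) : sqdist n (fun _ => 0) y = norm y ^ 2 by exact: sqdist0.
have lim : is_lim_seq (fun N => rsum n N (fun y => iter_lap D m [::] y * Psi (norm y ^ 2))
    - rsum n N (fun y => D [::] y * iter m (radial_lap n) Psi (norm y ^ 2))) 0.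
  have := rsum_iter_laplacian n n u D HC (fun _ => 0) (fun t => 0 < t) Z oU oZ _ _ m [::] Psi.
  move=> /(_ _ _ _ _ P2).
  have E F : (fun y => F y * Psi (sqdist n (fun _ => 0) y)) = (fun y => F y * Psi (norm y ^ 2)).
    by apply: functional_extensionality => y; rewrite T0.
  have E' F G : (fun y : pt n => F y * G (sqdist n (fun _ => 0) y)) = (fun y => F y * G (norm y ^ 2)).
    by apply: functional_extensionality => y; rewrite T0.
  rewrite E E'; apply.
  - by move=> y [hy _]; rewrite T0; apply: pow_lt.
  - move=> y hy; rewrite T0 /Z; have y0 := norm_ge0 n y.
    have [h|h] : norm y <= 0 \/ 2 <= norm y.
      by have [|] := Rle_dec (norm y) 0; [left | right; apply: Rnot_lt_le => h; apply: hy; split; lra].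
    + by left; rewrite (_ : norm y = 0) /=; lra.
    + by right; nra.
  - by rewrite /= add0n -mn.
  - by rewrite -mn in P1 *.
have Zlap t : Z t -> iter m (radial_lap (2 * m)) Psi t = 0.
  exact: (iter_radial_lap_locally0 Z oZ _ _ _ P2).
have ev := proj2 (is_lim_seq_spec _ _) lim (mkposreal 1 Rlt_0_1).
apply: filter_imp (filter_and _ _ eventually_pos ev) => N [N0 /= /Rabs_lt_between hN].
set S1 := rsum n N (fun y => iter_lap D m [::] y * Psi (norm y ^ 2)) in hN.
set S2 := rsum n N (fun y => D [::] y * iter m (radial_lap n) Psi (norm y ^ 2)) in hN.
set F1 := (fun y : pt n => f y * (norm y ^ 2) ^ (m - 1) * indic (A * eps) (1 / 4) (norm y ^ 2)).
set F2 := (fun y : pt n => u y * indic (3 / 2 * eps) (9 / 2 * eps) (norm y ^ 2)).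
have F10 y : 0 <= F1 y.
  rewrite /F1; case: (indic_spec (A * eps) (1 / 4) (norm y ^ 2)) => -[h ->]; last by rewrite Rmult_0_r; lra.
  have y0 := norm_ge0 n y.
  have py : punct_ball2 y by rewrite /punct_ball2; split; nra.
  rewrite Rmult_1_r; apply: Rmult_le_pos; first exact: lap_le0.
  by apply: pow_le; apply: pow_le.
have F20 y : 0 <= F2 y.
  rewrite /F2; case: (indic_spec (3 / 2 * eps) (9 / 2 * eps) (norm y ^ 2)) => -[h ->]; last by rewrite Rmult_0_r; lra.
  have y0 := norm_ge0 n y.
  have py : punct_ball2 y by rewrite /punct_ball2; split; nra.
  by rewrite Rmult_1_r; apply: u_ge0.
have main : rsum n N (fun y => c * F1 y + c / eps * F2 y) <= B.
  apply: (Rle_trans _ (rsum n N (fun y => (-1) * (iter_lap D m [::] y * Psi (norm y ^ 2)) +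
     (D [::] y * iter m (radial_lap n) Psi (norm y ^ 2) + C * M')))); last first.
    by rewrite !rsum_add rsum_scal rsum_const // -/S1 -/S2 /B; lra.
  have RL : radial_lap n = radial_lap (2 * m) by rewrite {1}mn.
  apply: rsum_le => y; rewrite /F1 /F2 RL.
  have y0 := norm_ge0 n y; set t := norm y ^ 2.
  have CM : 0 <= C * M' by apply: Rmult_le_pos; lra.
  have t0 : 0 <= t by exact: pow_le.
  have Ae : eps <= A * eps by nra.
  have [hz|hz] : Z t \/ (eps <= t <= 1) by rewrite /Z; lra.
    rewrite P2 // Zlap // !indic0; last first.
    - by move: hz; rewrite /Z; lra.
    - by move: hz; rewrite /Z; lra.
    - by lra.
  have py : punct_ball2 y by rewrite /punct_ball2; split; rewrite /t in hz; nra.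
  have uy := u_ge0 y py; have fy := lap_le0 y py; rewrite D_nil //.
  set L := iter m (radial_lap (2 * m)) Psi t; set w := iter_lap D m [::] y in fy *.
  have f1 : c * (- w * t ^ (m - 1) * indic (A * eps) (1 / 4) t) <= -1 * (w * Psi t).
    case: (indic_spec (A * eps) (1 / 4) t) => -[h ->].
      by have := Rmult_le_compat_l _ _ _ fy (P4 t h); lra.
    by have := Rmult_le_pos _ _ fy (P3 t); lra.
  have f2 : c / eps * (u y * indic (3 / 2 * eps) (9 / 2 * eps) t) <= u y * L + C * M'.
    have [t4|t4] := Rlt_dec t (1 / 4).
      case: (indic_spec (3 / 2 * eps) (9 / 2 * eps) t) => -[h ->].
        by have := Rmult_le_compat_l _ _ _ uy (P6 t t4 h); rewrite -/L; lra.
      by have := Rmult_le_pos _ _ uy (P5 t ltac:(lra)); rewrite -/L; lra.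
    rewrite indic0; last lra.
    have /Rabs_le_between := P7 t ltac:(lra); rewrite -/L => hL.
    have uM := HM' y; rewrite -/t in uM; have {}uM := uM ltac:(lra).
    have : - (C * M') <= u y * L; last lra.
    have : u y * (- L) <= M' * C.
      by apply: (Rle_trans _ (u y * C)); [apply: Rmult_le_compat_l | apply: Rmult_le_compat_r]; lra.
    lra.
  lra.
have r1 := rsum_ge0 n N F1 F10; have r2 := rsum_ge0 n N F2 F20.
rewrite rsum_add !rsum_scal in main.
have ce : 0 < c / eps by apply: Rdiv_lt_0_compat; lra.
have m1 := Rmult_le_pos _ _ (Rlt_le _ _ c0) r1; have m2 := Rmult_le_pos _ _ (Rlt_le _ _ ce) r2.
split.
  apply: (Rmult_le_reg_l c) => //; have -> : c * (B / c) = B by field; lra.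
  lra.
apply: (Rmult_le_reg_l (c / eps)) => //; have -> : c / eps * (B / c * eps) = B by field; lra.
lra.
Qed.

Lemma solid_mean_bound : exists C, 0 < C /\ forall x : pt n, 0 < norm x < 1 / 4 ->
  eventually (fun N =>
    rsum n N (fun y => u y * indic 0 ((norm x / 4) ^ 2) (sqdist n x y)) <= C * norm x ^ 2).
Proof.
have [_ [C [A [_ [C0 [_ H]]]]]] := energy_bound.
exists (3 / 8 * C); split; first lra.
move=> x; set r := norm x => hr.
(* With [eps = 3/8 r^2] the annulus is [9/16 r^2 <= |y|^2 <= 27/16 r^2]; it contains the ball of
   radius [r/4] about [x], on which [3/4 r <= |y| <= 5/4 r]. *)
apply: filter_imp (H (3 / 8 * r ^ 2) _) => [N [_ hN]|]; last by split; nra.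
apply: (Rle_trans _ (C * (3 / 8 * r ^ 2))); last lra.
apply: Rle_trans hN; apply: rsum_le => y.
case: (indic_spec 0 ((r / 4) ^ 2) (sqdist n x y)) => -[h ->].
  have y0 := norm_ge0 n y; have d0 := norm_ge0 n (vsub y x).
  have hd : norm (vsub y x) <= r / 4.
    apply: Rsqr_incr_0_var; last lra; rewrite !Rsqr_pow2 -sqdist_norm; lra.
  have h1 := norm_le_add n y x; have h2 := norm_le_add n x y.
  rewrite (norm_vsub_sym n x y) -/r in h1 h2.
  by rewrite indic1; [lra | split; nra].
rewrite Rmult_0_r.
case: (indic_spec (3 / 2 * (3 / 8 * r ^ 2)) (9 / 2 * (3 / 8 * r ^ 2)) (norm y ^ 2)) => -[h' ->]; last lra.
have y0 := norm_ge0 n y.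
by rewrite Rmult_1_r; apply: u_ge0; split; nra.
Qed.

Notation weighted y := (- iter_lap D m [::] y * (norm y ^ 2) ^ (m - 1)).

Lemma weighted_ge0 y a b : 0 < a -> b <= 3 -> 0 <= weighted y * indic a b (norm y ^ 2).
Proof.
move=> a0 b3; have y0 := norm_ge0 n y.
case: (indic_spec a b (norm y ^ 2)) => -[h ->]; last lra.
rewrite Rmult_1_r; apply: Rmult_le_pos; first by apply: lap_le0; split; nra.
by apply: pow_le; apply: pow_le.
Qed.

(* The weighted mass of [f] near the origin is finite, so only finitely many
   disjoint annuli can carry mass above [eta]. Without a limit of the Riemann
   sums at hand, smallness is only obtained for frequently many meshes. *)
Lemma weighted_mass_small eta : 0 < eta -> exists r0, 0 < r0 /\
  forall x : pt n, 0 < norm x < r0 -> forall P : nat -> Prop, eventually P ->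
    exists N, P N /\
      rsum n N (fun y => weighted y * indic (norm x ^ 2 / 4) (9 / 4 * norm x ^ 2) (norm y ^ 2)) <= eta.
Proof.
move=> e0; apply: NNPP => hyp.
have H r0 : 0 < r0 -> exists x : pt n, 0 < norm x < r0 /\ eventually (fun N =>
    eta <= rsum n N (fun y => weighted y * indic (norm x ^ 2 / 4) (9 / 4 * norm x ^ 2) (norm y ^ 2))).
  move=> r0p; apply: NNPP => no; apply: hyp; exists r0; split=> // x hx P hP.
  apply: NNPP => noN; apply: no; exists x; split=> //.
  apply: filter_imp hP => N PN; left; apply: Rnot_le_lt => h; apply: noN; by exists N.
have mass K : exists s, 0 < s <= 1 / 4 /\ eventually (fun N =>
    INR K * eta <= rsum n N (fun y => weighted y * indic s (1 / 4) (norm y ^ 2))).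
  elim: K => [|K [s [hs IH]]].
    exists (1 / 4); split; first lra.
    exists 0%nat => N _; rewrite Rmult_0_l; apply: rsum_ge0 => y.
    by apply: weighted_ge0; lra.
  (* Choosing [|x| < s <= 1/4] gives [9/4 |x|^2 < s], so the new annulus lies strictly inside those
     already counted. *)
  have [x [hx hN]] := H s (proj1 hs).
  exists (norm x ^ 2 / 4); split; first by split; nra.
  apply: filter_imp (filter_and _ _ IH hN) => N [h1 h2].
  rewrite S_INR; apply: (Rle_trans _ (rsum n N (fun y =>
     weighted y * indic s (1 / 4) (norm y ^ 2) +
     weighted y * indic (norm x ^ 2 / 4) (9 / 4 * norm x ^ 2) (norm y ^ 2)))).
    by rewrite rsum_add; lra.
  have hxs : 9 / 4 * norm x ^ 2 < s by nra.
  apply: rsum_le => y; move: (norm y ^ 2) (weighted_ge0 y (norm x ^ 2 / 4) (1 / 4) ltac:(nra) ltac:(lra)) => t.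
  set q := - _; set w := q * _.
  case: (indic_spec s (1 / 4) t) => -[h ->] H0.
    rewrite (indic0 _ (9 / 4 * norm x ^ 2)); last lra.
    by rewrite indic1; lra.
  case: (indic_spec (norm x ^ 2 / 4) (9 / 4 * norm x ^ 2) t) => -[h' ->]; last lra.
  by rewrite indic1; lra.
have [c [C [A [c0 [C0 [A1 HE]]]]]] := energy_bound.
have [K HK] : exists K, C < INR K * eta.
  have [K [_ HK]] := nfloor_ex (C / eta) (Rlt_le _ _ (Rdiv_lt_0_compat _ _ C0 e0)).
  exists (S K); rewrite S_INR; have -> : C = C / eta * eta by field; lra.
  exact: Rmult_lt_compat_r.
have [s [hs hN]] := mass K.
set eps := Rmin (s / A) (1 / 36).
have sA : 0 < s / A by apply: Rdiv_lt_0_compat; lra.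
have he : 0 < eps < 1 / 18.
  split; first by apply: Rmin_glb_lt; lra.
  by apply: Rle_lt_trans (Rmin_r _ _) _; lra.
have hA : A * eps <= s.
  have -> : s = A * (s / A) by field; lra.
  by apply: Rmult_le_compat_l; [lra | exact: Rmin_l].
have [N [[h1 _] h2]] : exists N, (fun N =>
    rsum n N (fun y => weighted y * indic (A * eps) (1 / 4) (norm y ^ 2)) <= C /\
    rsum n N (fun y => u y * indic (3 / 2 * eps) (9 / 2 * eps) (norm y ^ 2)) <= C * eps) N /\
    INR K * eta <= rsum n N (fun y => weighted y * indic s (1 / 4) (norm y ^ 2)).
  by have [N0 HN0] := filter_and _ _ (HE eps he) hN; exists N0; apply: HN0.
have : rsum n N (fun y => weighted y * indic s (1 / 4) (norm y ^ 2)) <=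
   rsum n N (fun y => weighted y * indic (A * eps) (1 / 4) (norm y ^ 2)); last lra.
have Ae : 0 < A * eps by apply: Rmult_lt_0_compat; lra.
apply: rsum_le => y; move: (norm y ^ 2) (weighted_ge0 y (A * eps) (1 / 4) Ae ltac:(lra)) => t.
set q := - _; set w := q * _.
case: (indic_spec s (1 / 4) t) => -[h ->] H0; last by lra.
by rewrite indic1; lra.
Qed.

(** The kernel is concentrated at a scale [delta] far below [sigma], and all constants are free of
    [delta]. Between [sigma] and [rho] the logarithm is at most [ln (2 rho^2 / sigma^2)] and is paid
    by the mass of [f]; inside [sigma] its excess is integrable and is paid by [exp A]. *)
Lemma local_bound : odd m -> exists c C, 0 < c /\ 0 < C /\
  forall (z : pt n) rho sigma A, 0 < sigma <= rho -> rho < norm z -> norm z + rho < 2 ->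
    0 < u z -> (forall y, sqdist n z y <= sigma ^ 2 -> f y <= exp A) ->
    eventually (fun N =>
      c * u z <= rsum n N (fun y => f y * indic 0 (rho ^ 2) (sqdist n z y)) * ln (2 * rho ^ 2 / sigma ^ 2)
        + C * (exp A * sigma ^ n)
        + C / rho ^ n * rsum n N (fun y => u y * indic 0 (rho ^ 2) (sqdist n z y)) + 1).
Proof.
move=> om; have [c [C [c0 [C0 H]]]] := radial_test_log_scaled m om.
have n0 : (0 < n)%nat by rewrite mn; lia.
have nn : 0 < INR n by apply: lt_0_INR; apply/ltP.
have nn1 : 0 < INR n ^ n by apply: pow_lt.
have l4 : 0 < ln 4 by rewrite -ln_1; apply: ln_increasing; lra.
have l3 : 0 < 3 ^ n by apply: pow_lt; lra.
exists (c / (2 * INR n ^ n)), (Rmax C (2 * ln 4 * 3 ^ n)).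
split; first by apply: Rdiv_lt_0_compat; lra.
split; first by apply: Rlt_le_trans C0 (Rmax_l _ _).
move=> z rho sigma A hs hz1 hz2 uz fA.
have pz : punct_ball2 z by split; lra.
have near y : sqdist n z y <= rho ^ 2 -> punct_ball2 y.
  move=> h; have hd : norm (vsub y z) <= rho.
    apply: Rsqr_incr_0_var; last lra; rewrite !Rsqr_pow2 -sqdist_norm; lra.
  have h1 := norm_le_add n y z; have h2 := norm_le_add n z y.
  by rewrite (norm_vsub_sym n z y) in h2; split; lra.
(* By continuity [u >= u z / 2] on a tiny ball. Its radius drops out later: [c / delta^n] times the
   volume [(delta / n)^n] of an inscribed cube is constant. *)
have [delta [hdelta udelta]] : exists delta, 0 < delta < rho / 2 /\
    forall y, sqdist n z y <= delta ^ 2 -> u z / 2 <= D [::] y.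
  have cD : cont_at n (D [::]) z.
    apply: cont_at_of_continuous_on (pnear_punct_ball2 n z pz) _.
    exact: (proj1 (proj2 HC)).
  have [d [d0 Hd]] := proj1 (cont_atP _ _ _) cD (u z / 2) ltac:(lra).
  exists (Rmin (d / 2) (rho / 4)).
  have m1 := Rmin_l (d / 2) (rho / 4); have m2 := Rmin_r (d / 2) (rho / 4).
  have m0 : 0 < Rmin (d / 2) (rho / 4) by apply: Rmin_glb_lt; lra.
  split; first lra.
  move=> y hy; have hd : norm (vsub y z) <= Rmin (d / 2) (rho / 4).
    apply: Rsqr_incr_0_var; last lra; rewrite !Rsqr_pow2 -sqdist_norm; lra.
  have /Rabs_lt_between := Hd y ltac:(lra).
  by rewrite (D_nil z pz); lra.
have [Psi [P1 [P2 [P3 [P4 [P5 P6]]]]]] := H rho delta hdelta.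
have d2 : 0 < delta ^ 2 by apply: pow_lt; lra.
have s2 : 0 < sigma ^ 2 by apply: pow_lt; lra.
have r2 : sigma ^ 2 <= rho ^ 2 by apply: pow_incr; lra.
have dr : delta ^ 2 < rho ^ 2 / 4.
  have -> : rho ^ 2 / 4 = (rho / 2) ^ 2 by field.
  by nra.
have oU := open_gt (- delta ^ 2); have oZ := open_gt (rho ^ 2).
have lim : is_lim_seq (fun N => rsum n N (fun y => iter_lap D m [::] y * Psi (sqdist n z y))
    - rsum n N (fun y => D [::] y * iter m (radial_lap n) Psi (sqdist n z y))) 0.
  apply: (rsum_iter_laplacian n n u D HC z (fun t => - delta ^ 2 < t) (fun t => rho ^ 2 < t)) => //.
  - by move=> y _; have := sqdist_ge0 n z y; lra.
  - by move=> y hy; apply: Rnot_le_lt => h; apply: hy; apply: near.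
  - by rewrite /= add0n -mn.
have Zlap t : rho ^ 2 < t -> iter m (radial_lap (2 * m)) Psi t = 0.
  exact: (iter_radial_lap_locally0 _ oZ _ _ _ P2).
have ev := proj2 (is_lim_seq_spec _ _) lim (mkposreal 1 Rlt_0_1).
have evl := eventually_rsum_log_plus n z sigma delta n0 (proj1 hs) (proj1 hdelta).
have dn0 : 0 < delta / INR n by apply: Rdiv_lt_0_compat; lra.
have dn1 : delta / INR n <= delta.
  have n1 : 1 <= INR n by rewrite (_ : 1 = INR 1) //; apply: le_INR; apply/leP.
  apply: (Rmult_le_reg_r (INR n)) => //; rewrite /Rdiv Rmult_assoc Rinv_l; nra.
have evb := eventually_rsum_box_ge n z (delta / INR n) dn0 _.
have {}evb := evb (fun i => ltac:(have := coord_le_norm n z i; lra)).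
apply: filter_imp (filter_and _ _ eventually_pos (filter_and _ _ evb (filter_and _ _ evl ev)))
  => N [N0 [hb [hl /= /Rabs_lt_between hN]]].
set S1 := rsum n N (fun y => iter_lap D m [::] y * Psi (sqdist n z y)) in hN.
set S2 := rsum n N (fun y => D [::] y * iter m (radial_lap n) Psi (sqdist n z y)) in hN.
set Sf := rsum n N (fun y => f y * indic 0 (rho ^ 2) (sqdist n z y)).
set Su := rsum n N (fun y => u y * indic 0 (rho ^ 2) (sqdist n z y)).
have RL : radial_lap n = radial_lap (2 * m) by rewrite {1}mn.
have Rn x : x ^ n = x ^ (2 * m) by rewrite {1}mn.
have dn : 0 < delta ^ n by apply: pow_lt; lra.
have rn : 0 < rho ^ n by apply: pow_lt; lra.
have Su0 : 0 <= Su.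
  apply: rsum_ge0 => y; case: (indic_spec 0 (rho ^ 2) (sqdist n z y)) => -[h ->]; last lra.
  by rewrite Rmult_1_r; apply: u_ge0; apply: near; lra.
have lower : c / (2 * INR n ^ n) * u z <= - S2 + C / rho ^ n * Su.
  apply: (Rle_trans _ (rsum n N (fun y => (u z / 2 * (c / delta ^ n)) * box_indic n z (delta / INR n) y))).
    rewrite rsum_scal.
    have -> : c / (2 * INR n ^ n) * u z = u z / 2 * (c / delta ^ n) * (delta / INR n) ^ n.
      by rewrite /Rdiv Rpow_mult_distr pow_inv; field; lra.
    apply: Rmult_le_compat_l => //; apply: Rmult_le_pos; first lra.
    by left; apply: Rdiv_lt_0_compat.
  have -> : - S2 + C / rho ^ n * Su = rsum n N (fun y =>
     (-1) * (D [::] y * iter m (radial_lap n) Psi (sqdist n z y)) +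
     C / rho ^ n * (u y * indic 0 (rho ^ 2) (sqdist n z y))).
    by rewrite rsum_add !rsum_scal -/S2 -/Su; ring.
  apply: rsum_le => y; rewrite RL.
  have ucd : 0 <= u z / 2 * (c / delta ^ n).
    by apply: Rmult_le_pos; [lra | left; apply: Rdiv_lt_0_compat].
  apply: Rle_trans (Rmult_le_compat_l _ _ _ ucd (box_le_ball n z delta y n0 _)) _; first lra.
  have t0 := sqdist_ge0 n z y.
  have ud := udelta y; have ny := near y.
  move: (sqdist n z y) t0 ud ny => t t0 ud ny.
  have [tr|tr] := Rlt_dec (rho ^ 2) t.
    by rewrite Zlap // !indic0; lra.
  have py := ny ltac:(lra); have uy := u_ge0 y py; rewrite (D_nil y py) in ud *.
  rewrite (indic1 0 (rho ^ 2)); last lra.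
  have Cr : 0 < C / rho ^ n by apply: Rdiv_lt_0_compat.
  have Cu : 0 <= C / rho ^ n * u y by apply: Rmult_le_pos; lra.
  have [t4|t4] := Rlt_dec t (rho ^ 2 / 4).
    case: (indic_spec 0 (delta ^ 2) t) => -[h ->].
      have p5 := P5 t h; rewrite -Rn in p5.
      have {}ud := ud ltac:(lra).
      have cd : 0 < c / delta ^ n by apply: Rdiv_lt_0_compat.
      have : u z / 2 * (c / delta ^ n) <= u y * (- iter m (radial_lap (2 * m)) Psi t).
        by apply: Rmult_le_compat; lra.
      lra.
    have p4 := P4 t ltac:(lra).
    have : 0 <= u y * (- iter m (radial_lap (2 * m)) Psi t) by apply: Rmult_le_pos; lra.
    lra.
  rewrite (indic0 0 (delta ^ 2)); last lra.
  have /Rabs_le_between := P6 t ltac:(lra); rewrite -Rn => hL.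
  have := Rmult_le_compat_l _ _ _ uy (proj2 hL); lra.
have upper : - S1 <= Sf * ln (2 * rho ^ 2 / sigma ^ 2) + exp A * (2 * ln 4 * (3 * sigma) ^ n).
  have -> : - S1 = rsum n N (fun y => (-1) * (iter_lap D m [::] y * Psi (sqdist n z y))).
    by rewrite rsum_scal -/S1; ring.
  apply: (Rle_trans _ (rsum n N (fun y =>
      ln (2 * rho ^ 2 / sigma ^ 2) * (f y * indic 0 (rho ^ 2) (sqdist n z y)) +
      exp A * log_plus sigma delta (sqdist n z y)))); last first.
    rewrite rsum_add !rsum_scal -/Sf.
    by have := Rmult_le_compat_l _ _ _ (Rlt_le _ _ (exp_pos A)) hl; lra.
  apply: rsum_le => y.
  have t0 := sqdist_ge0 n z y; have fy' := fA y; have ny := near y.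
  move: (sqdist n z y) t0 fy' ny => t t0 fy' ny.
  have lp0 : 0 <= log_plus sigma delta t by exact: Rmax_l.
  have el0 : 0 <= exp A * log_plus sigma delta t.
    by apply: Rmult_le_pos => //; left; exact: exp_pos.
  have [tr|tr] := Rlt_dec (rho ^ 2) t.
    by rewrite P2 // indic0; lra.
  have py := ny ltac:(lra); have fy := lap_le0 y py.
  rewrite indic1; last lra.
  have [p30 p31] := P3 t ltac:(lra).
  move: (iter_lap D m [::] y) fy fy' => w fy fy'.
  have fP : - w * Psi t <= - w * ln (2 * rho ^ 2 / (t + delta ^ 2)) by apply: Rmult_le_compat_l.
  have [ts|ts] := Rlt_dec (sigma ^ 2) t.
    have : ln (2 * rho ^ 2 / (t + delta ^ 2)) <= ln (2 * rho ^ 2 / sigma ^ 2).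
      apply: ln_le; first by apply: Rdiv_lt_0_compat; lra.
      by apply: Rmult_le_compat_l; [lra | apply: Rinv_le_contravar; lra].
    by move=> h; have := Rmult_le_compat_l _ _ _ fy h; lra.
  have fe := fy' ltac:(lra).
  (* Splitting the logarithm at [sigma] isolates the excess, to which [f <= exp A] applies. *)
  have e : ln (2 * rho ^ 2 / (t + delta ^ 2)) =
     ln (2 * rho ^ 2 / sigma ^ 2) + ln (sigma ^ 2 / (t + delta ^ 2)).
    rewrite -ln_mult; try (apply: Rdiv_lt_0_compat; lra).
    by congr ln; field; lra.
  rewrite e in fP.
  have h1 : - w * ln (sigma ^ 2 / (t + delta ^ 2)) <= - w * log_plus sigma delta t.
    by apply: Rmult_le_compat_l => //; exact: Rmax_r.
  have h2 : - w * log_plus sigma delta t <= exp A * log_plus sigma delta t.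
    exact: Rmult_le_compat_r.
  lra.
have k1 : C / rho ^ n * Su <= Rmax C (2 * ln 4 * 3 ^ n) / rho ^ n * Su.
  apply: Rmult_le_compat_r => //; apply: Rmult_le_compat_r; last exact: Rmax_l.
  by left; apply: Rinv_0_lt_compat.
have k2 : exp A * (2 * ln 4 * (3 * sigma) ^ n) <= Rmax C (2 * ln 4 * 3 ^ n) * (exp A * sigma ^ n).
  have -> : exp A * (2 * ln 4 * (3 * sigma) ^ n) = (2 * ln 4 * 3 ^ n) * (exp A * sigma ^ n).
    by rewrite Rpow_mult_distr; ring.
  apply: Rmult_le_compat_r; last exact: Rmax_r.
  by apply: Rmult_le_pos; [left; exact: exp_pos | apply: pow_le; lra].
move: lower upper k1 k2.
set a := exp A * (_ * (3 * sigma) ^ n); set b := Rmax _ _ * (exp A * _); set d := Rmax _ _ / _ * _.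
move: a b d (C / rho ^ n * Su) (Sf * _) (c / _ * _) => a b d e f0 g lower upper k1 k2.
lra.
Qed.

End Energy.

(** * Doubling and absorption *)

(* Replaces the maximum point of [u] by one where [u] is comparable to its
   supremum on a smaller ball, at the cost of a controlled loss of radius. *)
Lemma doubling_point n (u : pt n -> R) (x : pt n) (r : R) :
  0 < r -> 0 < u x -> (forall y, norm (vsub y x) <= r -> 0 <= u y) ->
  (exists M, forall y, norm (vsub y x) <= r -> u y <= M) ->
  exists z d, 0 < d /\ norm (vsub z x) + 2 * d = r /\ u x * r <= 4 * d * u z /\
    forall y, norm (vsub y z) <= d -> u y <= 4 * u z.
Proof.
move=> r0 ux u0 [M HM].
(* The weight vanishes on the boundary sphere. Within [d] of a near-maximiser [z] of [w], the
   distance to the sphere is at least half that of [z]; with the factor [2] lost in near-maximality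
   this gives [4]. *)
pose w y := u y * (r - norm (vsub y x)).
pose E v := exists y, norm (vsub y x) < r /\ v = w y.
have wx : w x = u x * r by rewrite /w norm_vsub_self Rminus_0_r.
have bE : bound E.
  exists (M * r) => v [y [hy ->]]; have y0 := norm_ge0 n (vsub y x).
  have uy := u0 y (Rlt_le _ _ hy); have uM := HM y (Rlt_le _ _ hy).
  by apply: Rmult_le_compat; lra.
have nE : exists v, E v by exists (w x), x; rewrite norm_vsub_self.
have [s [us ls]] := completeness E bE nE.
have sx : u x * r <= s by rewrite -wx; apply: us; exists x; rewrite norm_vsub_self.
have s0 : 0 < u x * r by apply: Rmult_lt_0_compat.
have [z [hz wz]] : exists z, norm (vsub z x) < r /\ s / 2 < w z.
  apply: NNPP => no; have : s <= s / 2; last lra.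
  apply: ls => v [y [hy ->]]; apply: Rnot_lt_le => h; apply: no; by exists y.
have hd : 0 < (r - norm (vsub z x)) / 2 by lra.
exists z, ((r - norm (vsub z x)) / 2); split=> //; split; first lra.
rewrite /w in wz; split; first lra.
move=> y hy; have tri := norm_vsub_triang n y z x.
have hyr : norm (vsub y x) < r by lra.
have wy : w y <= s by apply: us; exists y.
rewrite /w in wy; have uy := u0 y (Rlt_le _ _ hyr).
apply: (Rmult_le_reg_r _ _ _ hd).
have : u y * ((r - norm (vsub z x)) / 2) <= u y * (r - norm (vsub y x)).
  by apply: Rmult_le_compat_l; lra.
lra.
Qed.

Lemma exp_pow_INR x k : exp x ^ k = exp (INR k * x).
Proof.
elim: k => [|k IH]; first by rewrite /= Rmult_0_l exp_0.
by rewrite -tech_pow_Rmult IH S_INR -exp_plus; congr exp; ring.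
Qed.

Lemma exp_le_exp x y : x <= y -> exp x <= exp y.
Proof. by move=> [xy|->]; [left; exact: exp_increasing | right]. Qed.

Lemma Rpower_le_neg x y a : 0 < x -> x <= y -> a <= 0 -> Rpower y a <= Rpower x a.
Proof.
move=> x0 xy a0; rewrite -(Ropp_involutive a) !(Rpower_Ropp _ (- a)).
apply: Rinv_le_contravar; first by rewrite /Rpower; exact: exp_pos.
by apply: Rle_Rpower_l; lra.
Qed.

Lemma rpow_le x y a : 0 <= a -> 0 < y -> x <= y -> rpow x a <= Rpower y a.
Proof.
move=> a0 y0 xy; rewrite /rpow; case: Rle_dec => x0 /=.
  by left; rewrite /Rpower; exact: exp_pos.
by apply: Rle_Rpower_l; lra.
Qed.

(* The absorption step: with [Y = r^(-a)] and [E = Y^(1-lam)], every term on the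
   right of the local bound is a small multiple of [U]. *)
Lemma absorption (c K2 k lam a eps0 : R) :
  0 < c -> 0 < K2 -> 0 < k -> 0 < lam < 1 -> 0 < a -> 0 < eps0 ->
  exists eta r0, 0 < eta /\ 0 < r0 /\
  forall r U q, 0 < r < 1 -> r < r0 ->
    let Y := Rpower r (- a) in
    let E := Rpower r (- (a * (1 - lam))) in
    eps0 * Y <= 2 * U -> 0 <= q -> eps0 * Y * q <= 4 * U ->
    c * U <= eta * (k * E) * (1 + 2 * q + (Rpower (4 * U) lam + Rpower (Rpower 2 a * Y) lam)) + K2 * E ->
    False.
Proof.
move=> c0 K20 k0 hl a0 e0.
have posR x y : 0 < Rpower x y by rewrite /Rpower; exact: exp_pos.
set k1 := 4 * Rpower (eps0 / 2) (lam - 1).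
set k2 := Rpower (Rpower 2 a) lam * (2 / eps0).
have k10 : 0 < k1 by apply: Rmult_lt_0_compat; [lra | exact: posR].
have ie : 0 < / eps0 by apply: Rinv_0_lt_compat.
have k20 : 0 < k2 by apply: Rmult_lt_0_compat; [exact: posR | rewrite /Rdiv; lra].
set K3 := k * (2 / eps0 + 8 / eps0 + k1 + k2).
have K30 : 0 < K3 by apply: Rmult_lt_0_compat => //; rewrite /Rdiv; lra.
have al : 0 < a * lam by apply: Rmult_lt_0_compat; lra.
(* Since [E = Y r^(a lam)], a radius with [r^(a lam) <= b] makes [K2 * E] at most [c / 4 * U]. *)
set b := c * eps0 / (8 * K2).
have b0 : 0 < b by apply: Rdiv_lt_0_compat; [apply: Rmult_lt_0_compat | lra].
(* This [eta] brings the other term below [c / 4 * U] as well, and the two quarters cannot reach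
   [c * U]. *)
exists (c / (4 * K3)), (Rpower b (/ (a * lam))).
split; first by apply: Rdiv_lt_0_compat; lra.
split; first exact: posR.
move=> r U q hr hr0 Y E h1 q0 h2 main.
have Y0 : 0 < Y by exact: posR.
have E0 : 0 < E by exact: posR.
have U0 : 0 < U by have : 0 < eps0 * Y by [apply: Rmult_lt_0_compat]; lra.
have rb : Rpower r (a * lam) <= b.
  have -> : b = Rpower (Rpower b (/ (a * lam))) (a * lam).
    by rewrite Rpower_mult Rinv_l ?Rpower_1 //; lra.
  by apply: Rle_Rpower_l; lra.
have r1 : Rpower r (a * lam) <= 1.
  rewrite -(Rpower_O 1); last lra.
  have -> : Rpower 1 0 = Rpower 1 (a * lam) by rewrite /Rpower ln_1 !Rmult_0_r.
  by apply: Rle_Rpower_l; lra.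
have EY : E = Y * Rpower r (a * lam) by rewrite /E /Y -Rpower_plus; congr Rpower; ring.
have EleY : E <= Y by rewrite EY -[X in _ <= X]Rmult_1_r; apply: Rmult_le_compat_l; lra.
have YU : Y <= 2 / eps0 * U.
  by apply: (Rmult_le_reg_l eps0) => //; have -> : eps0 * (2 / eps0 * U) = 2 * U by field; lra.
have t1 : E * 1 <= 2 / eps0 * U by lra.
have t2 : E * (2 * q) <= 8 / eps0 * U.
  apply: (Rmult_le_reg_l eps0) => //; have -> : eps0 * (8 / eps0 * U) = 8 * U by field; lra.
  have : E * q <= Y * q by apply: Rmult_le_compat_r.
  by nra.
(* Here [lam < 1] enters: [(4 U)^(lam - 1)] decreases in [U], so it is at most its value at
   [eps0 / 2 * Y], where the power of [Y] cancels [E] exactly. *)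
have t3 : E * Rpower (4 * U) lam <= k1 * U.
  have -> : Rpower (4 * U) lam = 4 * U * Rpower (4 * U) (lam - 1).
    rewrite -{2}(Rpower_1 (4 * U)); last lra.
    by rewrite -Rpower_plus; congr Rpower; ring.
  have q1 : Rpower (4 * U) (lam - 1) <= Rpower (eps0 / 2 * Y) (lam - 1).
    by apply: Rpower_le_neg; [apply: Rmult_lt_0_compat; lra | lra | lra].
  have q2 : E * Rpower (eps0 / 2 * Y) (lam - 1) = Rpower (eps0 / 2) (lam - 1).
    rewrite -Rpower_mult_distr //; last lra.
    rewrite /E /Y Rpower_mult.
    have -> : - a * (lam - 1) = a * (1 - lam) by ring.
    rewrite Rpower_Ropp; field; apply: Rgt_not_eq; exact: posR.
  have q3 : E * Rpower (4 * U) (lam - 1) <= Rpower (eps0 / 2) (lam - 1).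
    by rewrite -q2; apply: Rmult_le_compat_l; lra.
  have := Rmult_le_compat_l (4 * U) _ _ ltac:(lra) q3; rewrite /k1; lra.
have t4 : E * Rpower (Rpower 2 a * Y) lam <= k2 * U.
  rewrite -Rpower_mult_distr //.
  have -> : E * (Rpower (Rpower 2 a) lam * Rpower Y lam) = Rpower (Rpower 2 a) lam * (E * Rpower Y lam) by ring.
  have -> : E * Rpower Y lam = Y.
    by rewrite /E /Y Rpower_mult -Rpower_plus; congr Rpower; ring.
  by rewrite /k2 Rmult_assoc; apply: Rmult_le_compat_l => //; left; exact: posR.
have t5 : K2 * E <= c / 4 * U.
  rewrite EY; have : K2 * (Y * Rpower r (a * lam)) <= K2 * (2 / eps0 * U * b).
    apply: Rmult_le_compat_l; first lra.
    by apply: Rmult_le_compat => //; [lra | left; exact: posR].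
  have -> : K2 * (2 / eps0 * U * b) = c / 4 * U by rewrite /b; field; lra.
  lra.
set X := 1 + 2 * q + _ in main.
have EX : E * X <= (2 / eps0 + 8 / eps0 + k1 + k2) * U by rewrite /X; lra.
have t6 : c / (4 * K3) * (k * E) * X <= c / 4 * U.
  have -> : c / (4 * K3) * (k * E) * X = c / (4 * K3) * (k * (E * X)) by ring.
  have -> : c / 4 * U = c / (4 * K3) * (K3 * U) by field; lra.
  apply: Rmult_le_compat_l; first by left; apply: Rdiv_lt_0_compat; lra.
  rewrite /K3 Rmult_assoc; apply: Rmult_le_compat_l; lra.
have : 0 < c * U by apply: Rmult_lt_0_compat.
lra.
Qed.

Lemma bounded_on_ball n K (u : pt n -> R) D (x : pt n) r :
  Ck_with K (@punct_ball2 n) u D -> r < norm x -> norm x + r < 2 ->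
  exists M, forall y, norm (vsub y x) <= r -> u y <= M.
Proof.
move=> HC rx xr2.
have near y : norm (vsub y x) <= r -> punct_ball2 y.
  move=> h; have h1 := norm_le_add n y x; have h2 := norm_le_add n x y.
  by rewrite (norm_vsub_sym n x y) in h2; split; lra.
have [M HM] : exists M, forall y, norm (vsub y x) <= r -> Rabs (D [::] y) <= M.
  apply: (locally_bounded_box n 2).
    by move=> y hy i; have := coord_le_norm n y i; have := near y hy => -[]; lra.
  move=> y; have [hy|hy] := Rle_dec (norm (vsub y x)) r.
    exists (Rabs (D [::] y) + 1).
    have cD : cont_at n (D [::]) y.
      apply: cont_at_of_continuous_on (pnear_punct_ball2 n y (near y hy)) _.
      exact: (proj1 (proj2 HC)).
    apply: filter_imp (proj1 (cont_atP _ _ _) cD 1 Rlt_0_1) => v hv _.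
    have := Rabs_triang (D [::] v - D [::] y) (D [::] y).
    have -> : D [::] v - D [::] y + D [::] y = D [::] v by ring.
    by lra.
  exists 0, (norm (vsub y x) - r); split; first lra.
  move=> v hv h; exfalso; have := norm_vsub_triang n y v x.
  by rewrite (norm_vsub_sym n y v); lra.
exists M => y hy; rewrite -(proj1 HC _ (near y hy)).
exact: Rle_trans (Rle_abs _) (HM y hy).
Qed.

Theorem theorem3p3 (m n : nat) (lam : R) (g u : pt n -> R)
    (D : seq 'I_n -> pt n -> R) :
  leq 2 m -> leq 2 n -> odd m -> Nat.mul 2 m = n ->
  0 < lam < 1 ->
  continuous_on (@punct_ball2 n) g ->
  (forall x, punct_ball2 x -> 0 <= g x) ->
  little_o_at0 g ((INR n - 2) / (1 - lam)) ->
  Ck_with (Nat.mul 2 m) (@punct_ball2 n) u D ->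
  (forall x, punct_ball2 x -> 0 <= u x) ->
  (forall x, punct_ball2 x ->
     0 <= - iter_lap D m [::] x <= exp (rpow (u x) lam + rpow (g x) lam)) ->
  little_o_at0 u ((INR n - 2) / (1 - lam)).
Proof.
move=> m2 n2 om mn hl _ g0 go HC u0 eqn eps0 e0.
(* Oddness excludes [m = 2]. *)
have m3 : (3 <= m)%coq_nat by lia.
have {}mn : n = (2 * m)%nat by lia.
rewrite (_ : Nat.mul 2 m = n) in HC; last by rewrite mn; lia.
have lap0 x : punct_ball2 x -> 0 <= - iter_lap D m [::] x by move=> px; case: (eqn x px).
set a := (INR n - 2) / (1 - lam).
have n6 : 6 <= INR n by rewrite (_ : 6 = INR 6); [apply: le_INR; lia | rewrite /=; ring].
have a0 : 0 < a by apply: Rdiv_lt_0_compat; lra.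
have al : a * (1 - lam) = INR n - 2 by rewrite /a; field; lra.
have [C1 [C10 mean]] := solid_mean_bound m n u D m3 mn HC u0 lap0.
have [c [C [c0 [C0 loc]]]] := local_bound m n u D m3 mn HC u0 lap0 om.
have p8 : 0 < 8 ^ n by apply: pow_lt; lra.
have p4 : 0 < 4 ^ (m - 1) by apply: pow_lt; lra.
(* The three summands stand for [exp A * sigma ^ n], the mean of [u] and the Riemann sum error [1];
   each term is at most its constant times [E]. *)
have K0 : 0 < C + C * C1 * 8 ^ n + 1.
  have : 0 < C * C1 * 8 ^ n by apply: Rmult_lt_0_compat => //; apply: Rmult_lt_0_compat.
  lra.
have [eta [r1 [eta0 [r10 absorb]]]] := absorption c (C + C * C1 * 8 ^ n + 1) (4 ^ (m - 1)) lam a eps0 c0 K0 p4 hl a0 e0.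
have [r2 [r20 small]] := weighted_mass_small m n u D m3 mn HC u0 lap0 eta eta0.
have [r3 [r30 gsmall]] := go 1 Rlt_0_1.
(* [r3] is halved because the bound on [g] is used up to [|y| = 5/4 |x|]; [1/4] is the range of the
   mean bound. *)
exists (Rmin (Rmin r1 r2) (Rmin (r3 / 2) (1 / 4))); split.
  by repeat apply: Rmin_glb_lt; lra.
move=> x [x0 xr] x2.
have h12 := Rmin_l (Rmin r1 r2) (Rmin (r3 / 2) (1 / 4)).
have h34 := Rmin_r (Rmin r1 r2) (Rmin (r3 / 2) (1 / 4)).
have h1 := Rmin_l r1 r2; have h2 := Rmin_r r1 r2.
have h3 := Rmin_l (r3 / 2) (1 / 4); have h4 := Rmin_r (r3 / 2) (1 / 4).
have px : punct_ball2 x by split.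
rewrite Rabs_right; last by apply: Rle_ge; exact: u0.
apply: Rnot_lt_le => big.
set r := norm x in x0 xr x2 big *.
have r1' : r < r1 by lra. have r2' : r < r2 by lra.
have r3' : r < r3 / 2 by lra. have r4' : r < 1 / 4 by lra.
clear h12 h34 h1 h2 h3 h4 xr.
set Y := Rpower r (- a) in big *.
have Y0 : 0 < Y by rewrite /Y /Rpower; exact: exp_pos.
have ux : 0 < u x by apply: Rlt_trans big; apply: Rmult_lt_0_compat.
have ball y : norm (vsub y x) <= r / 4 -> 3 / 4 * r <= norm y <= 5 / 4 * r.
  move=> h; have t1 := norm_le_add n y x; have t2 := norm_le_add n x y.
  by rewrite (norm_vsub_sym n x y) -/r in t1 t2; split; lra.
(* Radius [r / 8] for the doubling keeps the ball of radius [r / 8] about [z] inside the ball of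
   radius [r / 4] about [x], where mass and mean are known. *)
have [z [d [d0 [hd [ud udoub]]]]] :
  exists z d, 0 < d /\ norm (vsub z x) + 2 * d = r / 8 /\ u x * (r / 8) <= 4 * d * u z /\
    forall y, norm (vsub y z) <= d -> u y <= 4 * u z.
  apply: doubling_point => //; first lra.
    by move=> y hy; apply: u0; have := ball y ltac:(lra); split; lra.
  by apply: (bounded_on_ball n n u D) => //; rewrite -/r; lra.
have zx0 := norm_ge0 n (vsub z x).
have d16 : d <= r / 16 by lra.
have uz : 0 < u z.
  have : 0 < 4 * d * u z; last by nra.
  by apply: Rlt_le_trans ud; apply: Rmult_lt_0_compat; lra.
have hz : 7 / 8 * r <= norm z <= 9 / 8 * r.
  have t1 := norm_le_add n z x; have t2 := norm_le_add n x z.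
  by rewrite (norm_vsub_sym n x z) -/r in t1 t2; split; lra.
have zball y : norm (vsub y z) <= r / 8 -> norm (vsub y x) <= r / 4.
  by move=> h; have := norm_vsub_triang n y z x; lra.
(* The first term comes from [u <= 4 u z] near [z], the second from
   [g <= |y|^(-a) <= (r / 2)^(-a)]. *)
set A := Rpower (4 * u z) lam + Rpower (Rpower 2 a * Y) lam.
have A0 : 0 < A by rewrite /A /Rpower; apply: Rplus_lt_0_compat; exact: exp_pos.
have fA y : norm (vsub y z) <= d -> - iter_lap D m [::] y <= exp A.
  move=> hy; have := ball y (zball y ltac:(lra)) => hb.
  have py : punct_ball2 y by split; lra.
  apply: Rle_trans (proj2 (eqn y py)) _; apply: exp_le_exp; apply: Rplus_le_compat.
    by apply: rpow_le; [lra | lra | exact: udoub].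
  apply: rpow_le; first lra.
    by apply: Rmult_lt_0_compat => //; rewrite /Rpower; exact: exp_pos.
  apply: Rle_trans (Rle_abs _) _; apply: Rle_trans (gsmall y _ _) _; try lra.
  rewrite Rmult_1_l -/a.
  apply: Rle_trans (Rpower_le_neg (/ 2 * r) _ (- a) _ _ _) _; try lra.
  rewrite -Rpower_mult_distr; try lra.
  right; congr (_ * _); rewrite Rpower_Ropp.
  by rewrite /Rpower ln_Rinv; [rewrite Ropp_mult_distr_r_reverse exp_Ropp Rinv_inv | lra].
(* The loss of radius in the doubling. It enters the logarithm as [2 ln q <= 2 q], and
   [u x * (r / 8) <= 4 * d * u z] compensates it, since it says [u x * q <= 4 * u z]. *)
set q := r / 8 / d.
have q1 : 1 <= q.
  by apply: (Rmult_le_reg_r d) => //; rewrite /q /Rdiv Rmult_assoc Rinv_l; lra.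
have qE : q = r / 8 / d by [].
clearbody q.
set sigma := d * exp (- (A / INR n)).
have An : 0 < A / INR n by apply: Rdiv_lt_0_compat; lra.
have es : 0 < exp (- (A / INR n)) < 1.
  by split; [exact: exp_pos | rewrite -exp_0; apply: exp_increasing; lra].
have hs : 0 < sigma <= d.
  split; first by apply: Rmult_lt_0_compat; lra.
  by rewrite /sigma; nra.
have fA' y : sqdist n z y <= sigma ^ 2 -> - iter_lap D m [::] y <= exp A.
  move=> hy; apply: fA.
  apply: Rsqr_incr_0_var; last lra; rewrite !Rsqr_pow2 -sqdist_norm.
  by apply: Rle_trans hy _; apply: pow_incr; lra.
have locz := loc z (r / 8) sigma A ltac:(lra) ltac:(lra) ltac:(lra) uz fA'.
have meanx := mean x ltac:(rewrite -/r; lra).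
(* The small mass is available only for frequently many meshes, the other two bounds for all large
   ones; a single common [N] is enough. *)
have [N [[hN1 hN2] hN3]] := small x ltac:(rewrite -/r; lra) _ (filter_and _ _ locz meanx).
rewrite -/r in hN1 hN2 hN3.
set Sf := rsum n N (fun y => - iter_lap D m [::] y * indic 0 _ _) in hN1.
set Su := rsum n N (fun y => u y * indic 0 ((r / 8) ^ 2) _) in hN1.
set E := Rpower r (- (a * (1 - lam))).
have rr : 0 < r ^ 2 by apply: pow_lt.
have Epow : E = / (r ^ 2) ^ (m - 1).
  rewrite /E al Rpower_Ropp -pow_mult -Rpower_pow //; congr (/ Rpower _ _).
  rewrite (_ : Nat.mul 2 (m - 1) = Nat.sub n 2); last by rewrite mn; lia.
  by rewrite minus_INR; [rewrite /=; ring | lia].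
have E1 : 1 <= E.
  rewrite Epow -Rinv_1; apply: Rinv_le_contravar; first exact: pow_lt.
  by rewrite -(pow1 (m - 1)); apply: pow_incr; nra.
have inclusion y : indic 0 ((r / 8) ^ 2) (sqdist n z y) <= indic 0 ((r / 4) ^ 2) (sqdist n x y).
  case: (indic_spec 0 ((r / 8) ^ 2) (sqdist n z y)) => -[h ->].
    rewrite indic1; first lra.
    split; first exact: sqdist_ge0.
    rewrite sqdist_norm; apply: pow_incr; split; first exact: norm_ge0.
    apply: zball; apply: Rsqr_incr_0_var; last lra.
    by rewrite !Rsqr_pow2 -sqdist_norm; lra.
  by have := indic01 0 ((r / 4) ^ 2) (sqdist n x y); lra.
have xin y : 0 <= sqdist n x y <= (r / 4) ^ 2 -> 3 / 4 * r <= norm y <= 5 / 4 * r.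
  move=> h; apply: ball; apply: Rsqr_incr_0_var; last lra.
  by rewrite !Rsqr_pow2 -sqdist_norm; lra.
have SuE : Su <= C1 * r ^ 2.
  apply: Rle_trans hN2; apply: rsum_le => y.
  have inc := inclusion y.
  case: (indic_spec 0 ((r / 4) ^ 2) (sqdist n x y)) inc => -[h ->] inc.
    have hb := xin y h; apply: Rmult_le_compat_l => //; apply: u0; split; lra.
  have := indic01 0 ((r / 8) ^ 2) (sqdist n z y) => i01.
  by rewrite (_ : indic 0 ((r / 8) ^ 2) (sqdist n z y) = 0); lra.
(* On the annulus [|y|^2 >= r^2 / 4], so removing the weight [|y|^(2m-2)] costs the factor
   [4^(m-1) r^(2-n)]. *)
have SfE : Sf <= eta * (4 ^ (m - 1) * E).
  have -> : 4 ^ (m - 1) * E = (4 / r ^ 2) ^ (m - 1).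
    by rewrite Epow /Rdiv Rpow_mult_distr pow_inv.
  rewrite Rmult_comm; apply: Rle_trans (Rmult_le_compat_l _ _ _ _ hN3); last first.
    by apply: pow_le; apply: Rlt_le; apply: Rdiv_lt_0_compat; lra.
  rewrite -rsum_scal; apply: rsum_le => y.
  have inc := inclusion y.
  have y0 := norm_ge0 n y.
  case: (indic_spec 0 ((r / 8) ^ 2) (sqdist n z y)) inc => -[h ->] inc; last first.
    rewrite Rmult_0_r; apply: Rmult_le_pos.
      by apply: pow_le; apply: Rlt_le; apply: Rdiv_lt_0_compat; lra.
    by apply: (weighted_ge0 m n D lap0); nra.
  have [h' e'] : 0 <= sqdist n x y <= (r / 4) ^ 2 /\ True.
    split=> //; case: (indic_spec 0 ((r / 4) ^ 2) (sqdist n x y)) inc => -[hh ->] //; lra.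
  have hb := xin y h'.
  have py : punct_ball2 y by split; lra.
  rewrite indic1; last by split; nra.
  have fy := lap0 y py.
  have -> : (4 / r ^ 2) ^ (m - 1) * (- iter_lap D m [::] y * (norm y ^ 2) ^ (m - 1) * 1) =
     - iter_lap D m [::] y * (4 / r ^ 2 * norm y ^ 2) ^ (m - 1).
    by rewrite Rpow_mult_distr; ring.
  apply: Rmult_le_compat_l => //; rewrite -(pow1 (m - 1)); apply: pow_incr; split; first lra.
  apply: (Rmult_le_reg_r (r ^ 2)) => //.
  have -> : 4 / r ^ 2 * norm y ^ 2 * r ^ 2 = 4 * norm y ^ 2 by field; lra.
  nra.
(* The argument equals [2 q^2 e^(2 A / n)], and [n >= 6] gives [2 A / n <= A]. *)
have lnE : ln (2 * (r / 8) ^ 2 / sigma ^ 2) <= 1 + 2 * q + A.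
  have -> : 2 * (r / 8) ^ 2 / sigma ^ 2 = 2 * (q * q * (exp (A / INR n) * exp (A / INR n))).
    rewrite /sigma qE exp_Ropp; field.
    by repeat split; try lra; apply: Rgt_not_eq; exact: exp_pos.
  have ep := exp_pos (A / INR n).
  rewrite !ln_mult ?ln_exp; try lra; try (repeat apply: Rmult_lt_0_compat; lra).
  have l2 : ln 2 <= 1.
    by rewrite -(ln_exp 1); apply: ln_le; [lra | have := exp_ineq1 1; lra].
  have lq : ln q <= q.
    by rewrite -{2}(ln_exp q); apply: ln_le; [lra | have := exp_ineq1_le q; lra].
  have An2 : A / INR n <= A / 2.
    by apply: Rmult_le_compat_l; [lra | apply: Rinv_le_contravar; lra].
  lra.
have expE : exp A * sigma ^ n <= 1.
  rewrite /sigma Rpow_mult_distr exp_pow_INR.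
  have -> : INR n * - (A / INR n) = - A by field; lra.
  have -> : exp A * (d ^ n * exp (- A)) = d ^ n.
    by rewrite exp_Ropp; field; apply: Rgt_not_eq; exact: exp_pos.
  by rewrite -(pow1 n); apply: pow_incr; lra.
(* From [Su <= C1 * r^2], division by [(r / 8)^n] produces [r^(2-n) = E] and the factor [8^n]. *)
have SuE' : C / (r / 8) ^ n * Su <= C * C1 * 8 ^ n * E.
  have rn : (r / 8) ^ n = r ^ 2 * (r ^ 2) ^ (m - 1) / 8 ^ n.
    rewrite /Rdiv Rpow_mult_distr pow_inv; congr (_ * _).
    rewrite -[X in X * _](pow_1 (r ^ 2)) -pow_add -pow_mult; congr pow; rewrite mn; lia.
  have rm : 0 < (r ^ 2) ^ (m - 1) by apply: pow_lt.
  have -> : C * C1 * 8 ^ n * E = C / (r / 8) ^ n * (C1 * r ^ 2).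
    by rewrite rn Epow; field; lra.
  apply: Rmult_le_compat_l => //; left; apply: Rdiv_lt_0_compat => //; apply: pow_lt; lra.
have q8 : q * d = r / 8 by rewrite qE; field; lra.
apply: (absorb r (u z) q) => //; rewrite -/Y -/E.
- lra.
- have : u x * q <= 4 * u z.
    by apply: (Rmult_le_reg_r d) => //; rewrite Rmult_assoc q8; lra.
  nra.
- lra.
- have : u x * q <= 4 * u z.
    by apply: (Rmult_le_reg_r d) => //; rewrite Rmult_assoc q8; lra.
  by have := Rmult_le_compat_r q _ _ ltac:(lra) (Rlt_le _ _ big); lra.
rewrite -/A.
have P1 : Sf * ln (2 * (r / 8) ^ 2 / sigma ^ 2) <= eta * (4 ^ (m - 1) * E) * (1 + 2 * q + A).
  have X0 : 0 <= 1 + 2 * q + A by lra.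
  have Sf0 : 0 <= Sf.
    apply: rsum_ge0 => y; have inc := inclusion y.
    case: (indic_spec 0 ((r / 8) ^ 2) (sqdist n z y)) inc => -[h ->] inc; last lra.
    rewrite Rmult_1_r; apply: lap0.
    have h' : 0 <= sqdist n x y <= (r / 4) ^ 2.
      by case: (indic_spec 0 ((r / 4) ^ 2) (sqdist n x y)) inc => -[hh ->] //; lra.
    by have := xin y h'; split; lra.
  apply: (Rle_trans _ (Sf * (1 + 2 * q + A))); first exact: Rmult_le_compat_l.
  exact: Rmult_le_compat_r.
have P2 : C * (exp A * sigma ^ n) <= C * E by apply: Rmult_le_compat_l; lra.
move: P1 P2 SuE' hN1 E1.
move: (Sf * _) (C * (exp A * _)) (C / _ * Su) => v1 v2 v3.
set v4 := eta * _ * _ => P1 P2 P3 hN1 E1.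
lra.
Qed.
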